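(* Let $\mathfrak{T}$ be a polytopal tiling of $\mathbb{R}^d$ with Euclidean finite local complexity, and let $G$ be a unital ring. Suppose that, for some $K\in\mathbb{N}$, the coefficient ring $G$ has division by the order $\#\mathrm{Iso}(c,K)$ of the isotropy group $\mathrm{Iso}(c,K)$ for every cell $c$ of $\mathfrak{T}$. Then there is an isomorphism (ePE Poincaré duality) $H^{\bullet}(\mathfrak{T}^0;G)\cong H_{d-\bullet}(\mathfrak{T}^0;G)$ between the ePE cohomology and the ePE homology of $\mathfrak{T}$ over $G$.
   Context: **Tilings.** A cellular tiling of $\mathbb{R}^d$ is a pair $\mathfrak{T}=(\mathcal{T},l)$, where $\mathcal{T}$ is a regular CW decomposition of $\mathbb{R}^d$ and $l$ is a labelling, i.e. a map from the cells of $\mathcal{T}$ to some set of labels. ''Cell'' means closed cell. The tiling is polytopal if its cells are convex polytopes. A tile is a $d$-cell. A patch is a finite subcomplex of $\mathcal{T}$ together with the restricted labelling; equivalences of patches respect cells and labels. A rigid motion is an orientation-preserving isometry of $\mathbb{R}^d$. $\mathfrak{T}$ has Euclidean finite local complexity (eFLC) if for every $r>0$ there are only finitely many patches of diameter at most $r$ up to rigid motion. **Coronas and isotropy.** The $0$-corona of a tile $t$ is the patch whose only tile is $t$; for $i\ge 1$ the $i$-corona of $t$ is the patch of tiles having non-empty intersection with the $(i-1)$-corona of $t$. The $i$-corona of a lower dimensional cell is the intersection of the $i$-coronas of the tiles containing it. For a cell $c$, $\mathrm{Iso}(c,i)$ is the group of rigid motions mapping $c$ to itself and preserving its $i$-corona.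 Here $\mathbb{N}=\{1,2,\dots\}$ and $\mathbb{N}_0=\mathbb{N}\cup\{0\}$. **Division.** A unital ring $G$ has division by $n$ if $n\cdot 1_G=1_G+\cdots+1_G$ ($n$ summands) has a multiplicative inverse in $G$. **ePE (co)homology.** Let $C^\bullet(\mathcal{T};G)$ be the cellular cochain complex and $C_\bullet^{\mathrm{BM}}(\mathcal{T};G)$ the cellular Borel–Moore (possibly infinite) chain complex with coefficients in $G$; a (co)chain assigns to each oriented cell $\omega_c$ an element of $G$, with opposite values on opposite orientations. A $k$-cochain $\psi$ is Euclidean pattern-equivariant (ePE) if there is some $i\in\mathbb{N}_0$ such that $\psi(\omega_c)=\psi(f_*(\omega_c))$ whenever $f$ is a rigid motion taking a $k$-cell $c$ to a $k$-cell $f(c)$ and the $i$-corona of $c$ to the $i$-corona of $f(c)$, where $\omega_c$ is an orientation of $c$ and $f_*(\omega_c)$ its push-forward. The same definition applies to Borel–Moore chains. ePE cochains form a subcomplex $C^\bullet(\mathfrak{T}^0;G)$ with cohomology $H^\bullet(\mathfrak{T}^0;G)$, and ePE chains form a subcomplex $C_\bullet(\mathfrak{T}^0;G)$ of the Borel–Moore complex with homology $H_\bullet(\mathfrak{T}^0;G)$. *)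

(* Defs.v *)
From HB Require Import structures.
From mathcomp Require Import all_boot all_order all_algebra.
From mathcomp Require Import finmap.
From mathcomp Require Import all_classical all_reals all_analysis.
Import Order.TTheory GRing.Theory Num.Theory.
Import numFieldNormedType.Exports.

Set Implicit Arguments.
Unset Strict Implicit.
Unset Printing Implicit Defensive.

Local Open Scope classical_set_scope.
Local Open Scope ring_scope.

Section Geometry.
Variables (R : realType) (d : nat).
Local Notation E := 'rV[R]_d.
Implicit Types (c : set E) (f : E -> E).

(* The library norm on 'rV is the sup norm, hence a separate Euclidean
   distance. *)
Definition edist (x y : E) : R :=
  Num.sqrt (\sum_(i < d) (x 0 i - y 0 i) ^+ 2).

Definition polytope c := exists n (p : 'I_n.+1 -> E),
  c = [set x | exists a : 'I_n.+1 -> R,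
         [/\ forall i, 0 <= a i, \sum_i a i = 1 & x = \sum_i a i *: p i]].

Definition affine_hull c : set E :=
  [set x | exists n (p : 'I_n -> E) (a : 'I_n -> R),
     [/\ forall i, c (p i), \sum_i a i = 1 & x = \sum_i a i *: p i]].

Definition relint c : set E :=
  [set x | c x /\ exists2 e : R, 0 < e &
     forall y, affine_hull c y -> edist x y < e -> c y].

(* The rows of B are a basis of the direction space of c. *)
Definition frame k c (B : 'M[R]_(k, d)) := row_free B /\
  forall v : E, (v <= B)%MS <->
    exists x y, [/\ affine_hull c x, affine_hull c y & v = y - x].

Definition has_dim k c := exists B : 'M[R]_(k, d), frame c B.

(* An isometry f is affine, of the form x |-> x *m linpart f + f 0. *)
Definition linpart f : 'M[R]_d := lin1_mx (fun v => f v - f 0).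

Definition rigid_motion f :=
  (forall x y, edist (f x) (f y) = edist x y) /\ 0 < \det (linpart f).

(* An orientation of a k-dimensional c assigns a sign to every ordered basis
   of the direction space of c, compatibly with changes of basis; it is set to
   0 on matrices that are not such bases. For k = 0 the only basis is the empty
   one, so that a point also has two orientations. *)
Definition is_orientation k c (w : 'M[R]_(k, d) -> int) :=
  [/\ has_dim k c,
      forall B, frame c B -> w B = 1 \/ w B = -1,
      forall (A : 'M[R]_k) B, frame c B -> w (A *m B) = sgz (\det A) * w B
    & forall B, ~ frame c B -> w B = 0].

End Geometry.

Section Tiling.
Variables (R : realType) (d : nat) (L : Type).
Local Notation E := 'rV[R]_d.

(* A convex polytope of dimension k is homeomorphic to a closed k-ball, with
   relative interior corresponding to the open ball; characteristic maps that
   are homeomorphisms onto the closed cells are therefore automatic. The last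
   three fields are the CW axioms: the open cells partition the space, the
   boundary of a k-cell lies in finitely many cells of dimension < k, and the
   topology is the weak one. *)
Record polytopal_CW (C : set (set E)) : Prop := PolytopalCW {
  CW_polytope : forall c, C c -> polytope c ;
  CW_partition : forall x, exists! c, C c /\ relint c x ;
  CW_closure_finite : forall k c, C c -> has_dim k c ->
    exists S : set (set E),
      [/\ finite_set S, S `<=` C,
          forall c', S c' -> exists2 j, (j < k)%N & has_dim j c'
        & c `\` relint c `<=` \bigcup_(c' in S) c'] ;
  CW_weak_topology : forall A : set E,
    (forall c, C c -> closed (A `&` c)) -> closed A
}.

(* Only the values of the labelling on cells are ever used. *)
Record polytopal_tiling := PolytopalTiling {
  cells : set (set E) ;
  cells_CW : polytopal_CW cells ;
  label : set E -> L
}.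

Variable T : polytopal_tiling.
Implicit Types (c t : set E) (P Q : set (set E)) (f : E -> E).

Definition tile t := cells T t /\ has_dim d t.

Definition subcomplex P := P `<=` cells T /\
  forall c c', P c -> cells T c' -> c' `<=` c -> P c'.

Definition patch P := finite_set P /\ subcomplex P.

Definition maps_patch f P Q :=
  [set f @` c | c in P] = Q /\ forall c, P c -> label T (f @` c) = label T c.

Definition diam_le P (r : R) := forall c c' x y,
  P c -> P c' -> c x -> c' y -> edist x y <= r.

Definition eFLC := forall r : R, 0 < r ->
  exists S : set (set (set E)),
    [/\ finite_set S, S `<=` patch
      & forall P, patch P -> diam_le P r ->
          exists2 Q, S Q & exists2 f, rigid_motion f & maps_patch f P Q].

Definition subcomplex_of_tiles (U : set (set E)) : set (set E) :=
  [set c | cells T c /\ exists2 t, U t & c `<=` t].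

Fixpoint tile_corona (i : nat) t : set (set E) :=
  match i with
  | 0 => subcomplex_of_tiles [set t]
  | j.+1 => subcomplex_of_tiles
      [set t' | tile t' /\ exists2 c, tile_corona j t c & c `&` t' !=set0]
  end.

Definition corona (i : nat) c : set (set E) :=
  [set c' | cells T c' /\
     forall t, tile t -> c `<=` t -> tile_corona i t c'].

Definition maps_corona f i c c' :=
  [/\ rigid_motion f, f @` c = c' & maps_patch f (corona i c) (corona i c')].

Definition Iso c i : set (E -> E) := [set f | maps_corona f i c c].

(* Fields: an oriented k-cell. *)
Record ocell (k : nat) := OCell {
  oc_cell : set E ;
  oc_or : 'M[R]_(k, d) -> int ;
  oc_cellP : cells T oc_cell ;
  oc_orP : is_orientation oc_cell oc_or
}.

HB.instance Definition _ k := gen_eqMixin (ocell k).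
HB.instance Definition _ k := gen_choiceMixin (ocell k).

Definition opposite k (o o' : ocell k) :=
  oc_cell o' = oc_cell o /\ forall B, oc_or o' B = - oc_or o B.

Definition pushforward f k (o o' : ocell k) :=
  oc_cell o' = f @` oc_cell o /\
  forall B, oc_or o' (B *m linpart f) = oc_or o B.

(* o' is a face of o carrying the boundary orientation, with the convention
   that an outward pointing vector comes first: y - x points outwards along the
   face when x lies in the relative interior and y on the face. *)
Definition oriented_face k (o : ocell k.+1) (o' : ocell k) :=
  oc_cell o' `<=` oc_cell o /\
  forall x y B, relint (oc_cell o) x -> oc_cell o' y -> frame (oc_cell o') B ->
    oc_or o' B = oc_or o (col_mx (y - x) B).

Section Chains.
Variable G : pzRingType.

(* G^o is G as a left module over itself. The same functions serve as cellular
   cochains and as Borel-Moore chains, as no finiteness is imposed on either. *)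
Definition chain k := ocell k -> G^o.

Definition alternating k (s : chain k) :=
  forall o o', opposite o o' -> s o' = - s o.

Definition pattern_equivariant k (s : chain k) := exists i : nat,
  forall f o o', maps_corona f i (oc_cell o) (oc_cell o') ->
    pushforward f o o' -> s o = s o'.

Definition ePE k : set (chain k) :=
  [set s | alternating s /\ pattern_equivariant s].

(* Both sums are finite, by closure finiteness and local finiteness. *)
Definition coboundary k (s : chain k) : chain k.+1 :=
  fun o => \sum_(o' \in [set o' | oriented_face o o']) s o'.

Definition boundary k (s : chain k.+1) : chain k :=
  fun o' => \sum_(o \in [set o | oriented_face o o']) s o.

Definition cocycles k : set (chain k) :=
  [set s | ePE s /\ coboundary s = 0].

Definition coboundaries k : set (chain k) :=
  match k with
  | 0 => [set 0]
  | j.+1 => [set coboundary s | s in @ePE j]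
  end.

Definition cycles k : set (chain k) :=
  match k with
  | 0 => @ePE 0
  | j.+1 => [set s | ePE s /\ boundary s = 0]
  end.

Definition boundaries k : set (chain k) :=
  [set boundary s | s in @ePE k.+1].

End Chains.
End Tiling.

Section Quotient.
Variable G : pzRingType.

Definition add_coset (V : lmodType G) (B : set V) (z : V) : set V :=
  [set z + b | b in B].

(* The elements of the quotient module Z / B of submodules of V. *)
Definition quotient_mod (V : lmodType G) (Z B : set V) : set (set V) :=
  [set add_coset B z | z in Z].

(* Z / B and Z' / B' are isomorphic G-modules: there is a bijection F between
   them which is G-linear, the operations on classes being those of
   representatives. *)
Definition quotient_iso (V W : lmodType G) (Z B : set V) (Z' B' : set W) :=
  exists2 F : set V -> set W, set_bij (quotient_mod Z B) (quotient_mod Z' B') F &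
    forall (a : G) z1 z2 w1 w2, Z z1 -> Z z2 -> Z' w1 -> Z' w2 ->
      F (add_coset B z1) = add_coset B' w1 -> F (add_coset B z2) = add_coset B' w2 ->
      F (add_coset B (a *: z1 + z2)) = add_coset B' (a *: w1 + w2).

End Quotient.

(* H^k(T^0; G) is isomorphic to H_m(T^0; G). *)
Definition ePE_cohomology_iso_homology (R : realType) (d : nat) (L : Type)
    (T : polytopal_tiling R d L) (G : pzRingType) (k m : nat) : Prop :=
  @quotient_iso G (chain T G k) (chain T G m)
    (@cocycles R d L T G k) (@coboundaries R d L T G k)
    (@cycles R d L T G m) (@boundaries R d L T G m).

Definition division_by (G : pzRingType) (n : nat) :=
  exists x : G, x * n%:R = 1 /\ n%:R * x = 1.

(* #Iso(c, i); fset_set is empty on infinite sets, but Iso(c, i) is finite for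
   i >= 1 because the 1-corona of c contains all the tiles around c. *)
Definition iso_order (R : realType) (d : nat) (L : Type)
    (T : polytopal_tiling R d L) (c : set 'rV[R]_d) (i : nat) : nat :=
  #|` fset_set (Iso T c i)|.

(* Main.v *)
(* Let D(p,q) be the module of ePE functions on the pairs b <= c of cells with
   dim b = p and dim c = q, with the coboundary acting in b and the boundary in
   c. For fixed c a row computes the cohomology of the ball c, and for fixed b a
   column computes the Borel-Moore homology of the open star of b, so rows and
   columns are exact up to the functions that are constant on the vertices of
   c, respectively on the tiles around b. Functions constant on the tiles are
   ePE cochains in b, functions constant on the vertices are ePE chains in c,
   and the zigzag through the double complex identifies the two homologies.

   Solutions found cell by cell are made equivariant by averaging over the rigid
   motions taking the i-corona of a cell to that of a chosen representative r;
   these form a torsor under Iso(r,i), whose order divides that of Iso(r,K) when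
   i >= K by Lagrange's theorem.

   Locally, the star of b and the proper faces of c are fans of relatively open
   cones covering a linear space W. Cutting a fan by a hyperplane preserves and
   reflects exactness, and cutting both a fan and the one-cone fan {W} by all
   hyperplanes that separate the cones of the former gives the same result. *)
Require Import Defs.
From HB Require Import structures.
From mathcomp Require Import all_boot all_order all_algebra.
From mathcomp Require Import all_classical all_reals all_analysis.
From mathcomp Require Import perm finmap ring lra zify.
Import Order.TTheory GRing.Theory Num.Theory.
Import numFieldNormedType.Exports.
(* Again, because mathcomp-analysis has another [edist]. *)
Require Import Defs.

Set Implicit Arguments.
Unset Strict Implicit.
Unset Printing Implicit Defensive.

Local Open Scope classical_set_scope.
Local Open Scope ring_scope.

Local Notation "x <:= M" := (@submx _ _ _ _ x%R M) (at level 70, no associativity).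

Ltac vec := apply/rowP => ?; rewrite !mxE; first [lra | ring].

(** * Orientation signs *)

(** The faces of a cell are cells of the decomposition and not the geometric faces of a polytope: a
    facet may be subdivided, so that face lattices and shellings do not apply. This is why fans are
    arbitrary partitions of a space into relatively open cones with a frontier condition, and why
    the frontier condition for cells has to be extracted from the CW axioms. Every subspace gets one
    reference basis, against which all signs are measured. Oriented cochains become functions on
    cells that rigid motions twist by signs, and the top-dimensional cones of a fan are coherently
    oriented, as they share one direction space. Rigid motions have sign 1 on tiles and on vertices,
    so functions constant on these can be identified with cochains and chains. Rows are solved
    equivariantly around [c], columns around [b]. A motion that respects the corona of a cell
    respects slightly smaller coronas of all incident cells, so passing from one to the other costs
    only an increase of the radius. The choices in the zigzag are neither unique nor linear, so the
    isomorphism is first a relation between representatives. *)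

Section LinearAlgebra.
Variables (R : realType) (d : nat).
Local Notation E := 'rV[R]_d.
Implicit Types (U : set E) (M : 'M[R]_d).

(** Among the matrices whose row space lies in [U] take one of maximal rank; a vector of [U] outside
    its row space could be added to it. *)
Lemma subspace_mx U : U 0 -> (forall a x y, U x -> U y -> U (a *: x + y)) ->
  exists M, forall v, U v <-> v <:= M.
Proof.
move=> U0 Ulin.
pose P r := `[< exists M, \rank M = r /\ forall v, v <:= M -> U v >].
have exP : exists r, P r.
  exists 0%N; apply/asboolP; exists 0; split; first by rewrite mxrank0.
  by move=> v; rewrite submx0 => /eqP ->.
have leP r : P r -> (r <= d)%N.
  by move=> /asboolP[M [<- _]]; exact: rank_leq_col.
case: (ex_maxnP exP leP) => r /asboolP[M [rM MU]] maxr.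
exists M => v; split=> [Uv|]; last exact: MU.
apply: contraT => vM.
suff: P r.+1 by move=> /maxr; rewrite ltnn.
apply/asboolP; exists (M + v)%MS; split.
  rewrite -rM; apply/eqP; rewrite eqn_leq; apply/andP; split.
    apply: leq_trans (mxrank_adds_leqif _ _) _.
    by have := rank_leq_row v; lia.
  by rewrite (ltn_leqif (mxrank_leqif_sup (addsmxSl _ _))) addsmx_sub submx_refl.
move=> u /sub_addsmxP[[a b] /= ->].
have -> : b *m v = b 0 0 *: v.
  by rewrite [b]mx11_scalar mul_scalar_mx !mxE eqxx mulr1n.
by rewrite addrC; apply: Ulin => //; apply: MU; rewrite submxMl.
Qed.

Lemma scale_add_inj (r : R) (w u : E) (M : 'M[R]_d) (t t' : R) :
  w + t *: u <:= M -> w + t' *: u <:= M -> t != t' ->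
  w <:= M /\ u <:= M.
Proof.
move=> h h' tt'.
have uM : u <:= M.
  have: (w + t *: u) - (w + t' *: u) <:= M by apply: addmx_sub => //; rewrite -scaleN1r scalemx_sub.
  by rewrite opprD addrACA subrr add0r -scalerBl eqmx_scale ?subr_eq0.
split=> //; have: (w + t *: u) - t *: u <:= M.
  by apply: addmx_sub => //; rewrite -scaleNr scalemx_sub.
by rewrite addrK.
Qed.

(** A line meets a subspace that does not contain it in at most one point, so finitely many such
    subspaces leave an initial interval free. *)
Lemma avoid_line (Ms : seq 'M[R]_d) (w u : E) :
  {in Ms, forall M, ~~ ((w <:= M) && (u <:= M))} ->
  exists2 r : R, 0 < r & forall t, 0 < t -> t < r ->
    {in Ms, forall M, ~~ (w + t *: u <:= M)}.
Proof.
elim: Ms => [|M Ms IH] h; first by exists 1.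
have [|r r0 hr] := IH; first by move=> N NMs; apply: h; rewrite inE NMs orbT.
have [[s [s0 sM]]|no] :=
    pselect (exists s, 0 < s /\ w + s *: u <:= M); last first.
  exists r => // t t0 tr N; rewrite inE => /orP[/eqP->|]; last exact: hr.
  by apply/negP => k; apply: no; exists t.
exists (Num.min r s); first by rewrite lt_min r0.
move=> t t0; rewrite lt_min => /andP[tr ts] N; rewrite inE => /orP[/eqP->|].
  apply/negP => k; have := h M (mem_head _ _).
  by have [|-> ->] := scale_add_inj r k sM; first by rewrite lt_eqF.
exact: hr.
Qed.

(** General position over an infinite field: a vector that avoids all but one of the subspaces is
    moved slightly along a row of [D] outside the last one. *)
Lemma avoid_subspaces (D : 'M[R]_d) (Ms : seq 'M[R]_d) :
  {in Ms, forall M, ~~ (D <= M)%MS} ->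
  exists2 u : E, u <:= D & {in Ms, forall M, ~~ (u <:= M)}.
Proof.
elim: Ms => [|M Ms IH] h; first by exists 0; rewrite ?sub0mx.
have [|u uD hu] := IH; first by move=> N NMs; apply: h; rewrite inE NMs orbT.
have /row_subPn[i iM] := h M (mem_head _ _).
have [|r r0 hr] := @avoid_line (M :: Ms) u (row i D).
  move=> N; rewrite inE => /orP[/eqP->|/hu /negPf->//].
  by rewrite (negPf iM) andbF.
exists (u + (r / 2) *: row i D); last by apply: hr; lra.
by rewrite addmx_sub // scalemx_sub // row_sub.
Qed.

End LinearAlgebra.

Section Orientation.
Variables (R : realType) (d : nat).
Local Notation E := 'rV[R]_d.

(* U is the canonical matrix <<B>> of a subspace. *)
Definition ref_basis k (U : 'M[R]_d) : 'M[R]_(k, d) :=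
  xget 0 [set B : 'M[R]_(k, d) | row_free B /\ <<B>>%MS = U].

(** The reference basis depends on [B] only through its row space, so [bsgn] orients every subspace
    once and for all. *)
Definition bsgn k (B : 'M[R]_(k, d)) : int :=
  if row_free B then sgz (\det (B *m pinvmx (ref_basis k <<B>>%MS))) else 0.

Lemma ref_basisP k (B : 'M[R]_(k, d)) : row_free B ->
  row_free (ref_basis k <<B>>%MS) /\ (ref_basis k <<B>>%MS :=: B)%MS.
Proof.
move=> fB; have [|fC eC] := @xgetPex _ 0
    [set C : 'M[R]_(k, d) | row_free C /\ <<C>>%MS = <<B>>%MS]; first by exists B.
by split=> //; apply/eqmxP/genmxP.
Qed.

Lemma bsgn_coord_unit k (B C : 'M[R]_(k, d)) : row_free B -> (B :=: C)%MS ->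
  \det (B *m pinvmx C) != 0.
Proof.
move=> fB eBC; rewrite -unitfE -unitmxE -row_free_unit.
rewrite /row_free eqn_leq rank_leq_row /=.
have {1}<- : \rank B = k by apply/eqP.
by rewrite -{1}(@mulmxKpV _ _ _ _ B C) ?eBC // mxrankM_maxl.
Qed.

Lemma bsgn_free k (B : 'M[R]_(k, d)) : row_free B -> bsgn B = 1 \/ bsgn B = -1.
Proof.
move=> fB; rewrite /bsgn fB; have [_ /eqmx_sym eB] := ref_basisP fB.
have := bsgn_coord_unit fB eB; case: sgzP => // _ _; [by left|by right].
Qed.

Lemma bsgn_sq k (B : 'M[R]_(k, d)) : row_free B -> bsgn B * bsgn B = 1.
Proof. by move=> /bsgn_free[]->. Qed.

Lemma bsgn_mul k (A : 'M[R]_k) (B : 'M[R]_(k, d)) :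
  row_free B -> bsgn (A *m B) = sgz (\det A) * bsgn B.
Proof.
move=> fB; have [A0|uA] := eqVneq (\det A) 0.
  rewrite A0 sgz0 mul0r /bsgn ifN // /row_free neq_ltn; apply/orP; left.
  apply: leq_ltn_trans (mxrankM_maxl _ _) _.
  rewrite ltn_neqAle rank_leq_row andbT -/(row_free A) row_free_unit.
  by rewrite unitmxE A0 unitr0.
have uA' : A \in unitmx by rewrite unitmxE unitfE.
have eAB : (A *m B :=: B)%MS by apply: eqmxMfull; rewrite row_full_unit.
have fAB : row_free (A *m B) by rewrite /row_free eAB.
by rewrite /bsgn fB fAB (eq_genmx eAB) -mulmxA det_mulmx sgzM.
Qed.

Lemma bsgn_basis_eq k (B C : 'M[R]_(k, d)) : row_free B -> (B :=: C)%MS ->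
  exists A : 'M[R]_k, B = A *m C /\ \det A != 0.
Proof.
move=> fB eBC; exists (B *m pinvmx C); rewrite mulmxKpV ?eBC //.
by split=> //; exact: bsgn_coord_unit.
Qed.

Lemma row_free_col_mx k (B : 'M[R]_(k, d)) (v : E) :
  row_free B -> row_free (col_mx v B) = ~~ (v <:= B).
Proof.
move=> /eqP rB; rewrite /row_free -addsmxE.
case: (boolP (v <:= B)) => vB /=.
  by rewrite (addsmx_idPr vB) rB add1n; apply/negbTE; rewrite neq_ltn ltnSn.
rewrite eqn_leq; apply/andP; split.
  by rewrite addsmxE rank_leq_row.
have : (\rank B < \rank (v + B)%MS)%N.
  by rewrite (ltn_leqif (mxrank_leqif_sup (addsmxSr _ _))) addsmx_sub submx_refl andbT.
by rewrite rB add1n.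
Qed.

(** The change of basis is block triangular with diagonal blocks [a] and [A]. When [u] lies in the
    span of [B], both sides are 0. *)
Lemma bsgn_colE k (B : 'M[R]_(k, d)) (u v : E) (a : R) (A : 'M[R]_k) :
  row_free B -> v - a *: u <:= B ->
  bsgn (col_mx v (A *m B)) = sgz a * sgz (\det A) * bsgn (col_mx u B).
Proof.
move=> fB /submxP[x ex].
have -> : col_mx v (A *m B) = block_mx a%:M x 0 A *m col_mx u B.
  rewrite mul_block_col mul0mx add0r mul_scalar_mx -ex.
  by rewrite addrC subrK.
have [uB|uB] := boolP (u <:= B); last first.
  by rewrite bsgn_mul ?row_free_col_mx // det_ublock det_scalar1 sgzM.
have h0 C : ~~ row_free C -> @bsgn k.+1 C = 0 by move=> h; rewrite /bsgn ifN.
rewrite (h0 (col_mx u B)) ?mulr0; last by rewrite row_free_col_mx ?uB.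
apply: (h0 (_ *m _)); apply: contraL uB => /eqP rf.
rewrite -row_free_col_mx // /row_free eqn_leq rank_leq_row /=.
by rewrite -{1}[(1 + k)%N]rf mxrankM_maxr.
Qed.

Lemma bsgn_col_pos k (B : 'M[R]_(k, d)) (u v : E) (a : R) :
  row_free B -> 0 < a -> v - a *: u <:= B ->
  bsgn (col_mx v B) = bsgn (col_mx u B).
Proof.
move=> fB a0 h; have := @bsgn_colE k B u v a 1%:M fB h.
by rewrite mul1mx det1 sgz1 gtr0_sgz // !mul1r.
Qed.

Lemma bsgn_col_neg k (B : 'M[R]_(k, d)) (u v : E) (a : R) :
  row_free B -> 0 < a -> v + a *: u <:= B ->
  bsgn (col_mx v B) = - bsgn (col_mx u B).
Proof.
move=> fB a0 h; have := @bsgn_colE k B u v (- a) 1%:M fB.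
by rewrite scaleNr opprK mul1mx det1 sgz1 ltr0_sgz ?oppr_lt0 // mulr1 mulN1r; apply.
Qed.

Lemma bsgn_swap k (B : 'M[R]_(k, d)) (u v : E) :
  row_free (col_mx u (col_mx v B)) ->
  bsgn (col_mx v (col_mx u B)) = - bsgn (col_mx u (col_mx v B)).
Proof.
move=> f.
pose i0 : 'I_(1 + (1 + k)) := lshift _ 0; pose i1 : 'I_(1 + (1 + k)) := rshift _ (lshift _ 0).
have -> : col_mx v (col_mx u B) = tperm_mx i0 i1 *m col_mx u (col_mx v B).
  rewrite -xrowE; apply/matrixP => i j; rewrite [RHS]mxE.
  case: (split_ordP i) => i' ->; [rewrite (ord1 i') tpermL|case: (split_ordP i') => i'' ->].
  - by rewrite col_mxEd !col_mxEu.
  - by rewrite (ord1 i'') tpermR col_mxEd !col_mxEu.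
  by rewrite tpermD ?col_mxEd // -val_eqE.
rewrite bsgn_mul // det_perm odd_tperm.
have -> : i0 != i1 by rewrite -val_eqE.
by rewrite expr1 ltr0_sgz ?oppr_lt0 // mulN1r.
Qed.

End Orientation.

(** * Direction spaces and incidence numbers *)

Section Directions.
Variables (R : realType) (d : nat).
Local Notation E := 'rV[R]_d.
Implicit Types (c : set E) (M : 'M[R]_d) (x y v : E).

Lemma codim1_coord (L D : 'M[R]_d) u v : (L <= D)%MS ->
  \rank D = (\rank L).+1 -> u <:= D -> ~~ (u <:= L) -> v <:= D ->
  exists a, v - a *: u <:= L.
Proof.
move=> LD rD uD uL vD.
have sub : (L + u <= D)%MS by rewrite addsmx_sub LD.
have : (D <= L + u)%MS.
  rewrite -(mxrank_leqif_sup sub) eqn_leq mxrankS //= rD.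
  have : (\rank L < \rank (L + u)%MS)%N.
    by rewrite (ltn_leqif (mxrank_leqif_sup (addsmxSl _ _))) addsmx_sub submx_refl.
  by [].
move=> /(submx_trans vD)/sub_addsmxP[[a b] /= ->]; exists (b 0 0).
have -> : b *m u = b 0 0 *: u.
  by rewrite [b]mx11_scalar mul_scalar_mx !mxE eqxx mulr1n.
by rewrite addrK submxMl.
Qed.

Lemma affine_hull_sub c : c `<=` affine_hull c.
Proof.
move=> x cx; exists 1%N, (fun=> x), (fun=> 1).
by split=> //; rewrite big_ord1 ?scale1r.
Qed.

Lemma affine_hull_comb c x y (a b : R) : affine_hull c x -> affine_hull c y ->
  a + b = 1 -> affine_hull c (a *: x + b *: y).
Proof.
move=> [n [p [s [cp s1 ->]]]] [m [q [t [cq t1 ->]]]] ab.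
exists (n + m)%N, (fun i => match fintype.split i with inl i => p i | inr i => q i end),
  (fun i => match fintype.split i with inl i => a * s i | inr i => b * t i end).
split; first by move=> i; case: fintype.split.
- rewrite big_split_ord /=.
  under eq_bigr => i _ do rewrite (unsplitK (inl i)).
  under [X in _ + X]eq_bigr => i _ do rewrite (unsplitK (inr i)).
  by rewrite -!mulr_sumr s1 t1 !mulr1.
rewrite big_split_ord /=.
under [X in _ = X + _]eq_bigr => i _ do rewrite (unsplitK (inl i)) -scalerA.
under [X in _ = _ + X]eq_bigr => i _ do rewrite (unsplitK (inr i)) -scalerA.
by rewrite -!scaler_sumr.
Qed.

Lemma affine_hull_addB c x y z : affine_hull c x -> affine_hull c y ->
  affine_hull c z -> affine_hull c (x + (y - z)).
Proof.
move=> hx hy hz.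
have -> : x + (y - z) = 2 *: (2^-1 *: x + 2^-1 *: y) + (-1) *: z by vec.
by apply: affine_hull_comb => //; [apply: affine_hull_comb => //; lra|lra].
Qed.

(* Junk value 0 on the empty set. *)
Definition dirm c : 'M[R]_d := xget 0 [set M |
  forall v, v <:= M <-> exists x y, [/\ affine_hull c x, affine_hull c y & v = y - x]].

Lemma dirmP c v : c !=set0 -> v <:= dirm c <->
  exists x y, [/\ affine_hull c x, affine_hull c y & v = y - x].
Proof.
move=> [x0 cx0]; have ax0 := affine_hull_sub cx0.
have [||M MP] := @subspace_mx R d [set v | exists x y,
    [/\ affine_hull c x, affine_hull c y & v = y - x]].
- by exists x0, x0; rewrite subrr.
- move=> a _ _ [x [y [hx hy ->]]] [x' [y' [hx' hy' ->]]].
  exists (x' + (a *: x + (1 - a) *: x' - x')), (y' + (a *: y + (1 - a) *: x' - x')).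
  split; [apply: affine_hull_addB => //..|].
  + by apply: affine_hull_comb => //; rewrite addrC subrK.
  + by apply: affine_hull_comb => //; rewrite addrC subrK.
  by vec.
have h : [set M | forall v, v <:= M <-> exists x y,
    [/\ affine_hull c x, affine_hull c y & v = y - x]] (dirm c).
  by apply: xgetPex; exists M => u /=; rewrite -MP.
exact: h.
Qed.

Lemma affine_hullE c x y : affine_hull c x ->
  affine_hull c y <-> y - x <:= dirm c.
Proof.
move=> hx; have c0 : c !=set0.
  case: hx => -[|n] [p [a [cp]]]; last by move=> _ _; exists (p ord0).
  by rewrite big_ord0 => /eqP; rewrite eq_sym oner_eq0.
split=> [hy|/(dirmP _ c0)[x' [y' [hx' hy' e]]]].
  by apply/(dirmP _ c0); exists x, y.
by rewrite -(subrK x y) e addrC; exact: affine_hull_addB.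
Qed.

Lemma dirm_sub c x y : affine_hull c x -> affine_hull c y -> y - x <:= dirm c.
Proof. by move=> hx /(affine_hullE _ hx). Qed.

Lemma dirm_min c m (M : 'M[R]_(m, d)) x0 : c x0 -> (forall x, c x -> x - x0 <:= M) ->
  (dirm c <= M)%MS.
Proof.
move=> cx0 h; apply/row_subP => i.
have := row_sub i (dirm c); set v := row i _ => vc.
have : affine_hull c (x0 + v).
  by apply/(affine_hullE _ (affine_hull_sub cx0)); rewrite addrC addKr.
move=> [n [p [a [cp a1 e]]]].
have -> : v = \sum_i a i *: (p i - x0).
  transitivity (x0 + v - x0); first by rewrite addrC addKr.
  rewrite e -[x0 in LHS]scale1r -a1 scaler_suml -sumrB.
  by apply: eq_bigr => j _; rewrite scalerBr.
by apply: summx_sub => j _; apply: scalemx_sub; apply: h.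
Qed.

Lemma frameE k c (B : 'M[R]_(k, d)) : c !=set0 ->
  frame c B <-> row_free B /\ (B :=: dirm c)%MS.
Proof.
move=> c0; rewrite /frame; split=> -[fB h]; split=> //.
  apply/eqmxP/rV_eqP => v; apply/idP/idP => hv.
    by apply/(dirmP _ c0)/h.
  by apply/h/(dirmP _ c0).
by move=> v; rewrite h; exact: dirmP.
Qed.

Definition pt c : E := xget 0 c.

Lemma ptP c : c !=set0 -> c (pt c).
Proof. by move=> c0; apply: xgetPex. Qed.

Definition rk c := \rank (dirm c).

(** The incidence number with the outward vector first: [pt b - pt c] points from [c] to its face
    [b]. The last factor makes it independent of the basis chosen for [b]. *)
Definition inc c (b : set E) : int :=
  bsgn (col_mx (pt b - pt c) (row_base (dirm b))) * bsgn (row_base (dirm b)).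

(** Adding vectors of [dirm b] and scaling by [a > 0] do not change the sign, so only the side on
    which [v] lies matters. *)
Lemma incE k (B : 'M[R]_(k, d)) c b v (a : R) : row_free B ->
  (B :=: dirm b)%MS -> 0 < a -> v - a *: (pt b - pt c) <:= dirm b ->
  bsgn (col_mx v B) = inc c b * bsgn B.
Proof.
move=> fB eB a0 h.
have ek : k = \rank (dirm b) by rewrite -eB; apply/eqP; rewrite eq_sym.
subst k.
have [A [eA dA]] := bsgn_basis_eq fB (eqmx_trans eB (eqmx_sym (eq_row_base (dirm b)))).
rewrite /inc eA (bsgn_mul A) ?row_base_free //.
rewrite (@bsgn_colE _ _ _ _ (pt b - pt c) _ a) ?row_base_free ?eq_row_base //.
rewrite gtr0_sgz // mul1r -[LHS]mulr1 -(bsgn_sq (row_base_free (dirm b))).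
by ring.
Qed.

End Directions.

(** * Fans of cones *)

Section Cones.
Variables (R : realType) (d : nat).
Local Notation E := 'rV[R]_d.
Implicit Types (s r : set E) (L W : 'M[R]_d) (x y v e u : E).

(* Relatively open convex cones, in purely algebraic terms. *)
Definition ocone s := [/\ s !=set0,
  forall x y, s x -> s y -> s (x + y),
  forall (t : R) x, 0 < t -> s x -> s (t *: x)
  & forall x y, s x -> s y -> exists2 t : R, 0 < t & s (x - t *: y)].

(* For disjoint cones: r lies in the closure of s. *)
Definition below r s := forall x y, r x -> s y -> s (x + y).

Lemma ocone_dirmP s v : ocone s ->
  v <:= dirm s <-> exists a b, [/\ s a, s b & v = a - b].
Proof.
move=> [s0 sD sZ _]; split; last first.
  by move=> [a [b [sa sb ->]]]; apply: dirm_sub; apply: affine_hull_sub.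
have [||M MP] := @subspace_mx R d [set v | exists a b, [/\ s a, s b & v = a - b]].
- by case: s0 => x sx; exists x, x; rewrite subrr.
- move=> t _ _ [a [b [sa sb ->]]] [a' [b' [sa' sb' ->]]].
  have [t0|t0|->] := ltgtP t 0.
  + exists (- t *: b + a'), (- t *: a + b').
    split; [apply: sD => //; apply: sZ; rewrite ?oppr_gt0 //..|].
    by vec.
  + exists (t *: a + a'), (t *: b + b').
    split; [apply: sD => //; apply: sZ => //..|].
    by vec.
  by exists a', b'; rewrite scale0r add0r.
case: s0 => x0 sx0.
have sM : (dirm s <= M)%MS.
  by apply: (dirm_min sx0) => x sx; apply/MP; exists x, x0.
by move=> vs; apply/MP; exact: submx_trans vs sM.
Qed.

Lemma ocone_in s x : ocone s -> s x -> x <:= dirm s.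
Proof.
move=> cs sx; apply/(ocone_dirmP _ cs); case: cs => _ sD _ _.
by exists (x + x), x; rewrite addrK; split=> //; exact: sD.
Qed.

Lemma ocone_comb s x y (a b : R) : ocone s -> s x -> s y -> 0 <= a -> 0 < b ->
  s (a *: x + b *: y).
Proof.
move=> [_ sD sZ _] sx sy; rewrite le_eqVlt => /predU1P[<-|a0] b0.
  by rewrite scale0r add0r; exact: sZ.
by apply: sD; apply: sZ.
Qed.

(** With [v = a - b], one half of [x] absorbs the multiple of [a] and the other half that of
    [- b]. *)
Lemma ocone_open s x v : ocone s -> s x -> v <:= dirm s ->
  exists2 t0 : R, 0 < t0 & forall t, `|t| < t0 -> s (x + t *: v).
Proof.
move=> cs sx /(ocone_dirmP _ cs)[a [b [sa sb ->]]].
have [_ sD sZ so] := cs.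
have [p p0 hp] := so _ _ (sZ 2^-1 x ltac:(lra) sx) sa.
have [q q0 hq] := so _ _ (sZ 2^-1 x ltac:(lra) sx) sb.
have P y (z : R) t : s y -> s (2^-1 *: x - z *: y) -> - z < t -> s (2^-1 *: x + t *: y).
  move=> sy sxy zt; rewrite -[t](subrK z) -{1}[t - z + z](addrC z).
  have -> : 2^-1 *: x + (z + (t - z) ) *: y = (2^-1 *: x - z *: y) + (t + z) *: y.
    by vec.
  by apply: sD => //; apply: sZ => //; lra.
exists (Num.min p q); first by rewrite lt_min p0.
move=> t; rewrite lt_min !ltr_norml => /andP[/andP[tp pt'] /andP[tq qt]].
have -> : x + t *: (a - b) = (2^-1 *: x + t *: a) + (2^-1 *: x + (- t) *: b).
  by vec.
by apply: sD; [apply: (P a p)|apply: (P b q)] => //; lra.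
Qed.

Lemma below_dirm r s : ocone s -> ocone r -> below r s -> (dirm r <= dirm s)%MS.
Proof.
move=> cs cr brs; have [[x0 rx0] _ _ _] := cr.
have [[y sy] _ _ _] := cs.
have rs x : r x -> x <:= dirm s.
  by move=> rx; apply/(ocone_dirmP _ cs); exists (x + y), y; rewrite addrK; split=> //; apply: brs.
apply: (dirm_min rx0) => x rx; apply: addmx_sub; first exact: rs.
by rewrite -scaleN1r scalemx_sub // rs.
Qed.

(** If [x = a - b] with [a] and [b] in [r], then [a = b + x] lies in [s] as well. *)
Lemma below_dirm_disj r s x : ocone r -> below r s ->
  (forall z, r z -> s z -> False) -> s x -> ~~ (x <:= dirm r).
Proof.
move=> cr brs dis sx; apply/negP => /(ocone_dirmP _ cr)[a [b [ra rb e]]].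
by apply: (dis a) => //; rewrite -(subrK b a) -e addrC; exact: brs.
Qed.

(** [m] is the infimum of the slopes [t] for which [t *: e + u] lies in [s] modulo [L]. These slopes
    form an up-set, nonempty because [s] is open around [e] in its span, bounded below because
    otherwise [s] would meet [L], and without least element because one can move backwards along
    [e]. *)
Lemma cone_slope s L e u : ocone s -> (forall x, s x -> ~~ (x <:= L)) ->
  s e -> u <:= dirm s ->
  exists m : R, (forall t, m < t -> exists2 l, l <:= L & s (t *: e + u + l)) /\
    ~ exists2 l, l <:= L & s (m *: e + u + l).
Proof.
move=> cs sL se us; have [_ sD sZ so] := cs.
pose S := [set t : R | exists2 l, l <:= L & s (t *: e + u + l)].
have [p p0 hp] := ocone_open cs se us.
have Sup t t' : S t -> t < t' -> S t'.
  move=> [l lL h] tt'; exists l => //.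
  have -> : t' *: e + u + l = (t *: e + u + l) + (t' - t) *: e.
    by vec.
  by apply: sD => //; apply: sZ => //; rewrite subr_gt0.
have S0 : S (2 / p).
  exists 0; rewrite ?sub0mx // addr0.
  have -> : (2 / p) *: e + u = (2 / p) *: (e + (p / 2) *: u).
    by apply/rowP => i; rewrite !mxE; field; rewrite gt_eqF.
  by apply: sZ; [rewrite divr_gt0|apply: hp; rewrite gtr0_norm; lra].
have Sb : lbound S (- (2 / p)).
  move=> t St; rewrite leNgt; apply/negP => /(Sup _ _ St)[l lL h].
  have : s (- (2 / p) *: e + u + l + (2 / p) *: (e + (- (p / 2)) *: u)).
    by apply: sD => //; apply: sZ; [rewrite divr_gt0|apply: hp; rewrite normrN gtr0_norm; lra].
  have -> : - (2 / p) *: e + u + l + (2 / p) *: (e + (- (p / 2)) *: u) = l.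
    by apply/rowP => i; rewrite !mxE; field; rewrite gt_eqF.
  by move=> /sL; rewrite lL.
have Si : has_inf S by split; [exists (2 / p)|exists (- (2 / p))].
exists (inf S); split=> [t mt|[l lL h]].
  have t0 : 0 < t - inf S by rewrite subr_gt0.
  have [t' St' t't] := inf_adherent t0 Si.
  by apply: (Sup t') => //; move: t't; rewrite addrC subrK.
have [q q0 hq] := so _ _ h se.
have : S (inf S - q).
  exists l => //; move: hq; congr s; by vec.
by move=> /(ge_inf (proj2 Si)); rewrite lerBrDl gerDr leNgt q0.
Qed.

End Cones.

(** * Separating a relatively open cone from a subspace *)

Section Separation.
Variables (R : realType) (d : nat).
Local Notation E := 'rV[R]_d.
Implicit Types (s r : set E) (L W : 'M[R]_d) (x y v e u : E) (h : 'cV[R]_d).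

Definition ev h x : R := (x *m h) 0 0.

Lemma evD h x y : ev h (x + y) = ev h x + ev h y.
Proof. by rewrite /ev mulmxDl mxE. Qed.

Lemma evZ h (a : R) x : ev h (a *: x) = a * ev h x.
Proof. by rewrite /ev -scalemxAl mxE. Qed.

Lemma evN h x : ev h (- x) = - ev h x.
Proof. by rewrite -scaleN1r evZ mulN1r. Qed.

Lemma evB h x y : ev h (x - y) = ev h x - ev h y.
Proof. by rewrite evD evN. Qed.

Definition evE := (evD, evB, evN, evZ).

Lemma sub_adds1 L v x : x <:= (L + v)%MS ->
  exists l a, l <:= L /\ x = l + a *: v.
Proof.
move=> /sub_addsmxP[[a b] /= ->]; exists (a *m L), (b 0 0).
rewrite submxMl; split=> //; congr (_ + _).
by rewrite [b]mx11_scalar mul_scalar_mx !mxE eqxx mulr1n.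
Qed.

(** [L] is enlarged to a subspace [M] of maximal rank among those that miss [s]. Then [M] and one
    vector [e] of [s] span everything, and the functional that vanishes on [M] and is 1 at [e] is
    positive on [s] by convexity. *)
Lemma cone_separation s L : ocone s -> (forall x, s x -> ~~ (x <:= L)) ->
  exists h, (forall x, x <:= L -> ev h x = 0) /\ (forall y, s y -> 0 < ev h y).
Proof.
move=> cs sL; have [[e se] sD sZ so] := cs.
pose P n := `[< exists M : 'M[R]_d, [/\ \rank M = n, (L <= M)%MS & forall x, s x -> ~~ (x <:= M)] >].
have exP : exists n, P n by exists (\rank L); apply/asboolP; exists L.
have leP n : P n -> (n <= d)%N by move=> /asboolP[M [<- _ _]]; exact: rank_leq_col.
case: (ex_maxnP exP leP) => n /asboolP[M [rM LM sM]] maxr.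
have ext v : ~~ (v <:= M) -> ~ forall x, s x -> ~~ (x <:= (M + v)%MS).
  move=> vM H; have : P (\rank (M + v)%MS).
    by apply/asboolP; exists (M + v)%MS; split=> //; apply: submx_trans LM (addsmxSl _ _).
  move=> /maxr; rewrite leqNgt => /negP; apply; rewrite -rM.
  by rewrite (ltn_leqif (mxrank_leqif_sup (addsmxSl _ _))) addsmx_sub submx_refl.
have full u : u <:= (M + e)%MS.
  apply: contraT => uMe; exfalso.
  have [us|us] := boolP (u <:= (dirm s + M)%MS).
    have /sub_addsmxP[[a b] /= eu] := us.
    set u1 := a *m dirm s in eu; set l := b *m M in eu.
    have lM : l <:= M by rewrite submxMl.
    (* At the critical slope the vector [m *: e + u1] touches [s] from outside modulo [M], so it can
       be added to [M], against maximality. *)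
    have [m [mS mN]] := cone_slope cs sM se (submxMl a (dirm s)).
    have vM : ~~ (m *: e + u1 <:= M).
      apply: contra uMe => h.
      have -> : u = (m *: e + u1) + (l - m *: e) by rewrite eu; vec.
      apply: addmx_sub; first exact: submx_trans h (addsmxSl _ _).
      apply: addmx_sub; first exact: submx_trans lM (addsmxSl _ _).
      by rewrite -scaleNr scalemx_sub // addsmxSr.
    apply: (ext _ vM) => x sx; apply/negP => /sub_adds1[k [t [kM ex]]].
    have [t0|t0|t0] := ltgtP t 0; last first.
    - by have := sM _ sx; rewrite ex t0 scale0r addr0 kM.
    - apply: mN; exists (t^-1 *: k); first exact: scalemx_sub.
      have -> : m *: e + u1 + t^-1 *: k = t^-1 *: x.
        by rewrite ex; apply/rowP => i; rewrite !mxE; field; rewrite gt_eqF.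
      by apply: sZ => //; rewrite invr_gt0.
    (* For [t < 0], [x] divided by [- t] is the opposite of [m *: e + u1] modulo [M]. The room [p]
       gained by openness cancels the excess of a slope just above [m], and the sum is a point of
       [s] in [M]. *)
    have [p p0 hp] := so _ _ (sZ (- t)^-1 x ltac:(by rewrite invr_gt0 oppr_gt0) sx) se.
    have [|k' k'M hk'] := mS (m + p / 2); first lra.
    have := sM _ (sD _ _ hp (sD _ _ hk' (sZ (p / 2) e ltac:(lra) se))).
    have -> : (- t)^-1 *: x - p *: e + ((m + p / 2) *: e + u1 + k' + (p / 2) *: e)
      = (- t)^-1 *: k + k'.
      by rewrite ex; apply/rowP => i; rewrite !mxE; field; rewrite lt_eqF.
    by rewrite addmx_sub ?scalemx_sub.
  have uM : ~~ (u <:= M) by apply: contra us => /submx_trans; apply; exact: addsmxSr.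
  apply: (ext _ uM) => x sx; apply/negP => /sub_adds1[k [t [kM ex]]].
  have [t0|t0] := eqVneq t 0.
    by have := sM _ sx; rewrite ex t0 scale0r addr0 kM.
  move/negP: us; apply.
  have -> : u = t^-1 *: (x - k).
    by rewrite ex; apply/rowP => i; rewrite !mxE; field.
  rewrite scalemx_sub //; apply: addmx_sub.
    exact: submx_trans (ocone_in cs sx) (addsmxSl _ _).
  by rewrite -scaleN1r scalemx_sub // (submx_trans kM) // addsmxSr.
(* The columns of the cokernel matrix are functionals vanishing on [M]; one of them is nonzero at
   [e]. *)
have := sM _ se; rewrite submxE => /rV0Pn[j]; set c := _ 0 j => c0.
pose h := c^-1 *: col j (cokermx M); exists h.
have hM x : x <:= M -> ev h x = 0.
  rewrite submxE => /eqP xM; rewrite /ev /h -scalemxAr colE mulmxA -colE xM.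
  by rewrite !mxE mulr0.
have he : ev h e = 1.
  by rewrite /ev /h -scalemxAr colE mulmxA -colE mxE [col _ _ _ _]mxE -/c mulVf.
split=> [x xL|y sy]; first by apply: hM; apply: submx_trans xL LM.
have [k [t [kM ey]]] := sub_adds1 (full y).
rewrite ey !evE hM // he add0r mulr1 ltNge; apply/negP => t0.
move: t0; rewrite le_eqVlt => /predU1P[t0|t0].
  by have := sM _ sy; rewrite ey t0 scale0r addr0 kM.
have := sM _ (sD _ _ sy (sZ (- t) e ltac:(lra) se)).
by rewrite ey scaleNr addrK kM.
Qed.

End Separation.

(** * Complete fans and their local structure *)

Section Fans.
Variables (R : realType) (d : nat).
Local Notation E := 'rV[R]_d.
Implicit Types (s r z : set E) (F : seq (set E)) (L W : 'M[R]_d)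
  (x y v e u : E) (h : 'cV[R]_d).

(** By [fan_frontier], a cone that touches the closure of another at one point lies in it entirely.
    Cones may contain lines, which admits the fan whose single cone is [W]. *)
Record fan W F : Prop := Fan {
  fan_uniq : uniq F ;
  fan_ocone : {in F, forall s, ocone s} ;
  fan_sub : forall s x, s \in F -> s x -> x <:= W ;
  fan_cover : forall x, x <:= W -> exists2 s, s \in F & s x ;
  fan_disj : forall s r x, s \in F -> r \in F -> s x -> r x -> s = r ;
  fan_frontier : forall s r x y, s \in F -> r \in F -> r x -> s y ->
    (forall t : R, 0 < t -> s (x + t *: y)) -> below r s
}.

Section FanTheory.
Variables (W : 'M[R]_d) (F : seq (set E)) (fanF : fan W F).

Let Fo := fan_ocone fanF.

(** By convexity each cone contains the points [x + t *: y] for all small [t > 0] or for none. The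
    cones are finitely many and cover [W], so for one of them the first case holds. *)
Lemma fan_ray x y : x <:= W -> y <:= W ->
  exists2 s, s \in F & exists2 t0 : R, 0 < t0 & forall t, 0 < t -> t < t0 -> s (x + t *: y).
Proof.
move=> xW yW; apply: contrapT => H.
have : exists2 t0 : R, 0 < t0 & forall t, 0 < t -> t < t0 ->
    forall s, s \in F -> ~ s (x + t *: y).
  have : forall s, s \in F -> exists2 t0 : R, 0 < t0 & forall t, 0 < t -> t < t0 -> ~ s (x + t *: y).
    move=> s sF; have [[t1 [t10 ht1]]|no] := pselect (exists t1 : R, 0 < t1 /\ s (x + t1 *: y)); last first.
      by exists 1 => // t t0 _ st; apply: no; exists t.
    apply: contrapT => no; apply: H; exists s => //; exists t1 => // t t0 tt1.
    apply: contrapT => st; apply: no; exists t => // t' t'0 t't st'.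
    apply: st; have D : 0 < t1 - t' by lra.
    have -> : x + t *: y = ((t1 - t) / (t1 - t')) *: (x + t' *: y) +
        ((t - t') / (t1 - t')) *: (x + t1 *: y).
      by apply/rowP => i; rewrite !mxE; field; rewrite gt_eqF.
    by apply: (ocone_comb (Fo sF)) => //; [apply: divr_ge0|apply: divr_gt0]; lra.
  elim: (F) => [|s l IH] hl; first by exists 1.
  have [|p p0 hp] := IH; first by move=> r rl; apply: hl; rewrite inE rl orbT.
  have [q q0 hq] := hl s (mem_head _ _).
  exists (Num.min p q); first by rewrite lt_min p0.
  move=> t t0; rewrite lt_min => /andP[tp tq] r; rewrite inE => /orP[/eqP->|].
    exact: hq.
  exact: hp.
move=> [t0 t00 ht]; have hW : x + (t0 / 2) *: y <:= W by rewrite addmx_sub ?scalemx_sub.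
have [s sF ss] := fan_cover fanF hW.
by apply: (ht _ _ _ s sF ss); lra.
Qed.

(** The ray required by [fan_frontier] is taken towards the point [x + (t0 / 2) *: y] of [s]; up to
    scaling, its points lie on the given short segment. *)
Lemma fan_touch s r x y (t0 : R) : s \in F -> r \in F -> r x -> 0 < t0 ->
  (forall t, 0 < t -> t < t0 -> s (x + t *: y)) -> below r s.
Proof.
move=> sF rF rx t00 hs; have [_ _ sZ _] := Fo sF.
have h2 : s (x + (t0 / 2) *: y) by apply: hs; lra.
apply: (fan_frontier fanF sF rF rx h2) => t tp.
have -> : x + t *: (x + (t0 / 2) *: y) =
    (1 + t) *: (x + (t / (1 + t) * (t0 / 2)) *: y).
  by apply/rowP => i; rewrite !mxE; field; rewrite gt_eqF; lra.
have t1 : 0 < 1 + t by lra.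
have t2 : 0 < t / (1 + t) < 1 by rewrite divr_gt0 //= ltr_pdivrMr //; lra.
by apply: sZ => //; apply: hs; nra.
Qed.

Lemma fan_local r x y : r \in F -> r x -> y <:= W ->
  exists2 s, s \in F & below r s /\
    exists2 t0 : R, 0 < t0 & forall t, 0 < t -> t < t0 -> s (x + t *: y).
Proof.
move=> rF rx yW; have [s sF [t0 t00 hs]] := fan_ray (fan_sub fanF rF rx) yW.
by exists s => //; split; [exact: fan_touch rx t00 hs|exists t0].
Qed.

Lemma fan_dirm s : s \in F -> (dirm s <= W)%MS.
Proof.
move=> sF; have [[x sx] _ _ _] := Fo sF; apply: (dirm_min sx) => y sy.
by apply: addmx_sub; [|rewrite -scaleN1r scalemx_sub //]; apply: (fan_sub fanF sF).
Qed.

Lemma fan_below_disj s r x : s \in F -> r \in F -> below r s -> r <> s ->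
  s x -> ~~ (x <:= dirm r).
Proof.
move=> sF rF brs ne sx; apply: (below_dirm_disj (Fo rF) brs _ sx) => y ry sy.
by apply: ne; apply: (fan_disj fanF rF sF ry sy).
Qed.

Lemma fan_below_rk s r : s \in F -> r \in F -> below r s -> r <> s -> (rk r < rk s)%N.
Proof.
move=> sF rF brs ne.
rewrite (ltn_leqif (mxrank_leqif_sup (below_dirm (Fo sF) (Fo rF) brs))).
have [[x sx] _ _ _] := Fo sF; have := fan_below_disj sF rF brs ne sx.
by apply: contra => /(submx_trans (ocone_in (Fo sF) sx)).
Qed.

(** For any [e] in [s] the vector [- e] points outwards. Its coordinate [a] is positive, since
    otherwise [e - a *: pt s] would be a point of [s] in the span of [r]. *)
Lemma fan_inc k (B : 'M[R]_(k, d)) s r e : s \in F -> r \in F -> below r s ->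
  rk s = (rk r).+1 -> s e -> row_free B -> (B :=: dirm r)%MS ->
  bsgn (col_mx (- e) B) = inc s r * bsgn B.
Proof.
move=> sF rF brs rsr se fB eB; have cs := Fo sF; have cr := Fo rF.
have [s0 sD sZ _] := cs; have sp := ptP s0.
have rs : r <> s by move=> rs; move: rsr; rewrite rs; lia.
have rp : r (pt r) by apply: ptP; case: cr.
have [a ha] := codim1_coord (below_dirm cs cr brs) rsr (ocone_in cs sp)
  (fan_below_disj sF rF brs rs sp) (ocone_in cs se).
have a0 : 0 < a.
  rewrite ltNge; apply/negP => a0.
  have : ~~ (e - a *: pt s <:= dirm r).
    apply: (fan_below_disj sF rF brs rs); move: a0; rewrite le_eqVlt => /predU1P[->|a0].
      by rewrite scale0r subr0.
    by rewrite -scaleNr; apply: sD => //; apply: sZ => //; rewrite oppr_gt0.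
  by rewrite ha.
apply: (incE fB eB a0).
have -> : - e - a *: (pt r - pt s) = - (e - a *: pt s) - a *: pt r by vec.
apply: addmx_sub; first by rewrite -scaleN1r scalemx_sub.
by rewrite -scaleNr scalemx_sub // ocone_in.
Qed.

Lemma fan_below_trans r s z : r \in F -> s \in F -> z \in F ->
  below z r -> below r s -> below z s.
Proof.
move=> rF sF zF bzr brs.
have [[x zx] _ _ _] := Fo zF; have [[y ry] _ rZ _] := Fo rF; have [[w0 sw] sD sZ _] := Fo sF.
apply: (fan_frontier fanF sF zF zx (sD _ _ (brs _ _ ry sw) sw)) => t t0.
rewrite 2!scalerDr addrA; apply: sD; last exact: sZ.
rewrite addrA; apply: brs; last exact: sZ.
by apply: bzr => //; exact: rZ.
Qed.

End FanTheory.
End Fans.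

(** * The cones between two cones of codimension two *)

Section Diamond.
Variables (R : realType) (d : nat).
Local Notation E := 'rV[R]_d.
Implicit Types (s r z : set E) (F : seq (set E)) (L W : 'M[R]_d)
  (x y v e u : E) (h : 'cV[R]_d).

Definition fan_bd s r : int :=
  if `[< below r s >] && (rk s == (rk r).+1) then inc s r else 0.

Variables (W : 'M[R]_d) (F : seq (set E)) (fanF : fan W F).
Let Fo := fan_ocone fanF.

(** Modulo the span of [z], let [m] be the critical slope of [s] for [u]. Moving from a point of [z]
    along [m *: e + u] enters a cone [r], and moving on along [e] enters [s], so [r] bounds [s] on
    the side of [u]. It is not [s], as the slope [m] is not attained, and not [z], as [u] is not
    spanned by [z] and [e]. *)
Lemma fan_side_exists z s e u : z \in F -> s \in F -> below z s -> s e ->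
  u <:= dirm s -> ~~ (u <:= (dirm z + e)%MS) ->
  exists2 r, r \in F & [/\ below z r, below r s, r <> s, r <> z &
    exists m l (a : R), [/\ 0 < a, l <:= dirm z & r (a *: u + m *: e + l)]].
Proof.
move=> zF sF bzs se us uze; have cs := Fo sF; have cz := Fo zF.
have [_ sD sZ so] := cs; have [[z0 zz0] zD zZ zo] := cz.
have zs : z <> s.
  by move=> zs; move: uze; rewrite zs (submx_trans us) // addsmxSl.
have [m [mS mN]] := cone_slope cs (fun x => @fan_below_disj _ _ _ _ fanF s z x sF zF bzs zs) se us.
pose p := m *: e + u.
have sW x : x <:= dirm s -> x <:= W by move/submx_trans; apply; exact: fan_dirm fanF _ sF.
have eW := sW _ (ocone_in cs se).
have pW : p <:= W by rewrite addmx_sub ?scalemx_sub // sW.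
have [r rF [bzr [t0 t00 ht]]] := fan_local fanF zF zz0 pW.
have [_ rD rZ _] := Fo rF.
pose t1 := t0 / 2; have t10 : 0 < t1 by rewrite /t1; lra.
have rx : r (z0 + t1 *: p) by apply: ht; rewrite /t1; lra.
have [t tF [brt [q q0 hq]]] := fan_local fanF rF rx eW.
have bzt := fan_below_trans fanF rF tF zF bzr brt.
have [_ tD tZ _] := Fo tF.
(* A common point of both cones: a point of [z] plus a small multiple of a point of [s] of slope
   [m + dl]. The value of [dl] makes [t1 *: p + (q / 2) *: e] a multiple of a vector of that
   slope. *)
have ts : t = s.
  pose dl := q / 2 / t1; have dl0 : 0 < dl by rewrite /dl !divr_gt0 //; lra.
  have [|l /(ocone_dirmP _ cz)[a [b [za zb ->]]] hl] := mS (m + dl); first lra.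
  have ha : s ((m + dl) *: e + u + a).
    have -> : (m + dl) *: e + u + a = b + ((m + dl) *: e + u + (a - b)) by vec.
    exact: bzs.
  have [k k0 hk] := zo _ _ zz0 za.
  pose c := Num.min (k / 2) (t1 / 2).
  have c0 : 0 < c by rewrite lt_min; lra.
  have ck : c < k by rewrite gt_min; lra.
  have ct : c < t1 by rewrite gt_min; apply/orP; right; lra.
  have hz : z (z0 - c *: a).
    have -> : z0 - c *: a = (1 - c / k) *: z0 + (c / k) *: (z0 - k *: a).
      by apply/rowP => i; rewrite !mxE; field; rewrite gt_eqF.
    apply: (ocone_comb cz) => //; last by rewrite divr_gt0.
    by rewrite subr_ge0 ler_pdivrMr // mul1r ltW.
  have st := bzs _ _ hz (sZ _ _ c0 ha).
  apply: (fan_disj fanF tF sF _ st).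
  have -> : z0 - c *: a + c *: ((m + dl) *: e + u + a) =
     (1 - c / t1) *: z0 + (c / t1) *: (z0 + t1 *: p + (q / 2) *: e).
    by rewrite /dl /p; apply/rowP => i; rewrite !mxE; field; rewrite gt_eqF.
  apply: bzt; last by apply: tZ; [rewrite divr_gt0|apply: hq; lra].
  by apply: zZ => //; rewrite subr_gt0 ltr_pdivrMr // mul1r.
exists r => //; rewrite ts in brt; split=> //.
- move=> rs; apply: mN; exists (t1^-1 *: z0); first by rewrite scalemx_sub // ocone_in.
  have -> : m *: e + u + t1^-1 *: z0 = t1^-1 *: (z0 + t1 *: p).
    by rewrite /p; apply/rowP => i; rewrite !mxE; field; rewrite gt_eqF.
  by apply: sZ; rewrite ?invr_gt0 // -rs.
- move=> rz; move/negP: uze; apply.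
  have -> : u = t1^-1 *: ((z0 + t1 *: p) - z0) - m *: e.
    by rewrite /p; apply/rowP => i; rewrite !mxE; field; rewrite gt_eqF.
  have zin := ocone_in cz; rewrite rz in rx.
  apply: addmx_sub; last by rewrite -scaleNr scalemx_sub // addsmxSr.
  rewrite scalemx_sub // (submx_trans _ (addsmxSl _ _)) //.
  by apply: addmx_sub; [|rewrite -scaleN1r scalemx_sub //]; apply: zin.
exists (t1 * m), z0, t1; split; rewrite ?ocone_in //.
by move: rx; congr r; rewrite /p; vec.
Qed.

(** After scaling, both faces contain a point [u + mu *: e] modulo the span of [z]. If the slopes
    agree, shifting by points of [z] gives a common point. Otherwise adding a multiple of [e] to the
    point of smaller slope gives a point of the other face, but also of [s]. *)
Lemma fan_side_unique z s e u r r' v v' m m' a a' : z \in F -> s \in F ->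
  r \in F -> r' \in F -> below z r -> below z r' -> below r s -> below r' s ->
  r <> s -> r' <> s -> s e -> 0 < a -> 0 < a' ->
  v <:= dirm z -> v' <:= dirm z ->
  r (a *: u + m *: e + v) -> r' (a' *: u + m' *: e + v') -> r = r'.
Proof.
move=> zF sF rF r'F bzr bzr' brs br's rs r's se.
have [_ sD sZ _] := Fo sF; have [_ rD rZ _] := Fo rF; have [_ rD' rZ' _] := Fo r'F.
move=> a0 a'0 vz v'z rv rv'.
have := rZ a^-1 _ ltac:(by rewrite invr_gt0) rv.
have := rZ' a'^-1 _ ltac:(by rewrite invr_gt0) rv'.
set mu := a^-1 * m; set mu' := a'^-1 * m'.
have -> : a^-1 *: (a *: u + m *: e + v) = u + mu *: e + a^-1 *: v.
  by rewrite !scalerDr !scalerA mulVf ?gt_eqF // scale1r.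
have -> : a'^-1 *: (a' *: u + m' *: e + v') = u + mu' *: e + a'^-1 *: v'.
  by rewrite !scalerDr !scalerA mulVf ?gt_eqF // scale1r.
have := scalemx_sub a^-1 vz; have := scalemx_sub a'^-1 v'z.
set l := a^-1 *: v; set l' := a'^-1 *: v'; move: mu mu' l l'.
move=> {a a' v v' m m' a0 a'0 vz v'z rv rv'}.
move=> mu mu' l l' l'z lz hr' hr.
wlog : r r' mu mu' l l' lz l'z hr hr' rF r'F bzr bzr' brs br's rs r's {rD rZ rD' rZ'} / mu <= mu'.
  by move=> H; case: (leP mu mu') => [|/ltW] k; [apply: (H r r' mu mu' l l')|apply: esym; apply: (H r' r mu' mu l' l)].
move=> hmu; have : l' - l <:= dirm z by apply: addmx_sub => //; rewrite -scaleN1r scalemx_sub.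
move=> /(ocone_dirmP _ (Fo zF))[p [q [zp zq e1]]].
have h' : r' (q + (u + mu' *: e + l')) by exact: bzr'.
have h : r (p + (u + mu *: e + l)) by exact: bzr.
have el : l' = l + (p - q) by rewrite -e1 addrC subrK.
move: hmu; rewrite le_eqVlt => /predU1P[emu|hmu].
  apply: (fan_disj fanF rF r'F h); move: h'; congr r'; rewrite el emu; vec.
exfalso; apply: r's; apply: (fan_disj fanF r'F sF h').
have -> : q + (u + mu' *: e + l') = (p + (u + mu *: e + l)) + (mu' - mu) *: e.
  by rewrite el; vec.
by apply: brs => //; apply: sZ => //; rewrite subr_gt0.
Qed.

Lemma fan_side_sign k (B : 'M[R]_(k, d)) z s e u r v m a :
  z \in F -> s \in F -> r \in F -> below z r -> below r s ->
  rk r = (rk z).+1 -> rk s = (rk r).+1 -> s e -> 0 < a -> v <:= dirm z ->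
  r (a *: u + m *: e + v) -> row_free B -> (B :=: dirm z)%MS ->
  inc s r * inc r z * bsgn B = - bsgn (col_mx (- u) (col_mx (- e) B)).
Proof.
move=> zF sF rF bzr brs rkr rks se a0 vz rv fB eB.
set x := a *: u + m *: e + v in rv.
have rs : r <> s by move=> h; move: rks; rewrite h; lia.
have zr : z <> r by move=> h; move: rkr; rewrite h; lia.
have dzr := below_dirm (Fo rF) (Fo zF) bzr.
have xr := ocone_in (Fo rF) rv.
have nB1 : row_free (col_mx (- x) B).
  rewrite row_free_col_mx // eB -scaleN1r.
  by rewrite eqmx_scale ?oppr_eq0 ?oner_eq0 // (fan_below_disj fanF rF zF).
have eB1 : (col_mx (- x) B :=: dirm r)%MS.
  apply/eqmxP; rewrite -(mxrank_leqif_eq _).2.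
    rewrite (eqP nB1) -/(rk r) rkr /rk -eB (eqP fB) //.
  by rewrite -addsmxE addsmx_sub eB dzr andbT -scaleN1r scalemx_sub.
rewrite -mulrA -(fan_inc fanF rF zF bzr rkr rv fB eB).
rewrite -(fan_inc fanF sF rF brs rks se nB1 eB1).
have fe : row_free (col_mx (- e) (col_mx (- x) B)).
  rewrite row_free_col_mx // eB1 -scaleN1r.
  by rewrite eqmx_scale ?oppr_eq0 ?oner_eq0 // (fan_below_disj fanF sF rF).
rewrite -[LHS]opprK -(bsgn_swap fe); congr (- _).
have zs := fan_below_trans fanF rF sF zF bzr brs.
apply: (bsgn_col_pos _ a0).
  rewrite row_free_col_mx // eB -scaleN1r eqmx_scale ?oppr_eq0 ?oner_eq0 //.
  by apply: (fan_below_disj fanF sF zF) => // h; move: rks rkr; rewrite h; lia.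
rewrite -addsmxE; have -> : - x - a *: - u = m *: (- e) - v by rewrite /x; vec.
apply: addmx_sub; first by rewrite scalemx_sub // addsmxSl.
by rewrite -scaleN1r scalemx_sub // (submx_trans _ (addsmxSr _ _)) // eB.
Qed.

End Diamond.

Lemma mulIf_opp (x a b p q : int) : x != 0 -> p = a * x -> q = b * x -> p = - q -> a = - b.
Proof. by move=> x0 -> -> e; apply: (mulIf x0); rewrite mulNr. Qed.

Section SparseSums.
Variables (V : zmodType) (I : eqType).

Lemma big_one (s : seq I) (f : I -> V) r : uniq s -> r \in s ->
  (forall t, t \in s -> t <> r -> f t = 0) -> \sum_(t <- s) f t = f r.
Proof.
move=> us rs h; rewrite (bigD1_seq r) //= big1_seq ?addr0 // => t /andP[/eqP tr ts].
exact: h.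
Qed.

Lemma big_two (s : seq I) (f : I -> V) r r' : uniq s -> r \in s -> r' \in s ->
  r <> r' -> (forall t, t \in s -> t <> r -> t <> r' -> f t = 0) ->
  \sum_(t <- s) f t = f r + f r'.
Proof.
move=> us rs r's /eqP rr' h; rewrite (bigD1_seq r) //= -big_filter; congr (_ + _).
rewrite (@big_one _ _ r') ?filter_uniq // ?mem_filter ?r's 1?eq_sym ?rr' // => t.
by rewrite mem_filter => /andP[/eqP tr ts]; exact: h.
Qed.

End SparseSums.

(** * The boundary of a fan squares to zero *)

Section BoundarySquare.
Variables (R : realType) (d : nat).
Local Notation E := 'rV[R]_d.
Implicit Types (s r z : set E) (F : seq (set E)) (L W : 'M[R]_d)
  (x y v e u : E) (h : 'cV[R]_d).
Variables (W : 'M[R]_d) (F : seq (set E)) (fanF : fan W F).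
Let Fo := fan_ocone fanF.

Lemma rkS_neq s r : rk s = (rk r).+1 -> r <> s.
Proof. by move=> + e; rewrite e; lia. Qed.

Lemma fan_bdP s r : fan_bd s r != 0 -> below r s /\ rk s = (rk r).+1.
Proof.
by rewrite /fan_bd; case: ifP => [/andP[/asboolP h /eqP k] _ //|_]; rewrite eqxx.
Qed.

Lemma inc_free s r : r !=set0 -> pt r - pt s <:= dirm r = false ->
  inc s r * inc s r = 1.
Proof.
move=> r0 h; rewrite /inc mulrACA !bsgn_sq ?mulr1 ?row_base_free //.
by rewrite row_free_col_mx ?row_base_free // eq_row_base h.
Qed.

Lemma fan_bd_sq s r : s \in F -> r \in F -> below r s -> rk s = (rk r).+1 ->
  fan_bd s r * fan_bd s r = 1.
Proof.
move=> sF rF brs rsr; rewrite /fan_bd asboolT // rsr eqxx /=.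
have [r0 _ _ _] := Fo rF; have [s0 _ _ _] := Fo sF.
apply: inc_free => //; apply/negbTE.
have rs := rkS_neq rsr.
have := fan_below_disj fanF sF rF brs rs (ptP s0); apply: contra => h.
rewrite -[pt s](subKr (pt r)); apply: addmx_sub; first exact: ocone_in (Fo rF) (ptP r0).
by rewrite -scaleN1r scalemx_sub.
Qed.

(** For [z] of codimension two in [s], fix [e] in [s] and [u] in its span but outside that of [z]
    and [e]. Exactly two cones lie between, one on the side of [u] and one on that of [- u], and
    [fan_side_sign] gives them opposite signs. *)
Lemma fan_bd_bd s z : s \in F -> z \in F ->
  \sum_(r <- F) fan_bd s r * fan_bd r z = 0.
Proof.
move=> sF zF.
have [[bzs rks]|no] := pselect (below z s /\ rk s = (rk z).+2); last first.
  rewrite big1_seq // => r /andP[_ rF]; apply/eqP; rewrite mulf_eq0.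
  apply: contrapT => /negP; rewrite negb_or => /andP[/fan_bdP[h1 k1] /fan_bdP[h2 k2]].
  by apply: no; split; [exact: (fan_below_trans fanF rF sF zF h2 h1)|rewrite k1 k2].
have cs := Fo sF; have cz := Fo zF; have [[e se] sD sZ _] := cs.
have zs : z <> s by move=> h; move: rks; rewrite h; lia.
have : exists2 u : E, u <:= dirm s & ~~ (u <:= (dirm z + e)%MS).
  have /row_subPn[i hi] : ~~ (dirm s <= dirm z + e)%MS.
    apply/negP => /mxrankS; rewrite -/(rk s) rks.
    have := mxrank_adds_leqif (dirm z) e => -[+ _]; rewrite -/(rk z).
    by have := rank_leq_row e; lia.
  by exists (row i (dirm s)) => //; exact: row_sub.
move=> [u us uze].
have Nus : - u <:= dirm s by rewrite -scaleN1r scalemx_sub.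
have Nuze : ~~ (- u <:= (dirm z + e)%MS).
  by rewrite -scaleN1r eqmx_scale ?oppr_eq0 ?oner_eq0.
have mid r : r \in F -> below z r -> below r s -> r <> s -> r <> z ->
    rk r = (rk z).+1 /\ rk s = (rk r).+1.
  move=> rF h1 h2 n1 n2.
  have := fan_below_rk fanF rF zF h1 (fun k => n2 (esym k)).
  have := fan_below_rk fanF sF rF h2 n1; lia.
have [r rF [bzr brs rs rz [m [l [a [a0 lz hr]]]]]] := fan_side_exists fanF zF sF bzs se us uze.
have [r' r'F [bzr' br's r's r'z [m' [l' [a' [a'0 l'z hr']]]]]] := fan_side_exists fanF zF sF bzs se Nus Nuze.
have [k1 k2] := mid _ rF bzr brs rs rz.
have [k1' k2'] := mid _ r'F bzr' br's r's r'z.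
pose B := row_base (dirm z); have fB : row_free B := row_base_free _.
have eB : (B :=: dirm z)%MS := eq_row_base _.
have Q := fan_side_sign fanF zF sF rF bzr brs k1 k2 se a0 lz hr fB eB.
have Q' := fan_side_sign fanF zF sF r'F bzr' br's k1' k2' se a'0 l'z hr' fB eB.
have fe : row_free (col_mx (- e) B).
  rewrite row_free_col_mx // eB -scaleN1r eqmx_scale ?oppr_eq0 ?oner_eq0 //.
  exact: (fan_below_disj fanF sF zF).
have fu : row_free (col_mx (- u) (col_mx (- e) B)).
  rewrite row_free_col_mx // -addsmxE; apply: contra Nuze => /submx_trans; apply.
  rewrite addsmx_sub eB addsmxSl andbT -scaleN1r scalemx_sub //; exact: addsmxSr.
have QQ : bsgn (col_mx (- - u) (col_mx (- e) B)) = - bsgn (col_mx (- u) (col_mx (- e) B)).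
  by apply: (@bsgn_col_neg _ _ _ _ (- u) _ 1) => //; rewrite scale1r addNr sub0mx.
rewrite QQ in Q'.
have fb t : t \in F -> below z t -> below t s -> rk t = (rk z).+1 -> rk s = (rk t).+1 ->
    fan_bd s t * fan_bd t z = inc s t * inc t z.
  by move=> tF h1 h2 h3 h4; rewrite /fan_bd !asboolT //= h4 h3 !eqxx.
have B0 : bsgn B != 0 by case: (bsgn_free fB) => ->.
have C0 : bsgn (col_mx (- u) (col_mx (- e) B)) != 0 by case: (bsgn_free fu) => ->.
have rr' : r <> r'.
  move=> h; move: Q'; rewrite -h Q => /eqP; rewrite eq_sym -addr_eq0 opprK -mulr2n.
  by rewrite mulrn_eq0 (negbTE C0).
rewrite (@big_two _ _ _ _ r r') ?(fan_uniq fanF) //.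
  rewrite (fb _ rF bzr brs k1 k2) (fb _ r'F bzr' br's k1' k2').
  apply/eqP; rewrite addr_eq0; apply/eqP; apply: (mulIf_opp B0 (esym Q) (esym Q')).
  by rewrite opprK.
move=> t tF tr tr'; apply/eqP; apply: contrapT => /negP.
rewrite mulf_eq0 negb_or => /andP[/fan_bdP[bts rkt] /fan_bdP[bzt rkz]].
have ts := rkS_neq rkt; have zt := rkS_neq rkz.
have [[v tv] tD tZ _] := Fo tF.
have vs := submx_trans (ocone_in (Fo tF) tv) (below_dirm cs (Fo tF) bts).
have [b hb] : exists b, v - b *: u <:= (dirm z + e)%MS.
  apply: (@codim1_coord _ _ _ (dirm s)) => //.
    by rewrite addsmx_sub (below_dirm cs cz bzs) (ocone_in cs se).
  rewrite -/(rk s) rks; apply/eqP; rewrite eqSS eqn_leq; apply/andP; split.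
    rewrite (ltn_leqif (mxrank_leqif_sup (addsmxSl _ _))) addsmx_sub submx_refl /=.
    exact: (fan_below_disj fanF sF zF).
  have := mxrank_adds_leqif (dirm z) e => -[+ _]; rewrite -/(rk z).
  by have := rank_leq_row e; clear; lia.
have [l2 [m2 [l2z e2]]] := sub_adds1 hb.
have ev2 : v = b *: u + m2 *: e + l2 by rewrite -(subrK (b *: u) v) e2; vec.
have [b0|b0|b0] := ltgtP b 0.
- apply: tr'; apply: (fan_side_unique (e := e) (u := - u) (v := l2) (v' := l') (m := m2) (m' := m') (a := - b) (a' := a') fanF zF sF) => //.
    by rewrite oppr_gt0.
  by move: tv; rewrite ev2 scalerN scaleNr opprK.
- apply: tr; apply: (fan_side_unique (e := e) (u := u) (v := l2) (v' := l) (m := m2) (m' := m) (a := b) (a' := a) fanF zF sF) => //.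
  by rewrite -ev2.
(* With [b = 0] the cone [t] contains the point [m2 *: e + p], where [p] is in [z]. According to the
   sign of [m2], [s] would meet [z], or [t] would meet [s], or [t] would meet [z]. *)
move: l2z => /(ocone_dirmP _ cz)[p [q [zp zq el]]].
have tvq : t (q + v) by exact: bzt.
have evq : q + v = m2 *: e + p by rewrite ev2 b0 el; vec.
have [m0|m0|m0] := ltgtP m2 0.
- apply: zs; apply: (fan_disj fanF zF sF zp).
  have -> : p = (q + v) + (- m2) *: e by rewrite evq; vec.
  by apply: bts => //; apply: sZ => //; rewrite oppr_gt0.
- apply: ts; apply: (fan_disj fanF tF sF tvq); rewrite evq addrC.
  by apply: bzs => //; apply: sZ.
by apply: zt; apply/esym; apply: (fan_disj fanF tF zF tvq); rewrite evq m0 scale0r add0r.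
Qed.

End BoundarySquare.

(** * Cutting a fan by a hyperplane *)

Section Cut.
Variables (R : realType) (d : nat).
Local Notation E := 'rV[R]_d.
Implicit Types (s r z t : set E) (F : seq (set E)) (L W : 'M[R]_d)
  (x y v e u : E) (h : 'cV[R]_d) (i j : int).

Definition part h i s := s `&` [set x | sgz (ev h x) = i].

Definition signs : seq int := [:: 0; 1; -1].

Definition cut h F : seq (set E) :=
  [seq part h p.2 p.1 | p <- [seq (s, i) | s <- F, i <- signs] &
    `[< part h p.2 p.1 !=set0 >]].

Lemma sgz_signs (a : R) : sgz a \in signs.
Proof. by case: (sgzP a). Qed.

Lemma sgz_small (a b : R) : a != 0 -> exists2 c : R, 0 < c & sgz (a + c * b) = sgz a.
Proof.
move=> a0; have c0 : 0 < `|a| / (`|b| + 1) by rewrite divr_gt0 ?normr_gt0 // ltr_pwDr.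
exists (`|a| / (`|b| + 1)) => //.
have : `| `|a| / (`|b| + 1) * b| < `|a|.
  rewrite normrM gtr0_norm // mulrAC ltr_pdivrMr ?ltr_pwDr //.
  by rewrite ltr_pM2l ?normr_gt0 //; lra.
move: (_ * b) a0 => b'; clear; rewrite !ltr_norml.
case: (ltrgt0P a) => // a0 _ => [/andP[]|/andP[]] h1 h2.
  by rewrite !gtr0_sgz //; lra.
by rewrite !ltr0_sgz //; lra.
Qed.

Lemma sgz_add_same (a b : R) : sgz a = sgz b -> sgz (a + b) = sgz b.
Proof.
case: (ltrgt0P a) => [a0|a0|->]; last by rewrite add0r.
  rewrite (gtr0_sgz a0) => /esym/eqP; rewrite sgz_cp0 => b0.
  by rewrite !gtr0_sgz ?addr_gt0.
rewrite (ltr0_sgz a0) => /esym/eqP; rewrite sgz_cp0 => b0.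
by rewrite !ltr0_sgz //; lra.
Qed.

Lemma mem_signed F p :
  (p \in [seq (s, i) | s <- F, i <- signs]) = (p.1 \in F) && (p.2 \in signs).
Proof.
apply/flatten_mapP/andP => [[s sF /mapP[i ii ->]]|[sF ii]]; first by split.
by exists p.1 => //; apply/mapP; exists p.2 => //; case: p {sF ii}.
Qed.

Lemma cutP h F t : reflect
  (exists s i, [/\ s \in F, i \in signs, t = part h i s & part h i s !=set0])
  (t \in cut h F).
Proof.
apply: (iffP mapP) => [[[s i]]|[s [i [sF ii -> n0]]]].
  rewrite mem_filter mem_signed => /andP[/asboolP n0 /andP[/= sF ii]] ->.
  by exists s, i.
by exists (s, i); rewrite // mem_filter asboolT //= mem_signed sF.
Qed.

Lemma sum_cut (V : zmodType) (f : set E -> V) h F :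
  \sum_(t <- cut h F) f t =
  \sum_(s <- F) \sum_(i <- signs) (if `[< part h i s !=set0 >] then f (part h i s) else 0).
Proof.
rewrite big_map big_filter big_flatten /= big_map; apply: eq_bigr => s _.
by rewrite big_mkcond !big_cons !big_nil.
Qed.

Lemma part_sub h i s : part h i s `<=` s.
Proof. by move=> x []. Qed.

Lemma part_open h i s x v : ocone s -> part h i s x -> v <:= dirm s ->
  (i = 0 -> ev h v = 0) ->
  exists2 t0 : R, 0 < t0 & forall t : R, `|t| < t0 -> part h i s (x + t *: v).
Proof.
move=> cs [sx hx] vs iv; have [t0 t00 ht] := ocone_open cs sx vs.
have [i0|i0] := eqVneq i 0.
  exists t0 => // t tt; split; first exact: ht.
  by rewrite /= !evE iv // mulr0 addr0.
have evx : ev h x != 0 by rewrite -sgz_eq0 hx.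
exists (Num.min t0 (`|ev h x| / (`|ev h v| + 1))).
  by rewrite lt_min t00 divr_gt0 ?normr_gt0 // ltr_pwDr.
move=> t; rewrite lt_min => /andP[tt]; rewrite ltr_pdivlMr ?ltr_pwDr // => tv.
split; first exact: ht.
rewrite /= !evE -hx; have : `|t * ev h v| < `|ev h x|.
  rewrite normrM (le_lt_trans _ tv) // ler_wpM2l //; lra.
move: (ev h x) (t * ev h v) evx => a b; clear; rewrite !ltr_norml.
case: (ltrgt0P a) => // a0 _ => [/andP[]|/andP[]] h1 h2.
  by rewrite !gtr0_sgz //; lra.
by rewrite !ltr0_sgz //; lra.
Qed.

Lemma part_ocone h i s : ocone s -> part h i s !=set0 -> ocone (part h i s).
Proof.
move=> cs n0; have [_ sD sZ _] := cs; split=> //.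
- move=> x y [sx hx] [sy hy]; split; first exact: sD.
  by rewrite /= evD sgz_add_same // hx hy.
- move=> a x a0 [sx hx]; split; first exact: sZ.
  by rewrite /= evZ sgzM gtr0_sgz // mul1r.
move=> x y px [sy hy].
have [||t0 t00 ht] := part_open cs px (v := y); first exact: ocone_in.
  by move=> i0; apply/eqP; rewrite -sgz_eq0 hy i0.
exists (t0 / 2); first lra.
by rewrite -scaleNr; apply: ht; rewrite normrN gtr0_norm; lra.
Qed.

Lemma part_dirm_in h i s v : ocone s -> part h i s !=set0 -> v <:= dirm s ->
  (i = 0 -> ev h v = 0) -> v <:= dirm (part h i s).
Proof.
move=> cs n0 vs iv; have [x px] := n0.
have [t0 t00 ht] := part_open cs px vs iv.
have cp := part_ocone cs n0.
have h2 : part h i s (x + (t0 / 2) *: v) by apply: ht; rewrite gtr0_norm; lra.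
have -> : v = (t0 / 2)^-1 *: ((x + (t0 / 2) *: v) - x).
  by apply/rowP => k; rewrite !mxE; field; rewrite gt_eqF.
by rewrite scalemx_sub //; apply: dirm_sub; apply: affine_hull_sub.
Qed.

Lemma part_dirm_sub h i s : part h i s !=set0 -> (dirm (part h i s) <= dirm s)%MS.
Proof.
move=> [x px]; apply: (dirm_min px) => y py.
by apply: dirm_sub; apply: affine_hull_sub; apply: (part_sub (h := h) (i := i)).
Qed.

Lemma part_rk h i s : ocone s -> part h i s !=set0 -> i != 0 -> rk (part h i s) = rk s.
Proof.
move=> cs n0 i0; apply/eqP; rewrite eqn_leq; apply/andP; split.
  exact: mxrankS (part_dirm_sub n0).
apply: mxrankS; apply/rV_subP => v vs; apply: part_dirm_in => // i00.
by rewrite i00 eqxx in i0.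
Qed.

(** If [x] in [s] is on the hyperplane and [y] in [s] is off it, then [x - t0 *: y] is a point of
    [s] on the side opposite to [y]. *)
Lemma part0_cases h s : ocone s -> part h 0 s !=set0 ->
  (part h 0 s = s) \/
  [/\ rk s = (rk (part h 0 s)).+1, part h 1 s !=set0 & part h (-1) s !=set0].
Proof.
move=> cs n0; have [_ sD sZ so] := cs.
have [H|/existsNP[y /not_implyP[sy evy]]] := pselect (forall y, s y -> ev h y = 0).
  by left; apply/seteqP; split=> [x []//|x sx]; split=> //=; rewrite H // sgz0.
right; have [x [sx /= hx]] := n0.
have {}hx : ev h x = 0 by apply/eqP; rewrite -sgz_eq0 hx.
have [t0 t00 ht] := so _ _ sx sy.
have hy' : ev h (x - t0 *: y) = - (t0 * ev h y) by rewrite !evE hx add0r.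
have [q1 q2] : part h 1 s !=set0 /\ part h (-1) s !=set0.
  have [y0|y0|] := ltgtP (ev h y) 0; last by [].
    split; [exists (x - t0 *: y)|exists y]; split=> //=; last by rewrite ltr0_sgz.
    by rewrite hy' gtr0_sgz // oppr_gt0 pmulr_rlt0.
  split; [exists y|exists (x - t0 *: y)]; split=> //=; first by rewrite gtr0_sgz.
  by rewrite hy' ltr0_sgz // oppr_lt0 pmulr_rgt0.
split=> //.
have yin := ocone_in cs sy.
have yn : ~~ (y <:= dirm (part h 0 s)).
  apply/negP => /(ocone_dirmP _ (part_ocone cs n0))[a [b [[_ /= ha] [_ /= hb] ey]]].
  apply: evy; rewrite ey evB.
  by move: ha hb => /eqP; rewrite sgz_eq0 => /eqP-> /eqP; rewrite sgz_eq0 => /eqP->; rewrite subr0.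
have eqd : (dirm s <= dirm (part h 0 s) + y)%MS.
  apply/rV_subP => v vs; rewrite -(subrK ((ev h v / ev h y) *: y) v).
  apply: addmx_sub; last by rewrite scalemx_sub // addsmxSr.
  apply: submx_trans (addsmxSl _ _); apply: part_dirm_in => //.
    by apply: addmx_sub => //; rewrite -scaleNr scalemx_sub.
  by move=> _; rewrite !evE divfK ?subrr //; apply/eqP.
apply/eqP; rewrite eqn_leq; apply/andP; split.
  apply: leq_trans (mxrankS eqd) _; apply: leq_trans (mxrank_adds_leqif _ _) _.
  by have := rank_leq_row y; rewrite /rk; lia.
rewrite /rk (ltn_leqif (mxrank_leqif_sup (part_dirm_sub n0))).
by apply: contra yn; apply: submx_trans.
Qed.

Variables (W : 'M[R]_d) (F : seq (set E)) (fanF : fan W F) (h : 'cV[R]_d).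
Let Fo := fan_ocone fanF.
Local Notation F' := (cut h F).

Lemma part_in i s : s \in F -> i \in signs -> part h i s !=set0 -> part h i s \in F'.
Proof. by move=> sF ii n0; apply/cutP; exists s, i. Qed.

Lemma part_belowP i j s r : s \in F -> r \in F -> part h i r !=set0 ->
  part h j s !=set0 -> below (part h i r) (part h j s) <-> below r s /\ (i = 0 \/ i = j).
Proof.
move=> sF rF [x [rx hx]] [y [sy hy]]; split=> [b|[brs ij] x' y' [rx' /= hx'] [sy' /= hy']].
  have cp : ocone (part h j s) by apply: part_ocone; [exact: Fo|exists y].
  have cr : ocone (part h i r) by apply: part_ocone; [exact: Fo|exists x].
  have key (a : R) : 0 < a -> part h j s (x + a *: y).
    by move=> a0; apply: b => //; case: cp => _ _ Z _; apply: Z.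
  split; first by apply: (fan_frontier fanF sF rF rx sy) => a a0; case: (key _ a0).
  have [->|i0] := eqVneq i 0; [by left|right].
  have evx : ev h x != 0 by rewrite -sgz_eq0 hx.
  have [c c0 hc] := sgz_small (ev h y) evx.
  by have [_ /=] := key _ c0; rewrite -hx !evE hc.
split; first exact: brs.
rewrite /= evD -hy'; case: ij => ij; last first.
  by rewrite sgz_add_same // hx' hy'.
by move: hx'; rewrite ij => /eqP; rewrite sgz_eq0 => /eqP->; rewrite add0r.
Qed.

Lemma part_inj i j s r x : s \in F -> r \in F -> part h i s x -> part h j r x -> s = r /\ i = j.
Proof.
move=> sF rF [sx /= hx] [rx /= hx']; split; last by rewrite -hx hx'.
by apply: (fan_disj fanF sF rF sx).
Qed.

Lemma fan_cut : fan W F'.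
Proof.
split.
- rewrite map_inj_in_uniq ?filter_uniq //.
    by apply: allpairs_uniq; [exact: fan_uniq fanF|by []|by move=> [? ?] [? ?] _ _ [-> ->]].
  move=> [s i] [r j]; rewrite !mem_filter !mem_signed => /andP[/asboolP [x /= px] /andP[/= sF _]].
  move=> /andP[_ /andP[/= rF _]] /= e.
  have px' : part h j r x by rewrite -e.
  by have [-> ->] := part_inj sF rF px px'.
- by move=> _ /cutP[s [i [sF _ -> n0]]]; apply: part_ocone => //; exact: Fo.
- by move=> _ x /cutP[s [i [sF _ -> n0]]] [sx _]; by apply: (fan_sub fanF sF).
- move=> x /(fan_cover fanF)[s sF sx]; exists (part h (sgz (ev h x)) s) => //.
  by apply: part_in => //; [exact: sgz_signs|exists x].
- move=> _ _ x /cutP[s [i [sF _ -> _]]] /cutP[r [j [rF _ -> _]]] px qx.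
  by have [-> ->] := part_inj sF rF px qx.
move=> _ _ x y /cutP[s [i [sF _ -> n0]]] /cutP[r [j [rF _ -> n0']]] px py H.
apply/(part_belowP sF rF n0' n0).
have cp := part_ocone (Fo sF) n0.
split.
  apply: (fan_frontier fanF sF rF (part_sub px) (part_sub py)) => a a0.
  exact: part_sub (H _ a0).
have [->|j0] := eqVneq j 0; [by left|right].
have [_ /= hx] := px.
have evx : ev h x != 0 by rewrite -sgz_eq0 hx.
have [c c0 hc] := sgz_small (ev h y) evx.
by have [_ /=] := H _ c0; rewrite !evE hc hx.
Qed.

End Cut.

(** * Incidence numbers in the cut fan *)

Section CutTransfer.
Variables (R : realType) (d : nat).
Local Notation E := 'rV[R]_d.
Implicit Types (s r z t : set E) (x y v e u : E) (i j : int).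
Variables (W : 'M[R]_d) (F : seq (set E)) (fanF : fan W F) (h : 'cV[R]_d).
Let Fo := fan_ocone fanF.
Let fanF' := fan_cut fanF h.
Local Notation F' := (cut h F).
Local Notation P := (part h).

Definition fullb i s := `[< P i s !=set0 >] && (rk (P i s) == rk s).

Lemma inc_part s r s' r' e : s \in F -> r \in F -> s' \in F' -> r' \in F' ->
  below r s -> below r' s' -> rk s = (rk r).+1 -> rk s' = (rk r').+1 ->
  (dirm r' :=: dirm r)%MS -> s e -> s' e -> inc s' r' = inc s r.
Proof.
move=> sF rF sF' rF' b b' k k' eqd se se'.
have fB := row_base_free (dirm r); have eB := eq_row_base (dirm r).
have h1 := fan_inc fanF sF rF b k se fB eB.
have h2 := fan_inc fanF' sF' rF' b' k' se' fB (eqmx_trans eB (eqmx_sym eqd)).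
have B0 : bsgn (row_base (dirm r)) != 0 by case: (bsgn_free fB) => ->.
by apply: (mulIf B0); rewrite -h1 -h2.
Qed.

Lemma fan_bd_part i s r : s \in F -> r \in F -> i \in signs -> i != 0 ->
  P i s !=set0 -> P i r !=set0 -> fan_bd (P i s) (P i r) = fan_bd s r.
Proof.
move=> sF rF ii i0 ns nr; rewrite /fan_bd; have cs := Fo sF; have cr := Fo rF.
have bE : below (P i r) (P i s) <-> below r s.
  by rewrite (part_belowP fanF sF rF nr ns); split=> [[]|] //; split=> //; right.
rewrite (part_rk cs ns i0) (part_rk cr nr i0).
have [brs|nb] := pselect (below r s); last by rewrite !asboolF //= => /bE.
rewrite !asboolT //=; last by apply/bE.
case: eqP => //= k; have [e [se he]] := ns.
apply: (@inc_part _ _ _ _ e) => //; try exact: part_in.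
- exact: (proj2 bE brs).
- by rewrite (part_rk cs ns i0) (part_rk cr nr i0).
apply/eqmxP; rewrite part_dirm_sub //=; apply/rV_subP => v vr.
by apply: part_dirm_in => // i00; rewrite i00 eqxx in i0.
Qed.

Lemma part_trichotomy s : s \in F ->
  (exists2 i, i \in signs & P i s = s /\ forall j, j \in signs -> j <> i -> ~ (P j s !=set0)) \/
  [/\ P 0 s !=set0, P 1 s !=set0, P (-1) s !=set0 & rk s = (rk (P 0 s)).+1].
Proof.
move=> sF; have cs := Fo sF; have [[x sx] sD sZ _] := cs.
have [n0|n0] := pselect (P 0 s !=set0).
  have [e|[k p m]] := part0_cases cs n0; last by right.
  left; exists 0 => //; split=> // j _ j0 [y [sy /= hy]]; apply: j0.
  by move: sy; rewrite -hy -e => -[].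
have H y : s y -> sgz (ev h y) = sgz (ev h x).
  move=> sy; apply: contrapT => ne; apply: (n0).
  have Z a b : 0 < a -> b < 0 -> forall p q, s p -> s q -> ev h p = a -> ev h q = b -> P 0 s !=set0.
    move=> a0 b0 p q sp sq hp hq; exists ((- b) *: p + a *: q); split.
      by apply: sD; apply: sZ => //; rewrite oppr_gt0.
    by rewrite /= !evE hp hq mulNr mulrC addNr sgz0.
  have nz p : s p -> ev h p <> 0 by move=> sp hp; apply: n0; exists p; split=> //=; rewrite hp sgz0.
  case: (sgzP (ev h y)) ne (nz y sy); case: (sgzP (ev h x)) (nz x sx) => // hx _ hy //= _ _;
    [exact: (Z _ _ hy hx y x)|exact: (Z _ _ hx hy x y)].
left; exists (sgz (ev h x)); first exact: sgz_signs.
split; first by apply/seteqP; split=> [y []//|y sy]; split=> //=; exact: H.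
by move=> j _ jx [y [sy /= hy]]; apply: jx; rewrite -hy; exact: H.
Qed.

(** Only the part of [s] on the same side can have [P i r] in its boundary. Together with
    [sum_full_eq0] this computes the boundary of a subdivided cone. *)
Lemma sum_full_neq0 i s r : s \in F -> r \in F -> i \in signs -> i != 0 -> P i r !=set0 ->
  \sum_(j <- signs) (if fullb j s then fan_bd (P j s) (P i r) else 0) = fan_bd s r.
Proof.
move=> sF rF ii i0 nr; rewrite (@big_one _ _ _ _ i) //.
  rewrite /fullb; case: asboolP => ns /=.
    by rewrite (part_rk (Fo sF) ns i0) eqxx fan_bd_part.
  rewrite /fan_bd asboolF // => brs; apply: ns.
  have [x [rx hx]] := nr; have [[y sy] _ sZ _] := Fo sF.
  have evx : ev h x != 0 by rewrite -sgz_eq0 hx.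
  have [c c0 hc] := sgz_small (ev h y) evx.
  by exists (x + c *: y); split; [apply: brs => //; exact: sZ|rewrite /= !evE hc].
move=> j ij ji; case: ifP => // /andP[/asboolP ns _]; apply/eqP; apply: contrapT => /negP.
move=> /fan_bdP[/(part_belowP fanF sF rF nr ns)[_ [k|k]] _]; first by rewrite k eqxx in i0.
by apply: ji.
Qed.

(** If [r] lies in the hyperplane and [s] crosses it, then [P 0 s] lies strictly between any such
    [r] below [s] and [s], so that [r] is not of codimension one and both sides are 0. *)
Lemma sum_full_eq0 s r : s \in F -> r \in F -> P 0 r = r ->
  \sum_(j <- signs) (if fullb j s then fan_bd (P j s) r else 0) = fan_bd s r.
Proof.
move=> sF rF er; have r0 : P 0 r !=set0 by rewrite er; case: (Fo rF).
have [[i ii [e H]]|[n0 n1 n2 k]] := part_trichotomy sF.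
  rewrite (@big_one _ _ _ _ i) //.
    by rewrite /fullb e eqxx andbT asboolT //; case: (Fo sF).
  by move=> j jj ji; case: ifP => // /andP[/asboolP] /(H _ jj ji).
have key : below r s -> rk s = (rk r).+1 -> False.
  move=> brs k'; have /(part_belowP fanF sF rF r0 n0) b : below r s /\ (0 = 0 :> int \/ 0 = 0 :> int) by split=> //; left.
  have rs := rkS_neq k'.
  have : P 0 r <> P 0 s.
    rewrite er => e; have [x px] := n0; apply: rs.
    by apply: (fan_disj fanF rF sF (x := x)); [rewrite e|exact: part_sub px].
  have pF : P 0 r \in F' by exact: part_in.
  have qF : P 0 s \in F' by exact: part_in.
  by move=> /(fan_below_rk fanF' qF pF b); rewrite er; move: k k'; clear; lia.
rewrite big1_seq => [|j /andP[_ jj]].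
  by apply/esym/eqP; apply: contrapT => /negP/fan_bdP[]; exact: key.
case: ifP => // /andP[/asboolP ns /eqP kj]; apply/eqP; apply: contrapT => /negP/fan_bdP[b kb].
apply: key; last by rewrite -kj.
by move: b; rewrite -{1}er => /(part_belowP fanF sF rF r0 ns)[].
Qed.

(** The wall has rank one less than [r] and one less than [s]. So [r] and [s] have equal rank, and
    [r] below [s] then forces equality. *)
Lemma fan_bd_nonfull j s r : s \in F -> r \in F -> P 0 r !=set0 -> P 0 r <> r ->
  fullb j s -> fan_bd (P j s) (P 0 r) != 0 -> s = r.
Proof.
move=> sF rF n0 ne /andP[/asboolP ns /eqP kj] /fan_bdP[/(part_belowP fanF sF rF n0 ns)[b _] k].
apply: contrapT => sr; have := fan_below_rk fanF sF rF b (fun q => sr (esym q)).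
have [//|[k' _ _]] := part0_cases (Fo rF) n0.
by rewrite -kj k k' ltnn.
Qed.

(** The halves of [r] lie on opposite sides of the wall [P 0 r]. Their opposite signs are what makes
    a subdivided chain have no boundary on new walls. *)
Lemma fan_bd_nonfull_opp r : r \in F -> P 0 r !=set0 -> P 0 r <> r ->
  [/\ P 1 r !=set0, P (-1) r !=set0, fullb 1 r, fullb (-1) r
    & fan_bd (P (-1) r) (P 0 r) = - fan_bd (P 1 r) (P 0 r) /\
      fan_bd (P 1 r) (P 0 r) * fan_bd (P 1 r) (P 0 r) = 1].
Proof.
move=> rF n0 ne; have [//|[k n1 n2]] := part0_cases (Fo rF) n0.
have full i : i != 0 -> P i r !=set0 -> fullb i r.
  by move=> i0 ni; rewrite /fullb asboolT // (part_rk (Fo rF) ni i0) eqxx.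
split=> //; try by apply: full.
have inF i : i \in signs -> P i r !=set0 -> P i r \in F' by move=> ii ni; exact: part_in.
have b i : P i r !=set0 -> below (P 0 r) (P i r).
  move=> ni; apply/(part_belowP fanF rF rF n0 ni); split; last by left.
  by move=> x y rx ry; case: (Fo rF) => _ D _ _; exact: D.
have kk i : i != 0 -> P i r !=set0 -> rk (P i r) = (rk (P 0 r)).+1.
  by move=> i0 ni; rewrite (part_rk (Fo rF) ni i0).
split; last exact: (fan_bd_sq fanF' (inF 1 isT n1) (inF 0 isT n0) (b _ n1) (kk 1 isT n1)).
rewrite /fan_bd !asboolT /=; try exact: b.
rewrite (kk 1 isT n1) (kk (-1) isT n2) !eqxx /=.
have [e1 [re1 /= he1]] := n1; have [e2 [re2 /= he2]] := n2.
have fB := row_base_free (dirm (P 0 r)); have eB := eq_row_base (dirm (P 0 r)).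
have h1 := fan_inc fanF' (inF 1 isT n1) (inF 0 isT n0) (b _ n1) (kk 1 isT n1) (conj re1 he1) fB eB.
have h2 := fan_inc fanF' (inF (-1) isT n2) (inF 0 isT n0) (b _ n2) (kk (-1) isT n2) (conj re2 he2) fB eB.
have B0 : bsgn (row_base (dirm (P 0 r))) != 0 by case: (bsgn_free fB) => ->.
apply: (mulIf_opp B0 h2 h1).
have e1p : 0 < ev h e1 by apply/eqP/eqP; move/eqP: he1; rewrite sgz_cp0.
have e2n : ev h e2 < 0 by move/eqP: he2; rewrite sgz_cp0.
(* This factor puts the combination of [e1] and [e2] on the hyperplane, hence into the span of the
   wall. *)
apply: (bsgn_col_neg (a := - ev h e2 / ev h e1) fB); first by rewrite divr_gt0 // oppr_gt0.
rewrite eB; apply: part_dirm_in => //; first exact: Fo.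
  have in1 := ocone_in (Fo rF) re1; have in2 := ocone_in (Fo rF) re2.
  apply: addmx_sub; last apply: scalemx_sub.
    by rewrite -scaleN1r scalemx_sub.
  by rewrite -scaleN1r scalemx_sub.
by move=> _; rewrite !evE; field; rewrite gt_eqF.
Qed.

End CutTransfer.

(** * Subdivision as a chain map *)

Section FanExact.
Variables (R : realType) (d : nat) (M : zmodType).
Local Notation E := 'rV[R]_d.
Implicit Types (s r z t : set E) (F : seq (set E)) (x y v e u : E) (i j : int)
  (h : 'cV[R]_d) (a b w : set E -> M) (W : 'M[R]_d).

Definition bdF F a t : M := \sum_(s <- F) a s *~ fan_bd s t.

(* The homology of the fan is M, spanned by the constant top-dimensional chains. *)
Definition fan_exact W F :=
  (forall m t, t \in F -> bdF F (fun s => if rk s == \rank W then m else 0) t = 0) /\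
  forall a, (forall t, t \in F -> bdF F a t = 0) -> exists b m, forall t, t \in F ->
    a t = bdF F b t + (if rk t == \rank W then m else 0).

Lemma bdF_eq F a b t : {in F, forall s, a s = b s} -> bdF F a t = bdF F b t.
Proof. by move=> ab; apply: eq_big_seq => s sF; rewrite ab. Qed.

Lemma bdFB F a b t : bdF F (fun s => a s - b s) t = bdF F a t - bdF F b t.
Proof. by rewrite /bdF -sumrB; apply: eq_bigr => s _; rewrite mulrzBl. Qed.

Lemma bdFD F a b t : bdF F (fun s => a s + b s) t = bdF F a t + bdF F b t.
Proof. by rewrite /bdF -big_split; apply: eq_bigr => s _; rewrite mulrzDl. Qed.

Lemma bdF_bdF W F a t : fan W F -> t \in F -> bdF F (bdF F a) t = 0.
Proof.
move=> fanF tF; rewrite /bdF.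
under eq_bigr => r _ do rewrite mulrz_suml.
rewrite exchange_big big1_seq // => s /andP[_ sF].
under eq_bigr => r _ do rewrite -mulrzA.
by rewrite -mulrz_sumr (fan_bd_bd fanF sF tF) mulr0z.
Qed.

Section Transfer.
Variables (W : 'M[R]_d) (F : seq (set E)) (fanF : fan W F) (h : 'cV[R]_d).
Let Fo := fan_ocone fanF.
Let fanF' := fan_cut fanF h.
Local Notation F' := (cut h F).
Local Notation P := (part h).

Definition par t : set E := xget set0 [set s | s \in F /\ t `<=` s].

Lemma parE i s : s \in F -> P i s !=set0 -> par (P i s) = s.
Proof.
move=> sF [x px]; have [rF rs] : [set s' | s' \in F /\ P i s `<=` s'] (par (P i s)).
  by apply: xgetPex; exists s; split=> //; exact: part_sub.
exact: (fan_disj fanF rF sF (rs _ px) (part_sub px)).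
Qed.

(** The classical subdivision of a chain; the rank test singles out the walls newly created inside a
    cone, where the value is 0. *)
Definition subdiv a t : M := if rk t == rk (par t) then a (par t) else 0.

Definition crossing s := P 0 s !=set0 /\ P 0 s <> s.

Lemma nonfull_crossing i s : s \in F -> P i s !=set0 -> rk (P i s) <> rk s ->
  i = 0 /\ crossing s.
Proof.
move=> sF n0 k; have [i0|i0] := eqVneq i 0; last by case: k; exact: part_rk (Fo sF) n0 i0.
by subst i; do 2!split=> //; move=> e; apply: k; rewrite e.
Qed.

Lemma crossing_rk s : s \in F -> crossing s -> rk s = (rk (P 0 s)).+1.
Proof. by move=> sF [n0 ne]; case: (part0_cases (Fo sF) n0) => [|[]]. Qed.

(** On a new wall the two halves of the crossing cone cancel. On every other part the coefficients
    are those of [sum_full_neq0] and [sum_full_eq0]. *)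
Lemma bdF_subdiv a t : t \in F' -> bdF F' (subdiv a) t = subdiv (bdF F a) t.
Proof.
move=> /cutP[r [i [rF ii -> nr]]].
have -> : bdF F' (subdiv a) (P i r) = \sum_(s <- F) a s *~
    \sum_(j <- signs) (if fullb h j s then fan_bd (P j s) (P i r) else 0).
  rewrite /bdF sum_cut; apply: eq_big_seq => s sF; rewrite mulrz_sumr.
  apply: eq_bigr => j _; rewrite /fullb; case: asboolP => n0 /=; last by rewrite mulr0z.
  by rewrite /subdiv (parE sF n0); case: ifP; rewrite ?mul0rz ?mulr0z.
rewrite /subdiv (parE rF nr); case: eqP => k.
  apply: eq_big_seq => s sF; congr (_ *~ _).
  have [i0|i0] := eqVneq i 0; last by rewrite (sum_full_neq0 fanF sF rF ii i0 nr).
  have [er|ne] := pselect (P 0 r = r); first by rewrite i0 er (sum_full_eq0 fanF sF rF er).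
  have n0 : P 0 r !=set0 by rewrite -i0.
  by have := crossing_rk rF (conj n0 ne); rewrite -i0 k; lia.
have [i0 [n0 ne]] := nonfull_crossing rF nr k; subst i.
have [n1 n2 f1 f2 [op sq]] := fan_bd_nonfull_opp fanF rF n0 ne.
rewrite (big_one (r := r)) ?(fan_uniq fanF) //.
  rewrite !big_cons big_nil f1 f2 op {1}/fullb.
  by have /eqP/negbTE-> := k; rewrite andbF add0r addr0 subrr mulr0z.
move=> s sF sr; rewrite big1_seq ?mulr0z // => j _; case: ifP => // fj.
apply/eqP; apply: contrapT => /negP nb; apply: sr.
exact: (fan_bd_nonfull fanF sF rF n0 ne fj nb).
Qed.

(** The value of [w] on each new wall is cancelled by the boundary of a multiple of the adjacent
    half [P 1], so every chain is homologous to one that vanishes on the new walls. *)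
Lemma subdiv_normalize w : exists Y, forall s, s \in F -> crossing s ->
  w (P 0 s) - bdF F' Y (P 0 s) = 0.
Proof.
pose Y t := if `[< crossing (par t) /\ t = P 1 (par t) >]
  then w (P 0 (par t)) *~ fan_bd t (P 0 (par t)) else 0.
exists Y => r rF cr; have [n0 ne] := cr.
have [n1 n2 f1 f2 [op sq]] := fan_bd_nonfull_opp fanF rF n0 ne.
rewrite /bdF (big_one (r := P 1 r)) ?(fan_uniq fanF') //.
- rewrite /Y (parE rF n1) asboolT //.
  by rewrite -mulrzA sq mulr1z subrr.
- by apply: part_in.
move=> t /cutP[s [i [sF ii -> ns]]] ne1; rewrite /Y (parE sF ns).
case: asboolP => [[cs e1]|]; last by rewrite mul0rz.
apply/eqP; apply: contrapT => /negP nz.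
have nb : fan_bd (P i s) (P 0 r) != 0 by apply: contraNN nz => /eqP->; rewrite mulr0z.
have n1s : P 1 s !=set0 by rewrite -e1.
have fs : fullb h i s by rewrite /fullb asboolT // e1 (part_rk (Fo sF) n1s) // eqxx.
by apply: ne1; rewrite e1 (fan_bd_nonfull fanF sF rF n0 ne fs nb).
Qed.

(** If [w] and its boundary vanish on the new walls, then the two halves of a crossing cone carry
    the same value, which becomes the value on the uncut cone. *)
Lemma subdiv_lift w : (forall s, s \in F -> crossing s -> w (P 0 s) = 0) ->
  (forall s, s \in F -> crossing s -> bdF F' w (P 0 s) = 0) ->
  exists b, forall t, t \in F' -> w t = subdiv b t.
Proof.
move=> w0 dw0; exists (fun s => if `[< crossing s >] then w (P 1 s) else w s).
move=> _ /cutP[r [i [rF ii -> nr]]]; rewrite /subdiv (parE rF nr).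
case: eqP => k; last first.
  by have [-> cr] := nonfull_crossing rF nr k; exact: w0.
case: asboolP => [cr|ncr]; last first.
  have [[i' ii' [e H]]|[n0 n1 n2 k']] := part_trichotomy fanF h rF.
    have [->|ne] := eqVneq i i'; first by rewrite e.
    by case: (H i ii) => //; apply/eqP.
  by case: ncr; split=> // e; move: k'; rewrite e; lia.
have kr := crossing_rk rF cr; have [n0 ne] := cr.
have [n1 n2 f1 f2 [op sq]] := fan_bd_nonfull_opp fanF rF n0 ne.
have w12 : w (P (-1) r) = w (P 1 r).
  have := dw0 _ rF cr; rewrite /bdF (big_two (r := P 1 r) (r' := P (-1) r)) ?(fan_uniq fanF') ?part_in //.
  - rewrite op mulrNz -mulrzBl => /(congr1 (fun m => m *~ fan_bd (P 1 r) (P 0 r))).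
    by rewrite -mulrzA sq mulr1z mul0rz => /eqP; rewrite subr_eq0 => /eqP.
  - move=> e; have [x px] := n1; have qx := px; rewrite {1}e in qx.
    by case: px => _ /= h1; case: qx => _ /=; rewrite h1.
  move=> t /cutP[s [j [sF jj -> ns]]] ne1 ne2.
  apply/eqP; apply: contrapT => /negP nz.
  have nb : fan_bd (P j s) (P 0 r) != 0 by apply: contraNN nz => /eqP->; rewrite mulr0z.
  have [ks|/(nonfull_crossing sF ns)[j0 cs]] := pselect (rk (P j s) = rk s); last first.
    by move: nz; rewrite j0 w0 // mul0rz eqxx.
  have fs : fullb h j s by rewrite /fullb asboolT // ks eqxx.
  have e := fan_bd_nonfull fanF sF rF n0 ne fs nb; subst s.
  move: jj; rewrite !inE => /or3P[] /eqP jj; [|exact: ne1 (congr1 (P^~ r) jj)|exact: ne2 (congr1 (P^~ r) jj)].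
  by move: ks; rewrite jj kr => /n_Sn.
move: ii; rewrite !inE => /or3P[] /eqP ii; subst i => //.
by move: k; rewrite kr => /n_Sn.
Qed.

End Transfer.
End FanExact.

(** * Exactness of complete fans *)

Section FanTheorem.
Variables (R : realType) (d : nat) (M : zmodType).
Local Notation E := 'rV[R]_d.
Implicit Types (s r z t : set E) (F : seq (set E)) (x y v e u : E) (i j : int)
  (h : 'cV[R]_d) (a b w : set E -> M) (W : 'M[R]_d).

(** Subdivision is an injective chain map that preserves the constant top-dimensional chains [om m].
    By [subdiv_normalize] and [subdiv_lift], a cycle of the cut fan is homologous to a subdivided
    one, and a chain that bounds a subdivided chain can itself be chosen subdivided. *)
Lemma fan_exact_cut W F h : fan W F -> fan_exact M W F <-> fan_exact M W (cut h F).
Proof.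
move=> fanF; have fanF' := fan_cut fanF h; have Fo := fan_ocone fanF.
pose om m s : M := if rk s == \rank W then m else 0.
have rkW s : s \in F -> (rk s <= \rank W)%N by move=> sF; exact: mxrankS (fan_dirm fanF sF).
have pF t : t \in cut h F -> par F t \in F.
  by move=> /cutP[s [i [sF _ -> n0]]]; rewrite (parE fanF sF n0).
have prk t : t \in cut h F -> rk t <> rk (par F t) -> rk t <> \rank W.
  move=> /cutP[s [i [sF ii -> n0]]]; rewrite (parE fanF sF n0) => k e.
  have := mxrankS (part_dirm_sub n0); have := rkW _ sF; rewrite -/(rk _) -/(rk _).
  by move: k; rewrite e /rk; lia.
have Som m t : t \in cut h F -> subdiv F (om m) t = om m t.
  move=> tF; rewrite /subdiv /om; case: eqP => [->//|k].
  by case: eqP => // /(prk _ tF k).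
have crossP s : s \in F -> crossing h s -> part h 0 s \in cut h F.
  by move=> sF [n0 _]; exact: part_in.
have Scross a s : s \in F -> crossing h s -> subdiv F a (part h 0 s) = 0.
  move=> sF cs; have [n0 _] := cs.
  rewrite /subdiv (parE fanF sF n0) (crossing_rk fanF sF cs); case: eqP => // k.
  by case: (n_Sn _ k).
have fullpart s : s \in F -> exists2 t, t \in cut h F & par F t = s /\ rk t = rk s.
  move=> sF; have [[i ii [e _]]|[n0 n1 n2 k]] := part_trichotomy fanF h sF.
    have n0 : part h i s !=set0 by rewrite e; case: (Fo _ sF).
    by exists (part h i s); [exact: part_in|rewrite (parE fanF sF n0) e].
  exists (part h 1 s); first exact: part_in.
  by rewrite (parE fanF sF n1) (part_rk (Fo _ sF) n1).
have Sinj a : (forall t, t \in cut h F -> subdiv F a t = 0) -> forall s, s \in F -> a s = 0.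
  move=> H s /fullpart[t tF [ps rs]]; have := H _ tF.
  by rewrite /subdiv ps rs eqxx.
have SB a b t : subdiv F (fun s => a s - b s) t = subdiv F a t - subdiv F b t.
  by rewrite /subdiv; case: ifP; rewrite ?subrr.
have SD a b t : subdiv F (fun s => a s + b s) t = subdiv F a t + subdiv F b t.
  by rewrite /subdiv; case: ifP; rewrite ?addr0.
have Seq a b t : t \in cut h F -> {in F, forall s, a s = b s} -> subdiv F a t = subdiv F b t.
  by move=> tF ab; rewrite /subdiv ab // pF.
split=> -[om0 ex]; split.
- move=> m t tF; rewrite -(bdF_eq (a := subdiv F (om m))) => [|s sF]; last exact: Som.
  rewrite (bdF_subdiv fanF) // (Seq _ (fun=> 0)) // => [|s sF]; last exact: om0.
  by rewrite /subdiv; case: ifP.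
- move=> a da; have [Y hY] := subdiv_normalize fanF h a.
  pose a1 t := a t - bdF (cut h F) Y t.
  have da1 t : t \in cut h F -> bdF (cut h F) a1 t = 0.
    by move=> tF; rewrite bdFB da // (bdF_bdF _ fanF' tF) subrr.
  have [b hb] : exists b, forall t, t \in cut h F -> a1 t = subdiv F b t.
    apply: (subdiv_lift fanF) => [s sF cs|s sF cs]; first exact: hY.
    by apply: da1; exact: crossP.
  have db s : s \in F -> bdF F b s = 0.
    apply: Sinj => t tF; rewrite -(bdF_subdiv fanF (h := h)) // -(bdF_eq (a := a1)); first exact: da1.
    by move=> s' /hb ->.
  have [c [m hc]] := ex _ db.
  exists (fun t => Y t + subdiv F c t), m => t tF.
  rewrite bdFD (bdF_subdiv fanF) // -addrA -[X in _ + (_ + X)](Som m) // -SD.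
  have -> : subdiv F (fun s => bdF F c s + om m s) t = a1 t.
    by rewrite hb //; apply: Seq => // s sF; rewrite hc.
  by rewrite addrC subrK.
- move=> m s sF; apply: (Sinj (bdF F (om m))) => // t tF.
  rewrite -(bdF_subdiv fanF (h := h)) // -(om0 m _ tF); apply: bdF_eq => s' s'F; exact: Som.
move=> a da.
have dSa t : t \in cut h F -> bdF (cut h F) (subdiv F a) t = 0.
  move=> tF; rewrite (bdF_subdiv fanF) // (Seq _ (fun=> 0)) // /subdiv; by case: ifP.
have [w [m hw]] := ex _ dSa.
have [Y hY] := subdiv_normalize fanF h w.
pose w1 t := w t - bdF (cut h F) Y t.
have dw1 t : t \in cut h F -> bdF (cut h F) w1 t = bdF (cut h F) w t.
  by move=> tF; rewrite bdFB (bdF_bdF _ fanF' tF) subr0.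
have [b hb] : exists b, forall t, t \in cut h F -> w1 t = subdiv F b t.
  apply: (subdiv_lift fanF) => [s sF cs|s sF cs]; first exact: hY.
  (* On a new wall the boundary of [w] is the difference of a subdivided chain and a constant
     top-dimensional one, which are both 0 there. *)
  have pin := crossP _ sF cs; rewrite dw1 //; have := hw _ pin.
  rewrite Scross // -/(om m _) -Som // Scross // addr0 => <- //.
exists b, m => s sF; apply/eqP; rewrite -subr_eq0; apply/eqP.
pose g s := a s - (bdF F b s + om m s).
apply: (Sinj g) => // t tF; rewrite /g SB SD Som // -(bdF_subdiv fanF (h := h)) //.
have -> : bdF (cut h F) (subdiv F b) t = bdF (cut h F) w t.
  by rewrite -dw1 //; apply: bdF_eq => s' s'F; rewrite hb.
by rewrite hw // subrr.
Qed.

Definition cuts (hs : seq 'cV[R]_d) F := foldr (fun h => cut h) F hs.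

Lemma fan_cuts W F hs : fan W F -> fan W (cuts hs F).
Proof. by move=> fanF; elim: hs => [|h hs IH] //=; exact: fan_cut. Qed.

Lemma fan_exact_cuts W F hs : fan W F -> fan_exact M W F <-> fan_exact M W (cuts hs F).
Proof.
move=> fanF; elim: hs => [|h hs IH] //=.
by rewrite IH; apply: fan_exact_cut; exact: fan_cuts.
Qed.

Lemma cuts_memP W F (hs : seq 'cV[R]_d) t x y : fan W F -> t \in cuts hs F -> t x ->
  t y <-> (exists2 s, s \in F & s x /\ s y) /\ {in hs, forall h, sgz (ev h x) = sgz (ev h y)}.
Proof.
move=> fanF; elim: hs t => [|h hs IH] t /=.
  move=> tF tx; split=> [ty|[[s sF [sx sy]] _]]; first by split=> //; exists t.
  by rewrite (fan_disj fanF tF sF tx sx).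
move=> /cutP[s [i [sF ii -> n0]]] [sx /= hx]; split.
  move=> [/(IH _ sF sx)[H1 H2] /= hy]; split=> // k; rewrite inE => /orP[/eqP->|/H2//].
  by rewrite hx hy.
move=> [H1 H2]; split.
  by apply/(IH _ sF sx); split=> // k khs; apply: H2; rewrite inE khs orbT.
by rewrite /= -hx -H2 // mem_head.
Qed.

Lemma fan_exact_perm W F1 F2 : perm_eq F1 F2 -> fan_exact M W F1 -> fan_exact M W F2.
Proof.
move=> e; have bdE a t : bdF F1 a t = bdF F2 a t by apply: perm_big.
move=> [om0 ex]; split=> [m t tF|a da]; first by rewrite -bdE om0 // (perm_mem e).
have [|b [m hb]] := ex a; first by move=> t tF; rewrite bdE da // -(perm_mem e).
by exists b, m => t tF; rewrite -bdE hb // (perm_mem e).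
Qed.

Lemma fan_sub_self W : fan W [:: [set x | x <:= W]].
Proof.
have oc : ocone [set x | x <:= W].
  split; first by exists 0 => /=; rewrite sub0mx.
  - by move=> x y /= xW yW; exact: addmx_sub.
  - by move=> t x _ /= xW; exact: scalemx_sub.
  by move=> x y /= xW yW; exists 1 => //; rewrite -scaleNr addmx_sub ?scalemx_sub.
split=> //.
- by move=> s; rewrite inE => /eqP->.
- by move=> s x; rewrite inE => /eqP->.
- by move=> x xW; exists [set x | x <:= W] => //; rewrite inE.
- by move=> s r x; rewrite !inE => /eqP-> /eqP->.
move=> s r x y; rewrite !inE => /eqP-> /eqP-> _ _ _ p q /= pW qW; exact: addmx_sub.
Qed.

Lemma fan_exact_self W : fan_exact M W [:: [set x | x <:= W]].
Proof.
have bd0 a t : t \in [:: [set x | x <:= W]] -> bdF [:: [set x : E | x <:= W]] a t = 0.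
  rewrite inE => /eqP->; rewrite /bdF big_cons big_nil addr0 /fan_bd ifN ?mulr0z //.
  by rewrite negb_and; apply/orP; right; apply/eqP/n_Sn.
split=> [m t tF|a _]; first exact: bd0.
exists (fun=> 0), (a [set x | x <:= W]) => t tF; rewrite bd0 // add0r.
move: tF; rewrite inE => /eqP->; case: eqP => // k; exfalso; apply: k.
rewrite /rk; have [_ fo _ _ _ _] := fan_sub_self W.
have oc := fo _ (mem_head _ _).
apply/eqmx_rank/andP; split; apply/rV_subP => v.
  move=> /(ocone_dirmP _ oc)[p [q [/= pW qW ->]]].
  by apply: addmx_sub => //; rewrite -scaleN1r scalemx_sub.
by move=> vW; exact: ocone_in.
Qed.

Lemma separating_functionals W F : fan W F -> exists hs : seq 'cV[R]_d,
  forall r s, r \in F -> s \in F -> below r s -> r <> s ->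
  exists2 h, h \in hs & (forall x, r x -> ev h x = 0) /\ (forall y, s y -> 0 < ev h y).
Proof.
move=> fanF.
pose sep r s : 'cV[R]_d := xget 0
  [set h | (forall x, r x -> ev h x = 0) /\ (forall y, s y -> 0 < ev h y)].
exists (flatten [seq [seq sep r s | s <- F] | r <- F]) => r s rF sF brs ne.
exists (sep r s).
  by apply/flattenP; exists [seq sep r s | s <- F]; [exact: map_f|exact: map_f].
suff : [set h | (forall x, r x -> ev h x = 0) /\ (forall y, s y -> 0 < ev h y)] (sep r s) by [].
apply: xgetPex.
have [h [h0 h1]] := cone_separation (fan_ocone fanF sF)
  (fun x => fan_below_disj fanF sF rF brs ne (x := x)).
exists h; split=> // x rx; apply: h0; exact: ocone_in (fan_ocone fanF rF) rx.
Qed.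

Lemma sgz_conv (p q l : R) : sgz p = sgz q -> 0 <= l <= 1 ->
  sgz (p + l * (q - p)) = sgz p.
Proof.
move=> e /andP[l0 l1]; move: e; have [p0|p0|->] := ltrgt0P p.
- rewrite (gtr0_sgz p0) => /esym/eqP; rewrite sgz_cp0 => q0.
  by rewrite gtr0_sgz //; nra.
- rewrite (ltr0_sgz p0) => /esym/eqP; rewrite sgz_cp0 => q0.
  by rewrite ltr0_sgz //; nra.
by rewrite sgz0 => /esym/eqP; rewrite sgz_cp0 => /eqP->; rewrite subrr mulr0 addr0 sgz0.
Qed.

(** Go from [x] to [y] up to the supremum [l] of the times spent in [s]. If the point there is not
    in [s], it lies in a cone below [s]; if it is, the cone entered next lies above [s]. Either way
    a functional of [hs] vanishes at this point and is positive elsewhere on the segment, although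
    its sign is constant there. *)
Lemma sign_determined W F (hs : seq 'cV[R]_d) x y s : fan W F ->
  (forall r s, r \in F -> s \in F -> below r s -> r <> s -> exists2 h, h \in hs &
     (forall x, r x -> ev h x = 0) /\ (forall y, s y -> 0 < ev h y)) ->
  y <:= W -> {in hs, forall h, sgz (ev h x) = sgz (ev h y)} -> s \in F -> s x -> s y.
Proof.
move=> fanF sep yW hxy sF sx; apply: contrapT => nsy.
have xW := fan_sub fanF sF sx.
pose T := [set l : R | 0 <= l <= 1 /\ s (x + l *: (y - x))].
have T0 : T 0 by split; rewrite ?lexx ?ler01 // scale0r addr0.
have Tub : ubound T 1 by move=> l [/andP[]].
have Ts : has_sup T by split; [exists 0|exists 1].
have l0 : 0 <= sup T by apply: (ub_le_sup (proj2 Ts)).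
have l1 : sup T <= 1 by apply: sup_le_ub; [exists 0|].
set l := sup T in l0 l1; pose z := x + l *: (y - x).
have yxW : y - x <:= W by apply: addmx_sub => //; rewrite -scaleN1r scalemx_sub.
have zW : z <:= W by rewrite addmx_sub ?scalemx_sub.
have [r rF rz] := fan_cover fanF zW.
have seg k (t : R) : k \in hs -> 0 <= t <= 1 -> sgz (ev k (x + t *: (y - x))) = sgz (ev k x).
  by move=> kh t01; rewrite !evE sgz_conv // hxy.
have [ers|nrs] := pselect (r = s).
  have l1' : l < 1.
    rewrite lt_neqAle l1 andbT; apply/eqP => e; apply: nsy.
    by move: rz; rewrite ers /z e scale1r addrC subrK.
  have [s' s'F [b [t0 t00 ht]]] := fan_local fanF rF rz yxW.
  pose t := Num.min (t0 / 2) (1 - l).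
  have tp : 0 < t by rewrite lt_min; apply/andP; split; lra.
  have tt0 : t < t0 by rewrite gt_min; apply/orP; left; lra.
  have tl : l + t <= 1 by rewrite addrC -lerBrDr ge_min lexx orbT.
  have zt : z + t *: (y - x) = x + (l + t) *: (y - x) by rewrite /z; vec.
  have ss' : r <> s'.
    move=> e; have : T (l + t).
      by split; [apply/andP; split; lra|rewrite -zt -ers e; exact: ht].
    by move=> /(ub_le_sup (proj2 Ts)); rewrite -/l; lra.
  have [k kh [k0 k1]] := sep _ _ rF s'F b ss'.
  have := k1 _ (ht _ tp tt0); rewrite -sgz_gt0 zt seg //; last by apply/andP; split; lra.
  by rewrite -(seg k l kh) ?l0 // -/z k0 // sgz0.
have lp : 0 < l.
  rewrite lt_neqAle l0 andbT; apply/eqP => e; apply: nrs.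
  apply: (fan_disj fanF rF sF rz); by rewrite /z -e scale0r addr0.
have NW : (- l) *: (y - x) <:= W by rewrite scalemx_sub.
have [s' s'F [b [t0 t00 ht]]] := fan_local fanF rF rz NW.
have [||t [t01 st] lt] := @sup_adherent _ T (l * t0); [by rewrite mulr_gt0|by []|].
have tl : t < l.
  rewrite lt_neqAle; apply/andP; split; last by apply: (ub_le_sup (proj2 Ts)).
  by apply/eqP => e; apply: nrs; apply: (fan_disj fanF rF sF rz); rewrite /z -e.
have ss' : s = s'.
  apply: (fan_disj fanF sF s'F st).
  have -> : x + t *: (y - x) = z + ((l - t) / l) *: (- l *: (y - x)).
    by rewrite /z; apply/rowP => k; rewrite !mxE; field; rewrite gt_eqF.
  apply: ht; first by rewrite divr_gt0 // subr_gt0.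
  rewrite ltr_pdivrMr // mulrC; move: lt; rewrite -/l; lra.
have [k kh [k0 k1]] := sep _ _ rF sF ltac:(by rewrite ss') nrs.
have := k1 _ sx; rewrite -sgz_gt0 -(seg k l kh) ?l0 // -/z k0 // sgz0.
by [].
Qed.

Theorem fan_exactP W F : fan W F -> fan_exact M W F.
Proof.
move=> fanF; have [hs sep] := separating_functionals fanF.
have fan1 := fan_sub_self W.
apply/(fan_exact_cuts hs fanF).
apply: (@fan_exact_perm _ (cuts hs [:: [set x | x <:= W]])); last first.
  by apply/(fan_exact_cuts hs fan1); exact: fan_exact_self.
have c1 := fan_cuts hs fan1; have c2 := fan_cuts hs fanF.
(* By [sign_determined], a cone of either refinement consists of all vectors of [W] with one given
   vector of signs. *)
have key t1 t2 x : t1 \in cuts hs [:: [set x | x <:= W]] -> t2 \in cuts hs F ->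
    t1 x -> t2 x -> t1 = t2.
  move=> t1F t2F t1x t2x; apply/seteqP; split=> y.
    move=> t1y; have yW := fan_sub c1 t1F t1y.
    move/(cuts_memP _ fan1 t1F t1x): t1y => [_ hy].
    apply/(cuts_memP _ fanF t2F t2x); split=> //.
    have [s sF sx] := fan_cover fanF (fan_sub c2 t2F t2x).
    by exists s => //; split=> //; exact: (sign_determined fanF sep yW hy sF sx).
  move=> t2y; have yW := fan_sub c2 t2F t2y; have xW := fan_sub c2 t2F t2x.
  move/(cuts_memP _ fanF t2F t2x): t2y => [_ hy].
  apply/(cuts_memP _ fan1 t1F t1x); split=> //.
  by exists [set x | x <:= W]; rewrite ?mem_head.
apply: uniq_perm; [exact: fan_uniq c1|exact: fan_uniq c2|move=> t].
apply/idP/idP => tF.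
  have [[x tx] _ _ _] := fan_ocone c1 tF.
  have [t2 t2F t2x] := fan_cover c2 (fan_sub c1 tF tx).
  by rewrite (key _ _ _ tF t2F tx t2x).
have [[x tx] _ _ _] := fan_ocone c2 tF.
have [t1 t1F t1x] := fan_cover c1 (fan_sub c2 tF tx).
by rewrite -(key _ _ _ t1F tF t1x tx).
Qed.

End FanTheorem.

(** * Coexactness from a contracting homotopy *)

Section Coexact.
Variables (R : realType) (d : nat).
Local Notation E := 'rV[R]_d.
Implicit Types (s r q t : set E) (F : seq (set E)) (W : 'M[R]_d).

(** Exactness over the integers yields a matrix [H], row by row in the order of increasing rank of
    [s], that contracts the complex up to the constant top-dimensional chains. Unlike exactness
    itself, a matrix can be transposed and applied to any coefficients. *)
Lemma fan_contraction W F : fan W F -> exists (H : set E -> set E -> int) (m : set E -> int),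
  forall s t, s \in F -> t \in F ->
    (s == t)%:Z - \sum_(r <- F) fan_bd s r * H r t =
    \sum_(q <- F) H s q * fan_bd q t + (if (rk t == \rank W) && (rk s == \rank W) then m s else 0).
Proof.
move=> fanF; have [om0 ex] := fan_exactP int fanF.
have rkW s : s \in F -> (rk s <= \rank W)%N by move=> sF; exact: mxrankS (fan_dirm fanF sF).
pose good (H : set E -> set E -> int) (m : set E -> int) s :=
  (forall t, H s t != 0 -> rk t = (rk s).+1) /\ forall t, t \in F ->
    (s == t)%:Z - \sum_(r <- F) fan_bd s r * H r t =
    \sum_(q <- F) H s q * fan_bd q t + (if (rk t == \rank W) && (rk s == \rank W) then m s else 0).
suff [H [m good_m]] : exists H m, forall s, s \in F -> (rk s < (\rank W).+1)%N -> good H m s.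
  by exists H, m => s t sF tF; have [|_ ->] := good_m _ sF; rewrite // ltnS rkW.
elim: (\rank W).+1 => [|k [H [m IH]]].
  by exists (fun _ _ => 0), (fun=> 0).
have step s : s \in F -> rk s = k -> exists b c,
    (forall t, b t != 0 -> rk t = (rk s).+1) /\ forall t, t \in F ->
    (s == t)%:Z - \sum_(r <- F) fan_bd s r * H r t =
    \sum_(q <- F) b q * fan_bd q t + (if (rk t == \rank W) && (rk s == \rank W) then c else 0 : int).
  (* Row [s] of the identity minus what the rows built so far account for. It is a cycle, and the
     chain [b] that bounds it becomes row [s] of [H]. *)
  move=> sF rs; pose a t : int := (s == t)%:Z - \sum_(r <- F) fan_bd s r * H r t.
  have low r : r \in F -> fan_bd s r != 0 -> (rk r < k)%N /\ rk s = (rk r).+1.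
    by move=> rF /fan_bdP[_ e]; split=> //; rewrite -rs e.
  have supp t : a t != 0 -> rk t = rk s.
    move=> at0; apply: contrapT => ne; move/eqP: at0; apply.
    have -> : a t = - \sum_(r <- F) fan_bd s r * H r t.
      by rewrite /a; case: eqP => [e|_]; [case: ne; rewrite e|rewrite sub0r].
    rewrite big1_seq ?oppr0 // => r /andP[_ rF]; apply/eqP; rewrite mulf_eq0.
    apply: contrapT => /negP; rewrite negb_or => /andP[/(low _ rF)[rk1 e] h2].
    by have [/(_ _ h2) k2 _] := IH _ rF rk1; apply: ne; rewrite k2 e.
  have da t : t \in F -> bdF F a t = 0.
    move=> tF; rewrite /bdF; under eq_bigr => q _ do rewrite mulrzz mulrBl.
    rewrite sumrB (big_one (r := s)) ?(fan_uniq fanF) ?eqxx ?mul1r //; last first.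
      by move=> q _ qs; case: eqP => [e|]; rewrite ?mul0r //; case: qs.
    apply/eqP; rewrite subr_eq0; apply/eqP.
    under eq_bigr => q _ do rewrite mulr_suml.
    rewrite exchange_big /=.
    have e r : r \in F -> \sum_(q <- F) fan_bd s r * H r q * fan_bd q t =
        fan_bd s r * (r == t)%:Z - \sum_(q <- F) fan_bd s r * fan_bd r q * H q t.
      move=> rF; under eq_bigr => q _ do rewrite -mulrA.
      rewrite -mulr_sumr; have [->|nz] := eqVneq (fan_bd s r) 0.
        by rewrite !mul0r big1 ?subr0 // => q _; rewrite !mul0r.
      have [rk1 e] := low _ rF nz; have [_ /(_ _ tF)] := IH _ rF rk1.
      rewrite [rk r == _]ltn_eqF; last by rewrite -ltnS -e ltnS; exact: rkW.
      rewrite andbF addr0 => <-; rewrite mulrBr mulr_sumr; congr (_ - _).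
      by apply: eq_bigr => q _; rewrite mulrA.
    rewrite (eq_big_seq _ e) sumrB (big_one (r := t)) ?(fan_uniq fanF) ?eqxx ?mulr1 //; last first.
      by move=> q _ /eqP qt; rewrite (negbTE qt) mulr0.
    rewrite exchange_big /= big1_seq ?subr0 // => q /andP[_ qF].
    by rewrite -mulr_suml (fan_bd_bd fanF sF qF) mul0r.
  have [b [c hb]] := ex _ da.
  (* [a] lives in rank [rk s], so only the values of [b] one rank higher matter; the truncation
     keeps [H] homogeneous. *)
  exists (fun t => if rk t == (rk s).+1 then b t else 0), c; split=> [t|t tF].
    by case: ifP => [/eqP|_] //; rewrite eqxx.
  rewrite -/(a t); have [e|ne] := eqVneq (rk t) (rk s).
    rewrite hb // -e andbb; congr (_ + _); apply: eq_bigr => q _.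
    rewrite mulrzz; case: ifP => // k'; rewrite mul0r; apply/eqP; rewrite mulf_eq0.
    apply/orP; right; apply: contraFT k' => /fan_bdP[_ ->]; exact: eqxx.
  have -> : a t = 0 by apply/eqP; apply: contraNT ne => /supp ->.
  rewrite big1 => [|q _].
    by rewrite add0r; case: ifP => // /andP[/eqP e1 /eqP e2]; rewrite e1 e2 eqxx in ne.
  case: eqP => [e|_]; last by rewrite mul0r.
  apply/eqP; rewrite mulf_eq0; apply/orP; right; apply: contraNT ne => /fan_bdP[_].
  by rewrite e => -[->].
have /choice[bc hbc] : forall s, exists p : (set E -> int) * int,
    s \in F -> rk s = k -> (forall t, p.1 t != 0 -> rk t = (rk s).+1) /\ forall t, t \in F ->
    (s == t)%:Z - \sum_(r <- F) fan_bd s r * H r t =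
    \sum_(q <- F) p.1 q * fan_bd q t + (if (rk t == \rank W) && (rk s == \rank W) then p.2 else 0 : int).
  move=> s; have [sF|nF] := boolP (s \in F); last by exists (fun=> 0, 0).
  have [rs|nr] := eqVneq (rk s) k; last by exists (fun=> 0, 0) => _ e; rewrite e eqxx in nr.
  by have [b [c hb]] := step _ sF rs; exists (b, c).
exists (fun s => if rk s == k then (bc s).1 else H s), (fun s => if rk s == k then (bc s).2 else m s).
have same s t : s \in F -> (rk s <= k)%N -> \sum_(r <- F) fan_bd s r * (if rk r == k then (bc r).1 else H r) t
    = \sum_(r <- F) fan_bd s r * H r t.
  move=> sF sk; apply: eq_bigr => r _; case: eqP => // rk'.
  have [->|/fan_bdP[_ e]] := eqVneq (fan_bd s r) 0; first by rewrite !mul0r.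
  by move: sk; rewrite e rk' ltnn.
move=> s sF; rewrite ltnS => sk; have [e|ne] := eqVneq (rk s) k.
  have [h1 h2] := hbc _ sF e; have ek : (rk s == k) = true by apply/eqP.
  by split=> [t|t tF] /=; [rewrite ek; exact: h1|rewrite (same _ _ sF sk) ek h2].
have [|h1 h2] := IH _ sF; first by rewrite ltn_neqAle ne sk.
by split=> [t|t tF] /=; [rewrite (negbTE ne); exact: h1|rewrite (same _ _ sF sk) (negbTE ne) h2].
Qed.

(** This is the homotopy read from the other side. The term with [m] disappears because [phi] sums
    to 0 over the top-dimensional cones. *)
Lemma fan_coexact W F (V : zmodType) (phi : set E -> V) : fan W F ->
  (forall s, s \in F -> \sum_(r <- F) phi r *~ fan_bd s r = 0) ->
  \sum_(s <- F) (if rk s == \rank W then phi s else 0) = 0 ->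
  exists psi : set E -> V, forall s, s \in F -> phi s = \sum_(r <- F) psi r *~ fan_bd s r.
Proof.
move=> fanF dphi ophi; have [H [m hH]] := fan_contraction fanF.
exists (fun r => \sum_(t <- F) phi t *~ H r t) => s sF.
under eq_bigr => r _ do rewrite mulrz_suml.
rewrite exchange_big /=.
have e t : t \in F -> \sum_(r <- F) phi t *~ H r t *~ fan_bd s r =
    phi t *~ (s == t)%:Z - \sum_(q <- F) phi t *~ fan_bd q t *~ H s q
    - (if rk t == \rank W then phi t else 0) *~ (if rk s == \rank W then m s else 0).
  move=> tF; have <- : phi t *~ (\sum_(r <- F) fan_bd s r * H r t) = \sum_(r <- F) phi t *~ H r t *~ fan_bd s r.
    by rewrite mulrz_sumr; apply: eq_bigr => r _; rewrite -mulrzA mulrC.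
  have -> : \sum_(r <- F) fan_bd s r * H r t = (s == t)%:Z - \sum_(q <- F) H s q * fan_bd q t -
     (if (rk t == \rank W) && (rk s == \rank W) then m s else 0).
    by have := hH s t sF tF => h; rewrite -addrA -opprD -h opprB addrC subrK.
  rewrite !mulrzBr mulrz_sumr; congr (_ - _ - _).
    by apply: eq_bigr => q _; rewrite -mulrzA mulrC.
  by case: eqP; case: eqP; rewrite ?mulr0z ?mul0rz.
rewrite (eq_big_seq _ e) !sumrB (big_one (r := s)) ?(fan_uniq fanF) //; last first.
  by move=> t _ /eqP ts; rewrite eq_sym (negbTE ts) mulr0z.
rewrite eqxx mulr1z exchange_big /= big1_seq ?subr0 => [|q /andP[_ qF]]; last first.
  by rewrite -mulrz_suml dphi // mul0rz.
by rewrite -mulrz_suml ophi mul0rz subr0.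
Qed.

End Coexact.

(** * Polytopal complexes *)

Section EuclideanNorm.
Variables (R : realType) (d : nat).
Local Notation E := 'rV[R]_d.
Implicit Types (x y v : E).

Definition en v : R := Num.sqrt (\sum_(i < d) v 0 i ^+ 2).

Lemma edistE x y : edist x y = en (x - y).
Proof. by congr Num.sqrt; apply: eq_bigr => i _; rewrite !mxE. Qed.

Lemma en_ge0 v : 0 <= en v.
Proof. exact: sqrtr_ge0. Qed.

Lemma en_sqr v : en v ^+ 2 = \sum_(i < d) v 0 i ^+ 2.
Proof. by rewrite sqr_sqrtr // sumr_ge0 // => i _; rewrite sqr_ge0. Qed.

Lemma enZ (t : R) v : en (t *: v) = `|t| * en v.
Proof.
rewrite /en -sqrtr_sqr -sqrtrM ?sqr_ge0 // mulr_sumr.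
by congr Num.sqrt; apply: eq_bigr => i _; rewrite mxE exprMn.
Qed.

Lemma enN v : en (- v) = en v.
Proof. by rewrite -scaleN1r enZ normrN normr1 mul1r. Qed.

Lemma coord_le_en v i : `|v 0 i| <= en v.
Proof.
rewrite -sqrtr_sqr ler_wsqrtr // (bigD1 i) //= lerDl sumr_ge0 // => j _.
exact: sqr_ge0.
Qed.

Lemma en0_eq0 v : en v = 0 -> v = 0.
Proof.
move=> v0; apply/rowP => i; rewrite mxE; apply/eqP.
by rewrite -normr_le0 -v0 coord_le_en.
Qed.

End EuclideanNorm.

(** * Convexity and relative interiors of polytopes *)

Section Polytopes.
Variables (R : realType) (d : nat).
Local Notation E := 'rV[R]_d.
Implicit Types (c : set E) (x y v p : E).

Definition convex c := forall x y (t : R), 0 <= t <= 1 -> c x -> c y ->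
  c (x + t *: (y - x)).

Lemma polytope_convex c : polytope c -> convex c.
Proof.
move=> [n [p ->]] _ _ t /andP[t0 t1] [a [a0 a1 ->]] [b [b0 b1 ->]].
exists (fun i => a i + t * (b i - a i)); split.
- by move=> i; have := a0 i; have := b0 i; nra.
- by rewrite big_split /= -mulr_sumr sumrB a1 b1 subrr mulr0 addr0.
rewrite -sumrB scaler_sumr -big_split; apply: eq_bigr => i _.
by rewrite scalerDl -scalerBl scalerA.
Qed.

(** A polytope is a continuous image of a standard simplex. *)
Lemma polytope_compact c : polytope c -> compact c.
Proof.
move=> [n [p ->]].
pose f (a : 'rV[R]_n.+1) : E := \sum_i a 0 i *: p i.
pose S : set 'rV[R]_n.+1 := [set a | forall i, (a ord0 i) \in `[0, 1]] `&`
  [set a | \sum_i a 0 i = 1].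
have -> : [set x | exists a : 'I_n.+1 -> R,
    [/\ forall i, 0 <= a i, \sum_i a i = 1 & x = \sum_i a i *: p i]] = f @` S.
  apply/seteqP; split=> [x [a [a0 a1 ->]]|_ [a [a0 a1] <-]].
    exists (\row_i a i); last by apply: eq_bigr => i _; rewrite mxE.
    split=> [i|] /=; last by rewrite -[RHS]a1; apply: eq_bigr => i _; rewrite mxE.
    rewrite mxE in_itv /= a0 -a1 (bigD1 i) //= lerDl sumr_ge0 //.
  exists (fun i => a 0 i); split=> // i.
  by have := a0 i; rewrite in_itv => /andP[].
have cont (V : normedModType R) (q : 'I_n.+1 -> V) :
    continuous (fun a : 'rV[R]_n.+1 => \sum_i a 0 i *: q i).
  elim: (index_enum _) => [|i s IH].
    under eq_fun do rewrite big_nil; exact: cst_continuous.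
  under eq_fun do rewrite big_cons.
  move=> a; apply: continuousD (IH a); apply: (@cvgZr_tmp R V _ (nbhs a) (nbhs_filter a)); exact: (@coord_continuous R 1 n.+1 0 i a).
apply: continuous_compact; first by apply: continuous_subspaceT; exact: cont.
apply: compact_closedI.
  have := @rV_compact R n.+1 (fun=> `[0, 1]%classic) (fun _ => @segment_compact R 0 1).
  by congr compact.
pose g (a : 'rV[R]_n.+1) : R^o := \sum_i a 0 i *: (1 : R^o).
have gE a : g a = \sum_i a 0 i by apply: eq_bigr => i _; rewrite /GRing.scale /= mulr1.
rewrite [X in closed X](_ : _ = g @^-1` [set 1]); last first.
  by apply/seteqP; split=> a /=; rewrite gE.
apply: preimage_closed; first by move=> a _; exact: (cont R^o).
exact: closed_eq.
Qed.

Lemma polytope_closed c : polytope c -> closed c.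
Proof. by move=> /polytope_compact; apply: compact_closed; exact: norm_hausdorff. Qed.

Lemma closed_away c x : closed c -> ~ c x ->
  exists2 r : R, 0 < r & forall y, `|y - x| < r -> ~ c y.
Proof.
move=> /closed_openC cc ncx; have /nbhs_ballP[r /= r0 hr] := open_nbhs_nbhs (conj cc ncx).
exists r => // y yr; apply: hr; rewrite mx_norm_ball /ball_ /= distrC; exact: yr.
Qed.

Lemma closed_ray c x v (r : R) : closed c -> 0 < r ->
  (forall t, 0 < t -> t < r -> c (x + t *: v)) -> c x.
Proof.
move=> cc r0 h; apply: contrapT => /(closed_away cc)[q q0 hq].
pose t := Num.min (r / 2) (q / (2 * (`|v| + 1))).
have v1 : 0 < 2 * (`|v| + 1) by have := normr_ge0 v; lra.
have t0 : 0 < t by rewrite lt_min !divr_gt0.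
apply: (hq (x + t *: v)); last by apply: h => //; rewrite gt_min; apply/orP; left; lra.
rewrite addrC addKr normrZ gtr0_norm //.
have : t <= q / (2 * (`|v| + 1)) by rewrite ge_min lexx orbT.
by rewrite ler_pdivlMr //; have := normr_ge0 v; nra.
Qed.

Lemma polytope_bounded c : polytope c -> exists B : R, forall x, c x -> `|x| <= B.
Proof.
move=> /polytope_compact/compact_bounded[B [_ hB]]; exists (B + 1) => x cx.
by apply: hB => //; lra.
Qed.

Lemma relint_ray c x v : relint c x -> v <:= dirm c ->
  exists2 t0 : R, 0 < t0 & forall t, `|t| < t0 -> c (x + t *: v).
Proof.
move=> [cx [e e0 he]] vc; have n1 : 0 < en v + 1 by have := en_ge0 v; lra.
exists (e / (en v + 1)); first by rewrite divr_gt0.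
move=> t; rewrite ltr_pdivlMr // => te; apply: he.
  apply/(affine_hullE _ (affine_hull_sub cx)).
  by rewrite addrC addKr scalemx_sub.
rewrite edistE opprD addrA subrr sub0r enN enZ.
by have := en_ge0 v; have := normr_ge0 t; nra.
Qed.

(** The homothety with centre [x] and ratio [t] carries a neighbourhood of [y] in [c] to one of
    [x + t *: (y - x)]. *)
Lemma relint_segment c x y (t : R) : convex c -> c x -> relint c y -> 0 < t <= 1 ->
  relint c (x + t *: (y - x)).
Proof.
move=> cc cx [cy [e e0 he]] /andP[t0 t1]; have t01 : 0 <= t <= 1 by lra.
split; first exact: cc.
exists (t * e); first exact: mulr_gt0.
move=> z az; rewrite edistE => zt; pose y' := y + t^-1 *: (z - (x + t *: (y - x))).
have -> : z = x + t *: (y' - x).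
  by rewrite /y'; apply/rowP => i; rewrite !mxE; field; rewrite gt_eqF.
apply: cc => //; have aff := affine_hullE _ (affine_hull_sub cx).
have D u w : u <:= dirm c -> w <:= dirm c -> u - w <:= dirm c.
  by move=> hu hw; apply: addmx_sub => //; rewrite -scaleN1r scalemx_sub.
apply: he; rewrite ?edistE.
  apply/aff; have -> : y' - x = (y - x) + t^-1 *: ((z - x) - t *: (y - x)).
    by rewrite /y'; vec.
  have yx : y - x <:= dirm c by apply/aff; exact: affine_hull_sub.
  by rewrite addmx_sub // scalemx_sub // D ?scalemx_sub //; apply/aff.
have -> : y - y' = t^-1 *: (x + t *: (y - x) - z) by rewrite /y'; vec.
by rewrite enZ gtr0_norm ?invr_gt0 // mulrC ltr_pdivrMr // mulrC.
Qed.

Lemma relint_between c x p (t : R) : convex c -> relint c p -> 0 < t ->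
  c (x + t *: (x - p)) -> relint c x.
Proof.
move=> cc rp t0 h; have t1 : 0 < 1 + t by lra.
have := relint_segment (t := t / (1 + t)) cc h rp.
have -> : x + t *: (x - p) + (t / (1 + t)) *: (p - (x + t *: (x - p))) = x.
  by apply/rowP => i; rewrite !mxE; field; rewrite gt_eqF.
by apply; rewrite divr_gt0 //= ler_pdivrMr //; lra.
Qed.

Lemma relint_convex c : convex c -> convex (relint c).
Proof.
move=> cc x y t /andP[]; rewrite le_eqVlt => /predU1P[<-|t0] t1 rx ry.
  by rewrite scale0r addr0.
by apply: relint_segment => //; [case: rx|rewrite t0].
Qed.

Lemma relint_sub c : relint c `<=` c.
Proof. by move=> x []. Qed.

Lemma relint_open c x v : convex c -> relint c x -> v <:= dirm c ->
  exists2 t0 : R, 0 < t0 & forall t, `|t| < t0 -> relint c (x + t *: v).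
Proof.
move=> cc rx vc; have [t0 t00 ht] := relint_ray rx vc.
exists (t0 / 2) => [|t]; first lra.
rewrite ltr_norml => /andP[ta tb].
apply: (@relint_between _ _ x 1) => //.
have -> : x + t *: v + 1 *: (x + t *: v - x) = x + (2 * t) *: v by vec.
by apply: ht; rewrite ltr_norml; apply/andP; split; lra.
Qed.

(** The barycentre [x0] of the points [p i] is interior: a small displacement is a combination of
    the vectors [p i - x0] with small coefficients, read off from a pseudo-inverse, and the weights
    [N^-1] of the barycentre absorb them. *)
Lemma polytope_relint c : polytope c -> relint c !=set0.
Proof.
move=> pc; have cc := polytope_convex pc; case: pc => n [p ec].
pose N : R := n.+1%:R; have N0 : 0 < N by rewrite ltr0n.
pose x0 := \sum_i N^-1 *: p i.
have sN : \sum_(i < n.+1) N^-1 = 1.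
  by rewrite sumr_const card_ord -[_ *+ _]mulr_natr mulVf // gt_eqF.
have cx : c x0.
  by rewrite ec; exists (fun=> N^-1); split=> // i; rewrite invr_ge0 ltW.
exists x0; split=> //.
pose A := \matrix_(i < n.+1) (p i - x0).
have cp i : c (p i).
  rewrite ec; exists (fun j => (j == i)%:R); split=> [j||].
  - by rewrite ler0n.
  - by rewrite (bigD1 i) //= eqxx big1 ?addr0 // => j /negbTE ->.
  rewrite (bigD1 i) //= eqxx scale1r big1 ?addr0 // => j /negbTE ->.
  by rewrite scale0r.
have dA : (dirm c <= A)%MS.
  apply: (dirm_min cx) => x; rewrite {1}ec => -[a [a0 a1 ->]].
  have -> : \sum_i a i *: p i - x0 = \sum_i a i *: (p i - x0).
    rewrite -[x0 in LHS]scale1r -a1 scaler_suml -sumrB.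
    by apply: eq_bigr => j _; rewrite scalerBr.
  apply: summx_sub => i _; rewrite scalemx_sub //.
  by have := row_sub i A; rewrite rowK.
pose Q := pinvmx A; pose K : R := \sum_i \sum_j `|Q j i| + 1.
have K0 : 0 < K.
  by rewrite ltr_wpDl // sumr_ge0 // => i _; rewrite sumr_ge0.
exists (N^-1 / (2 * K)); first by rewrite divr_gt0 ?invr_gt0 ?mulr_gt0.
move=> y ay; rewrite edistE => hy.
have : y - x0 <:= A.
  by apply: submx_trans dA; apply/(affine_hullE _ (affine_hull_sub cx)).
move=> /mulmxKpV; set l := _ *m pinvmx A => el.
have lb i : `|l 0 i| <= N^-1 / 2.
  rewrite mxE; apply: le_trans (ler_norm_sum _ _ _) _.
  apply: (@le_trans _ _ (\sum_j en (x0 - y) * `|Q j i|)).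
    apply: ler_sum => j _; rewrite normrM ler_wpM2r //.
    by rewrite -enN opprB; exact: coord_le_en.
  rewrite -mulr_sumr.
  have h1 : \sum_j `|Q j i| <= K.
    rewrite /K (bigD1 i) //= -addrA lerDl addr_ge0 // sumr_ge0 // => k _.
    by rewrite sumr_ge0.
  move: hy; rewrite ltr_pdivlMr ?mulr_gt0 // => hy.
  move: h1 hy (en_ge0 (x0 - y)); clear.
  move: (\sum_j _) (en _) (N^-1) K => z1 z2 z3 z4 h1 h2 h3.
  have := ler_wpM2l h3 h1; lra.
have ey : y = x0 + \sum_i l 0 i *: (p i - x0).
  rewrite -[y in LHS](subrK x0) -el addrC; congr (_ + _).
  by rewrite mulmx_sum_row; apply: eq_bigr => i _; rewrite rowK.
pose s := \sum_i l 0 i.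
have sb : `|s| <= 2^-1.
  apply: le_trans (ler_norm_sum _ _ _) _.
  apply: (@le_trans _ _ (\sum_(i < n.+1) N^-1 / 2)); first by apply: ler_sum.
  by rewrite -mulr_suml sN mul1r.
(* The coefficients [l], of sum [s], are completed by a multiple of the barycentre to sum 1; their
   bound [N^-1 / 2] and the bound [1 / 2] on [s] keep the weights nonnegative. *)
rewrite ec; exists (fun i => l 0 i + (1 - s) * N^-1); split.
- move=> i; have := lb i; rewrite ler_norml => /andP[h1 h2].
  move: sb; rewrite ler_norml => /andP[h3 h4].
  have : 0 < N^-1 by rewrite invr_gt0.
  move: h1 h2 h3 h4; clear; move: (l 0 i) s (N^-1) => z1 z2 z3; nra.
- by rewrite big_split /= -mulr_sumr sN mulr1 addrC subrK.
rewrite ey; under eq_bigr => i _ do rewrite scalerBr.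
rewrite sumrB -scaler_suml -/s.
under [RHS]eq_bigr => i _ do rewrite scalerDl -scalerA.
by rewrite big_split /= -scaler_sumr -/x0; vec.
Qed.

End Polytopes.

(** * Local consequences of the CW axioms *)

Section CellComplex.
Variables (R : realType) (d : nat).
Local Notation E := 'rV[R]_d.
Implicit Types (c b : set E) (x y v p : E).

(** The supremum of the times reached is reached, as [c] is closed, and can be exceeded unless it is
    1. *)
Lemma closed_convex_reach c x v : closed c -> convex c -> c x ->
  (forall t : R, 0 <= t < 1 -> c (x + t *: v) -> exists2 e : R, 0 < e & c (x + (t + e) *: v)) ->
  c (x + v).
Proof.
move=> cc kc cx H; pose T := [set t : R | 0 <= t <= 1 /\ c (x + t *: v)].
have T0 : T 0 by split; rewrite ?lexx ?ler01 // scale0r addr0.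
have Tub : ubound T 1 by move=> l [/andP[]].
have Ts : has_sup T by split; [exists 0|exists 1].
set l := sup T; have l0 : 0 <= l by apply: (ub_le_sup (proj2 Ts)).
have l1 : l <= 1 by apply: sup_le_ub; [exists 0|].
have dn s t : T t -> 0 <= s <= t -> c (x + s *: v).
  move=> [/andP[t0 t1] ct] /andP[s0 st].
  have [t00|tn] := eqVneq t 0.
    have s00 : s = 0 by lra.
    by rewrite s00 scale0r addr0.
  have -> : x + s *: v = x + (s / t) *: (x + t *: v - x).
    by apply/rowP => i; rewrite !mxE; field.
  by apply: kc => //; rewrite divr_ge0 //= ler_pdivrMr ?mul1r // lt_neqAle eq_sym tn.
have lt t : 0 <= t < l -> c (x + t *: v).
  move=> /andP[t0 tl]; have tl0 : 0 < l - t by rewrite subr_gt0.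
  have [s Ts' st] := sup_adherent tl0 Ts.
  by apply: dn Ts' _; rewrite t0 /=; move: st; rewrite -/l; lra.
have cl : c (x + l *: v).
  move: l0; rewrite le_eqVlt => /predU1P[<-|l0]; first by rewrite scale0r addr0.
  apply: (@closed_ray _ _ _ _ (- v) l) => // t t0 tl.
  have -> : x + l *: v + t *: - v = x + (l - t) *: v by vec.
  by apply: lt; apply/andP; split; lra.
move: l1; rewrite le_eqVlt => /predU1P[l1|l1]; first by move: cl; rewrite l1 scale1r.
have [|e e0 ce] := H l _ cl; first by rewrite l0.
pose e' := Num.min e (1 - l).
have e'0 : 0 < e' by rewrite lt_min e0 subr_gt0.
have : T (l + e').
  have e1 : e' <= 1 - l by rewrite ge_min lexx orbT.
  split; first by apply/andP; split; lra.
  have [t Tt] : exists t, T t by exists 0.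
  have ee : e' <= e by rewrite ge_min lexx.
  have -> : x + (l + e') *: v = x + l *: v + (e' / e) *: (x + (l + e) *: v - (x + l *: v)).
    by apply/rowP => i; rewrite !mxE; field; rewrite gt_eqF.
  apply: kc => //; apply/andP; split; first by rewrite divr_ge0 ?ltW.
  by rewrite ler_pdivrMr // mul1r.
by move=> /(ub_le_sup (proj2 Ts)); rewrite -/l; lra.
Qed.

(** A segment that starts in the relative interior can leave [c] only through a point of [c] outside
    the relative interior. *)
Lemma relint_exit c x v : closed c -> convex c -> relint c x -> v <:= dirm c ->
  (forall t : R, 0 < t < 1 -> c (x + t *: v) -> relint c (x + t *: v)) -> c (x + v).
Proof.
move=> cc kc rx vc H; apply: closed_convex_reach => //; first by case: rx.
move=> t /andP[t0 t1] ct; have rt : relint c (x + t *: v).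
  move: t0; rewrite le_eqVlt => /predU1P[<-|t0]; first by rewrite scale0r addr0.
  by apply: H => //; rewrite t0.
have [e e0 he] := relint_ray rt vc.
exists (e / 2); first lra.
have -> : x + (t + e / 2) *: v = x + t *: v + (e / 2) *: v by vec.
by apply: he; rewrite gtr0_norm; lra.
Qed.

Lemma has_dimE k c : c !=set0 -> has_dim k c <-> rk c = k.
Proof.
move=> c0; split=> [[B /(frameE _ c0)[fB eB]]|<-].
  by rewrite /rk -eB; apply/eqP.
by exists (row_base (dirm c)); apply/frameE => //; split; [exact: row_base_free|exact: eq_row_base].
Qed.

Variables (C : set (set E)) (hC : polytopal_CW C).

Lemma cell_convex c : C c -> convex c.
Proof. by move=> /(CW_polytope hC)/polytope_convex. Qed.

Lemma cell_closed c : C c -> closed c.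
Proof. by move=> /(CW_polytope hC)/polytope_closed. Qed.

Lemma cell_relint0 c : C c -> relint c !=set0.
Proof. by move=> /(CW_polytope hC)/polytope_relint. Qed.

Lemma cell_nonempty c : C c -> c !=set0.
Proof. by move=> /cell_relint0[x []]; exists x. Qed.

Lemma cell_at x : exists2 c, C c & relint c x.
Proof. by have [c [[? ?] _]] := CW_partition hC x; exists c. Qed.

Lemma cell_uniq c b x : C c -> C b -> relint c x -> relint b x -> c = b.
Proof.
move=> Cc Cb rc rb; have [a [_ h]] := CW_partition hC x.
by rewrite -(h c) // (h b).
Qed.

Lemma cell_boundary c : C c -> exists s : seq (set E),
  (forall b, b \in s -> C b /\ (rk b < rk c)%N) /\
  forall x, c x -> ~ relint c x -> exists2 b, b \in s & b x.
Proof.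
move=> Cc; have c0 := cell_nonempty Cc.
have [S [/finite_seqP[s ->] SC Sd Sb]] := CW_closure_finite hC Cc (proj2 (has_dimE (rk c) c0) erefl).
exists s; split=> [b bs|x cx nx].
  have Cb := SC _ bs; split=> //; have [j jk /(has_dimE _ (cell_nonempty Cb))->] := Sd _ bs.
  by [].
by have [b bs bx] := Sb _ (conj cx nx); exists b.
Qed.

(** Closure finiteness, iterated over the dimension. *)
Lemma cell_cover c : C c -> exists s : seq (set E),
  (forall b, b \in s -> C b) /\ forall x, c x -> exists2 b, b \in s & relint b x.
Proof.
have [n] := ubnP (rk c); elim: n c => // n IH c; rewrite ltnS => cn Cc.
have [s [sC sB]] := cell_boundary Cc.
have : exists s' : seq (set E), (forall b, b \in s' -> C b) /\
    forall x, (exists2 b, b \in s & b x) -> exists2 b, b \in s' & relint b x.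
  have : forall b, b \in s -> exists s' : seq (set E), (forall b, b \in s' -> C b) /\
      forall x, b x -> exists2 b, b \in s' & relint b x.
    by move=> b /sC[Cb bc]; apply: IH => //; exact: leq_trans bc cn.
  elim: (s) => [|a l IHl] H; first by exists [::]; split=> // x [].
  have [|s1 [s1C s1R]] := IHl; first by move=> b bl; apply: H; rewrite inE bl orbT.
  have [s2 [s2C s2R]] := H a (mem_head _ _).
  exists (s1 ++ s2); split=> [b|x [b]]; rewrite ?mem_cat ?inE.
    by move=> /orP[/s1C|/s2C].
  move=> /orP[/eqP->|bl] bx.
    by have [e es ex] := s2R _ bx; exists e; rewrite // mem_cat es orbT.
  have [|e es ex] := s1R x; first by exists b.
  by exists e; rewrite // mem_cat es.
move=> [s' [s'C s'R]]; exists (c :: s'); split=> [b|x cx].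
  by rewrite inE => /orP[/eqP->//|/s'C].
have [rx|nx] := pselect (relint c x); first by exists c; rewrite ?mem_head.
by have [b bs bx] := s'R _ (sB _ cx nx); exists b; rewrite // inE bs orbT.
Qed.

(* A sequence meeting every open cell finitely often is a closed discrete set,
   by the weak topology. *)
Lemma no_accumulation (y : nat -> E) p :
  (forall r : R, 0 < r -> exists N, forall n, (N <= n)%N -> `|y n - p| < r) ->
  (forall c, C c -> exists N, forall n, (N <= n)%N -> ~ relint c (y n)) -> False.
Proof.
move=> yp yc; pose A := [set z | exists2 n, y n = z & z <> p].
have cA : closed A.
  apply: (CW_weak_topology hC) => c Cc.
  have [s [sC sR]] := cell_cover Cc.
  have [N hN] : exists N, forall n, (N <= n)%N -> forall b, b \in s -> ~ relint b (y n).
    elim: (s) sC => [|a l IH] sC; first by exists 0%N.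
    have [|N1 h1] := IH; first by move=> b bl; apply: sC; rewrite inE bl orbT.
    have [N2 h2] := yc a (sC a (mem_head _ _)).
    exists (maxn N1 N2) => n; rewrite geq_max => /andP[n1 n2] b.
    by rewrite inE => /orP[/eqP->|]; [exact: h2|exact: h1].
  apply: (proj1 (@accessible_finite_set_closed E) (hausdorff_accessible (@norm_hausdorff _ _))).
  apply: (@sub_finite_set _ _ (y @` `I_N)); last exact/finite_image/finite_II.
  move=> z [[n <- _] cz]; exists n => //=; rewrite ltnNge; apply/negP => /hN h.
  by have [b bs] := sR _ cz; exact: h.
have nA : ~ A p by move=> [n].
have [r r0 hr] := closed_away cA nA.
have [N hN] := yp _ r0; have [c Cc rc] := cell_at p; have [N' hN'] := yc _ Cc.
pose n := maxn N N'; have := hr _ (hN n (leq_maxl _ _)).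
move=> _; have e : y n = p.
  by apply: contrapT => ne; apply: (hr _ (hN n (leq_maxl _ _))); exists n.
by apply: (hN' n (leq_maxr _ _)); rewrite e.
Qed.

Lemma small_invS (r : R) : 0 < r -> exists N, forall n, (N <= n)%N -> n.+1%:R^-1 < r.
Proof.
move=> r0; exists (Num.truncn r^-1) => n nN.
have : r^-1 < n.+1%:R by rewrite (lt_le_trans (truncnS_gt _)) // ler_nat.
by move=> h; rewrite -[r]invrK ltf_pV2 ?posrE ?invr_gt0 // ltr0n.
Qed.

(** The points [x + n.+1%:R^-1 *: v] converge to [x], so by [no_accumulation] some open cell
    contains infinitely many of them, and by convexity the segments between them. *)
Lemma cell_local x v : exists2 c, C c & exists2 t0 : R, 0 < t0 &
  forall t, 0 < t -> t < t0 -> relint c (x + t *: v).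
Proof.
pose y n := x + n.+1%:R^-1 *: v.
have [c [Cc hc]] : exists c, C c /\ forall N, exists2 n, (N <= n)%N & relint c (y n).
  apply: contrapT => H; apply: (@no_accumulation y x) => [r r0|c Cc].
    have v0 : 0 < `|v| + 1 by have := normr_ge0 v; lra.
    have [N hN] := small_invS (divr_gt0 r0 v0); exists N => n /hN.
    rewrite ltr_pdivlMr // => hn; rewrite /y addrC addKr normrZ gtr0_norm ?invr_gt0 ?ltr0n //.
    by apply: le_lt_trans hn; rewrite ler_wpM2l ?invr_ge0 ?ler0n //; lra.
  apply: contrapT => H'; apply: H; exists c; split=> // N.
  apply: contrapT => H; apply: H'; exists N => n Nn rn; apply: H; by exists n.
exists c => //; have [n0 _ h0] := hc 0%N.
exists n0.+1%:R^-1; first by rewrite invr_gt0 ltr0n.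
move=> t t0 tn; have [N hN] := small_invS t0; have [n Nn hn] := hc N.
have nt := hN _ Nn.
have D : 0 < n0.+1%:R^-1 - n.+1%:R^-1 :> R by rewrite subr_gt0 (lt_trans nt tn).
have -> : x + t *: v = y n + ((t - n.+1%:R^-1) / (n0.+1%:R^-1 - n.+1%:R^-1)) *: (y n0 - y n).
  rewrite /y; move: D; move: (n0.+1%:R^-1 : R) (n.+1%:R^-1 : R) => q q' D.
  by apply/rowP => i; rewrite !mxE; field; rewrite gt_eqF.
apply: (relint_convex (cell_convex Cc)) => //.
apply/andP; split; first by rewrite divr_ge0 ?ltW // subr_gt0.
by rewrite ler_pdivrMr // mul1r lerD2r ltW.
Qed.

End CellComplex.

(** * The frontier condition and local finiteness for cells *)

Section Frontier.
Variables (R : realType) (d : nat).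
Local Notation E := 'rV[R]_d.
Implicit Types (c b : set E) (x y v p : E).
Variables (C : set (set E)) (hC : polytopal_CW C).

Let kC := cell_convex hC.
Let clC := cell_closed hC.

Lemma subset_dirm c b : c !=set0 -> c `<=` b -> (dirm c <= dirm b)%MS.
Proof.
move=> [x cx] cb; apply: (dirm_min cx) => y cy.
by apply: dirm_sub; apply: affine_hull_sub; exact: cb.
Qed.

Lemma dirm_subin c x y : c x -> c y -> y - x <:= dirm c.
Proof. by move=> cx cy; apply: dirm_sub; exact: affine_hull_sub. Qed.

Lemma local_boundary c x (s : seq (set E)) : (forall b, b \in s -> C b) ->
  exists2 r : R, 0 < r & forall y b, b \in s -> `|y - x| < r -> b y -> b x.
Proof.
elim: s => [|a l IH] sC; first by exists 1.
have [|r1 r10 h1] := IH; first by move=> b bl; apply: sC; rewrite inE bl orbT.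
have [ax|nax] := pselect (a x).
  by exists r1 => // y b; rewrite inE => /orP[/eqP->//|]; exact: h1.
have [r2 r20 h2] := closed_away (clC (sC _ (mem_head _ _))) nax.
exists (Num.min r1 r2); first by rewrite lt_min r10.
move=> y b; rewrite inE lt_min => /orP[/eqP->|bl] /andP[y1 y2] yb.
  by case: (h2 _ y2).
exact: h1 bl y1 yb.
Qed.

(** By induction, the boundary of [b] near a point of the open cell [c] is contained in finitely
    many affine subspaces of dimension below [rk b], all containing the directions of [c]. Paths
    that avoid them cannot leave [b]. This yields first that [dirm c] lies in [dirm b], then that
    [b] contains a piece of [c] around each of its points in the open cell. *)
Lemma frontier_aux n c b : (rk b < n)%N ->
  (forall b', (rk b' < rk b)%N -> C b' -> forall x, relint c x -> b' x -> c `<=` b') ->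
  C c -> C b -> forall x, relint c x -> b x -> c `<=` b.
Proof.
move=> _ IH Cc Cb x rx bx.
have [->//|cb] := pselect (c = b).
have cc := kC Cc; have kb := kC Cb; have clb := clC Cb.
have [s [sC sB]] := cell_boundary hC Cb.
have nr z : relint c z -> ~ relint b z by move=> h1 h2; apply: cb; exact: (cell_uniq hC Cc Cb h1 h2).
(* near a point of c the boundary of b lies in cells of dimension < dim b that contain c *)
pose Ls := [seq dirm a | a <- s & `[< c `<=` a >]].
have near z : relint c z -> exists2 r : R, 0 < r & forall y, `|y - z| < r -> b y ->
    ~ relint b y -> exists2 L, L \in Ls & y - z <:= L.
  move=> rz; have [|r r0 hr] := @local_boundary c z s; first by move=> a /sC[].
  exists r => // y yr by_ nry; have [a as_ ay] := sB _ by_ nry.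
  have az := hr _ _ as_ yr ay; have [Ca rka] := sC _ as_.
  have ca := IH a rka Ca z rz az.
  exists (dirm a); last exact: dirm_subin.
  by apply/map_f; rewrite mem_filter asboolT.
have LsP L : L \in Ls -> (dirm c <= L)%MS /\ (\rank L < rk b)%N.
  move=> /mapP[a]; rewrite mem_filter => /andP[/asboolP ca as_] ->.
  have [Ca rka] := sC _ as_; split=> //; apply: subset_dirm => //.
  exact: cell_nonempty Cc.
have [p rp] := cell_relint0 hC Cb; have bp := relint_sub rp.
have xpb : p - x <:= dirm b by exact: dirm_subin.
set w := p - x in xpb.
have small (r : R) (u1 u2 : E) : 0 < r -> exists2 e : R, 0 < e <= 1 &
    forall t t' : R, `|t| <= e -> `|t'| <= e -> `|t *: u1 + t' *: u2| < r.
  move=> r0; have n0 : 0 < `|u1| + `|u2| + 1 by have := normr_ge0 u1; have := normr_ge0 u2; lra.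
  exists (Num.min 1 (r / 2 / (`|u1| + `|u2| + 1))).
    by rewrite lt_min ltr01 !divr_gt0 //= ge_min lexx.
  move=> t t'; rewrite !le_min => /andP[_ h1] /andP[_ h2].
  apply: le_lt_trans (ler_normD _ _) _; rewrite !normrZ.
  move: h1 h2; rewrite !ler_pdivlMr // => h1 h2.
  have := normr_ge0 u1; have := normr_ge0 u2; have := normr_ge0 t; have := normr_ge0 t'.
  nra.
have relw (e : R) : 0 < e <= 1 -> relint b (x + e *: w) by move=> e01; exact: relint_segment.
have dcb : (dirm c <= dirm b)%MS.
  (* Otherwise the boundary of [b] would have codimension at least two in [b] near [x]. One could
     then go around [x] within [b], from [x + e *: w] through [x + e *: u] to [x - e *: w], which
     would put [x] into the relative interior of [b]. *)
  apply/rV_subP => v vc; apply: contraT => nvb; exfalso.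
  (* [w] is added so that the plane spanned by [w] and [u] meets the spaces of [Ls] at most along
     the line of [w]. *)
  pose Ls' := [seq (L :&: dirm b + w)%MS | L <- Ls].
  have [L /mapP[L0 L0s ->]|u ub hu] := @avoid_subspaces _ _ (dirm b) Ls'.
    apply/negP => /mxrankS; rewrite -/(rk b).
    have := mxrank_adds_leqif (L0 :&: dirm b)%MS w => -[+ _].
    have := rank_leq_row w; have [h1 h2] := LsP _ L0s.
    have : (\rank (L0 :&: dirm b)%MS < \rank L0)%N.
      rewrite (ltn_leqif (mxrank_leqif_sup (capmxSl _ _))) sub_capmx submx_refl /=.
      by apply: contra nvb => h; exact: submx_trans (submx_trans vc h1) h.
    by move: h2; clear; lia.
  have {}hu L : L \in Ls -> ~~ (u <:= (L :&: dirm b + w)%MS).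
    by move=> h; apply: hu; apply/mapP; exists L.
  have [r r0 hr] := near _ rx; have [e /andP[e0 e1] he] := small r w u r0.
  have key (t t' : R) : t' != 0 -> `|t| <= e -> `|t'| <= e ->
      b (x + (t *: w + t' *: u)) -> relint b (x + (t *: w + t' *: u)).
    move=> t'0 te t'e bq; apply: contrapT => nrq.
    have [|L /[dup] Ls1 /hu/negP huL] := hr _ _ bq nrq; first by rewrite addrC addKr he.
    rewrite addrC addKr => hL; apply: huL.
    have -> : u = t'^-1 *: ((t *: w + t' *: u) - t *: w).
      by apply/rowP => i; rewrite !mxE; field.
    rewrite scalemx_sub // addmx_sub //; last by rewrite -scaleNr scalemx_sub ?addsmxSr.
    apply: submx_trans (addsmxSl _ _); rewrite sub_capmx hL.
    by rewrite addmx_sub ?scalemx_sub.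
  have ab t : 0 <= t <= 1 -> `|t * e| <= e /\ `|(1 - t) * e| <= e.
    by move=> /andP[t0 t1]; rewrite !normrM !(gtr0_norm e0) !ger0_norm ?subr_ge0 //; split; nra.
  have ne (t : R) : 0 < t -> t * e != 0 by move=> t0; rewrite mulf_neq0 ?gt_eqF.
  have b1 : relint b (x + e *: u).
    have e01 : 0 < e <= 1 by rewrite e0.
    have -> : x + e *: u = x + (0 *: w + e *: u) by rewrite scale0r add0r.
    apply: (key); [by rewrite gt_eqF|by rewrite normr0 ltW|by rewrite gtr0_norm|].
    have -> : x + (0 *: w + e *: u) = x + e *: w + e *: (u - w) by vec.
    apply: relint_exit => //; [exact: relw|by rewrite scalemx_sub // addmx_sub // -scaleN1r scalemx_sub|].
    move=> t /andP[t0 t1].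
    have -> : x + e *: w + t *: (e *: (u - w)) = x + (((1 - t) * e) *: w + (t * e) *: u) by vec.
    have t01 : 0 <= t <= 1 by rewrite !ltW.
    by have [h1 h2] := ab t t01; apply: (key) => //; exact: ne.
  have b2 : b (x + e *: (x - p)).
    have -> : x + e *: (x - p) = x + e *: u + (- e) *: (u + w) by rewrite /w; vec.
    apply: relint_exit => //; first by rewrite scalemx_sub // addmx_sub.
    move=> t /andP[t0 t1].
    have -> : x + e *: u + t *: (- e *: (u + w)) = x + ((- (t * e)) *: w + ((1 - t) * e) *: u) by vec.
    have t01 : 0 <= t <= 1 by rewrite !ltW.
    have [h1 h2] := ab t t01.
    by apply: (key); rewrite ?normrN //; apply: ne; rewrite subr_gt0.
  exact: nr rx (relint_between kb rp e0 b2).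
have [L Ls1|u0 u0b hu0] := @avoid_subspaces _ _ (dirm b) Ls.
  by apply/negP => /mxrankS; have [_ h2] := LsP _ Ls1; move: h2; rewrite /rk; clear; lia.
(* Go from [z] into the interior along [u], shift by [k *: v], and come back along [u]. Every space
   of [Ls] contains [v] but not [u], so the way back meets no boundary before [z + k *: v]. *)
have step z v : relint c z -> b z -> v <:= dirm c -> exists2 e : R, 0 < e & b (z + e *: v).
  move=> rz bz vc; have vb := submx_trans vc dcb.
  have [t1 t10 ht1] := relint_open kb rp u0b.
  have [|t2 t20 ht2] := @avoid_line _ _ Ls (p - z) u0.
    by move=> L Ls1; rewrite (negPf (hu0 _ Ls1)) andbF.
  pose t := Num.min (t1 / 2) (t2 / 2).
  have t0 : 0 < t by rewrite lt_min; apply/andP; split; lra.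
  have tt1 : t < t1 by rewrite gt_min; apply/orP; left; lra.
  have tt2 : t < t2 by rewrite gt_min; apply/orP; right; lra.
  have rp' : relint b (p + t *: u0) by apply: ht1; rewrite gtr0_norm.
  have hu := ht2 _ t0 tt2; set u := p - z + t *: u0 in hu.
  have up : u = (p + t *: u0) - z by rewrite /u; vec.
  have ub : u <:= dirm b by rewrite up dirm_subin //; exact: relint_sub rp'.
  have [r r0 hr] := near _ rz; have [e /andP[e0 e1] he] := small r v u r0.
  have ru : relint b (z + e *: u) by rewrite up; apply: relint_segment => //; rewrite e0.
  have [q q0 hq] := relint_open kb ru vb.
  pose k := Num.min (q / 2) e.
  have k0 : 0 < k by rewrite lt_min e0 andbT; lra.
  have kq : k < q by rewrite gt_min; apply/orP; left; lra.
  have ke : k <= e by rewrite ge_min lexx orbT.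
  have rk' : relint b (z + e *: u + k *: v) by apply: hq; rewrite gtr0_norm.
  exists k => //.
  have -> : z + k *: v = z + e *: u + k *: v + (- e) *: u by vec.
  apply: relint_exit => //; first by rewrite scalemx_sub.
  move=> s1 /andP[s0 s11].
  have -> : z + e *: u + k *: v + s1 *: (- e *: u) = z + (k *: v + ((1 - s1) * e) *: u) by vec.
  move=> bq; apply: contrapT => nrq.
  have le : `|(1 - s1) * e| <= e.
    by rewrite normrM (gtr0_norm e0) ger0_norm ?subr_ge0 ?ltW //; nra.
  have [|L Ls1] := hr _ _ bq nrq; first by rewrite addrC addKr he // gtr0_norm.
  rewrite addrC addKr => hL; have /negP := hu _ Ls1; apply.
  have [cL _] := LsP _ Ls1.
  have -> : u = ((1 - s1) * e)^-1 *: ((k *: v + ((1 - s1) * e) *: u) - k *: v).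
    have h1 : (1 - s1) * e != 0 by rewrite mulf_neq0 ?gt_eqF ?subr_gt0.
    by rewrite [X in _ *: X](_ : _ = ((1 - s1) * e) *: u); [rewrite scalerA mulVf // scale1r|vec].
  by rewrite scalemx_sub // addmx_sub // -scaleNr scalemx_sub // (submx_trans vc).
have rcb y : relint c y -> b y.
  move=> ry; rewrite -(subrK x y) addrC.
  have yxc : y - x <:= dirm c by apply: dirm_subin; exact: relint_sub.
  apply: closed_convex_reach => // t /andP[t0 t1] bt.
  have rt : relint c (x + t *: (y - x)) by apply: relint_convex; rewrite // t0 ltW.
  have [e e0 he] := step _ _ rt bt yxc; exists e => //.
  by rewrite scalerDl addrA.
move=> y cy; have [q rq] := cell_relint0 hC Cc.
apply: (@closed_ray _ _ _ _ (q - y) 1) => // t t0 t1; apply: rcb.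
by apply: relint_segment => //; rewrite t0 ltW.
Qed.

(** The closure finiteness axiom only covers the boundary of a cell by smaller cells, which might
    stick out of it. This lemma makes every closed cell a union of cells. *)
Lemma cell_frontier c b x : C c -> C b -> relint c x -> b x -> c `<=` b.
Proof.
move=> Cc Cb; move: x; have [n] := ubnP (rk b); elim: n b Cb => // n IH b Cb bn.
apply: (frontier_aux bn _ Cc Cb) => b' b'b Cb'; apply: IH => //.
exact: leq_trans b'b bn.
Qed.

(** Otherwise a segment from [y] to a relatively interior point [z] of [b] could be prolonged within
    [b], and [z] would be relatively interior to [c] too. *)
Lemma subcell_span c b x y : C c -> C b -> b `<=` c -> b <> c -> b x -> relint c y ->
  ~~ (y - x <:= dirm b).
Proof.
move=> Cc Cb bc ne bx ry; apply/negP => yx; apply: ne.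
have [z rz] := cell_relint0 hC Cb; have bz := relint_sub rz.
have zy : z - y <:= dirm b.
  have -> : z - y = (z - x) - (y - x) by vec.
  by rewrite addmx_sub ?dirm_subin // -scaleN1r scalemx_sub.
have [t t0 ht] := relint_ray rz zy.
apply: (cell_uniq hC Cb Cc rz); apply: (relint_between (kC Cc) ry (t := t / 2)); first lra.
by apply: bc; apply: ht; rewrite gtr0_norm; lra.
Qed.

Lemma subcell_rk c b : C c -> C b -> b `<=` c -> b <> c -> (rk b < rk c)%N.
Proof.
move=> Cc Cb bc ne; have [x bx] := cell_nonempty hC Cb; have [y ry] := cell_relint0 hC Cc.
rewrite /rk (ltn_leqif (mxrank_leqif_sup (subset_dirm (cell_nonempty hC Cb) bc))).
apply: contra (subcell_span Cc Cb bc ne bx ry); apply: submx_trans.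
by apply: dirm_subin; [exact: bc|exact: relint_sub].
Qed.

Lemma cell_faces c : C c -> exists2 s : seq (set E), uniq s &
  forall b, b \in s <-> C b /\ b `<=` c.
Proof.
move=> Cc; have [s [sC sR]] := cell_cover hC Cc.
exists (undup [seq b <- s | `[< b `<=` c >]]); first exact: undup_uniq.
move=> b; rewrite mem_undup mem_filter; split=> [/andP[/asboolP bc /sC]//|[Cb bc]].
rewrite asboolT //=; have [x rx] := cell_relint0 hC Cb.
have [a as_ ax] := sR _ (bc _ (relint_sub rx)).
by rewrite (cell_uniq hC Cb (sC _ as_) rx ax).
Qed.

(** Infinitely many cells around [b] would provide points in distinct open cells that converge to a
    point of [b], against [no_accumulation]. *)
Lemma cell_star b : C b -> exists2 s : seq (set E), uniq s &
  forall c, c \in s <-> C c /\ b `<=` c.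
Proof.
move=> Cb; have [x rx] := cell_relint0 hC Cb; have bx := relint_sub rx.
pose A := [set c | C c /\ b `<=` c].
have [fA|/infiniteP/pcard_leP[f]] := pselect (finite_set A).
  have /finite_seqP[s sE] := fA; exists (undup s); first exact: undup_uniq.
  move=> c; rewrite mem_undup; have : (c \in s) <-> [set` s] c by [].
  by rewrite -sE.
exfalso; have fA n : A (f n) by apply: funS.
have finj n m : f n = f m -> n = m by apply: (@inj _ _ _ f); rewrite in_setE.
have /choice[y hy] : forall n, exists y, relint (f n) y /\ `|y - x| < n.+1%:R^-1.
  move=> n; have [Cn bn] := fA n; have [p rp] := cell_relint0 hC Cn.
  have n0 : 0 < n.+1%:R^-1 :> R by rewrite invr_gt0 ltr0n.
  have v0 : 0 < `|p - x| + 1 by have := normr_ge0 (p - x); lra.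
  pose t := Num.min 1 (n.+1%:R^-1 / (`|p - x| + 1)).
  have t0 : 0 < t by rewrite lt_min ltr01 divr_gt0.
  exists (x + t *: (p - x)); split.
    apply: relint_segment => //; [exact: kC|exact: bn|by rewrite t0 ge_min lexx].
  rewrite addrC addKr normrZ gtr0_norm //.
  have : t <= n.+1%:R^-1 / (`|p - x| + 1) by rewrite ge_min lexx orbT.
  rewrite ler_pdivlMr //; apply: lt_le_trans.
  by rewrite ltr_pM2l //; lra.
apply: (no_accumulation hC (y := y) (p := x)) => [r r0|c Cc].
  have [N hN] := small_invS r0; exists N => n /hN; apply: lt_trans.
  by have [] := hy n.
have [[m em]|no] := pselect (exists m, f m = c).
  exists m.+1 => n mn rn; have [h _] := hy n; have [Cn _] := fA n.
  by move: mn; rewrite (finj n m) ?ltnn // em (cell_uniq hC Cn Cc h rn).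
exists 0%N => n _ rn; have [h _] := hy n; have [Cn _] := fA n.
by apply: no; exists n; rewrite (cell_uniq hC Cn Cc h rn).
Qed.

End Frontier.

Section SupportedSums.
Variables (V : zmodType) (I : eqType).

Lemma big_supp_eq (s1 s2 : seq I) (f : I -> V) : uniq s1 -> uniq s2 ->
  (forall x, x \in s1 -> x \notin s2 -> f x = 0) ->
  (forall x, x \in s2 -> x \notin s1 -> f x = 0) ->
  \sum_(x <- s1) f x = \sum_(x <- s2) f x.
Proof.
move=> u1 u2 h1 h2.
have E s (g : pred I) : (forall x, x \in s -> x \notin g -> f x = 0) ->
    \sum_(x <- s) f x = \sum_(x <- [seq x <- s | g x]) f x.
  move=> H; rewrite big_filter [RHS]big_mkcond; apply: eq_big_seq => x xs.
  by case: ifP => // /negbT /(H _ xs).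
rewrite (E s1 (mem s2)) // (E s2 (mem s1)) //; apply: perm_big.
apply: uniq_perm; rewrite ?filter_uniq // => x; rewrite !mem_filter.
by rewrite /= andbC.
Qed.

End SupportedSums.

(** * Incidence numbers of cells *)

Section CellIncidence.
Variables (R : realType) (d : nat).
Local Notation E := 'rV[R]_d.
Implicit Types (c b a : set E) (x y v p e : E).

(* The base point of c is taken in its relative interior, so that pt b - pt c
   points outwards along the face b. *)
Definition eps c b : int :=
  if `[< b `<=` c >] && (rk c == (rk b).+1) then inc (relint c) b else 0.

Lemma eps_neq0 c b : eps c b != 0 -> b `<=` c /\ rk c = (rk b).+1.
Proof. by rewrite /eps; case: ifP => [/andP[/asboolP h /eqP k] _ //|_]; rewrite eqxx. Qed.

Definition coneat x0 (A : set E) : set E :=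
  [set v | exists (t : R) y, [/\ 0 < t, A y & v = t *: (y - x0)]].

Variables (C : set (set E)) (hC : polytopal_CW C).
Let kC := cell_convex hC.

Lemma epsE k (B : 'M[R]_(k, d)) c b x y : C c -> C b -> b `<=` c -> rk c = (rk b).+1 ->
  relint c x -> b y -> row_free B -> (B :=: dirm b)%MS ->
  bsgn (col_mx (y - x) B) = eps c b * bsgn B.
Proof.
move=> Cc Cb bc rcb rx by_ fB eB; rewrite /eps asboolT // rcb eqxx /=.
have ne := rkS_neq rcb.
have rp := ptP (cell_relint0 hC Cc); have bp := ptP (cell_nonempty hC Cb).
have cp := relint_sub rp; have cx := relint_sub rx.
have db := subset_dirm (cell_nonempty hC Cb) bc.
have sp q z : b q -> relint c z -> ~~ (q - z <:= dirm b).
  move=> bq rz; rewrite -opprB -scaleN1r eqmx_scale ?oppr_eq0 ?oner_eq0 //.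
  exact: (subcell_span hC Cc Cb bc ne bq rz).
have [|||t ht] := @codim1_coord _ _ _ _ (pt b - pt (relint c)) (y - x) db rcb.
- by apply: dirm_subin => //; exact: bc.
- exact: sp.
- by apply: dirm_subin => //; exact: bc.
(* If [t <= 0], then for some point of the open cell [c] between [x] and [pt (relint c)] the vector
   to [y] lies in the span of [b], against [subcell_span]. *)
have t0 : 0 < t.
  rewrite ltNge; apply/negP => t0.
  have t1 : 0 < 1 - t by lra.
  have rz : relint c (x + (- t / (1 - t)) *: (pt (relint c) - x)).
    apply: (relint_convex (kC Cc)) => //.
    apply/andP; split; first by apply: divr_ge0; lra.
    by rewrite ler_pdivrMr // mul1r; lra.
  apply: (negP (sp y _ by_ rz)).
  have -> : y - (x + (- t / (1 - t)) *: (pt (relint c) - x)) =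
     (1 - t)^-1 *: (y - x - t *: (pt b - pt (relint c))) - (- t / (1 - t)) *: (pt b - y).
    by apply/rowP => i; rewrite !mxE; field; rewrite gt_eqF.
  apply: addmx_sub; first by rewrite scalemx_sub.
  by rewrite -scaleNr scalemx_sub // dirm_subin.
exact: (incE fB eB t0 ht).
Qed.

Lemma coneat_ocone x0 c : C c -> ocone (coneat x0 (relint c)).
Proof.
move=> Cc; have kc := kC Cc; split.
- by have [p rp] := cell_relint0 hC Cc; exists (1 *: (p - x0)), 1, p.
- move=> _ _ [t [y [t0 ry ->]]] [s [z [s0 rz ->]]]; have ts : 0 < t + s by lra.
  exists (t + s), (y + (s / (t + s)) *: (z - y)); split=> //.
    apply: (relint_convex kc) => //.
    by apply/andP; split; [rewrite divr_ge0 ?ltW|rewrite ler_pdivrMr // mul1r; lra].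
  by apply/rowP => i; rewrite !mxE; field; rewrite gt_eqF.
- by move=> a _ a0 [t [y [t0 ry ->]]]; exists (a * t), y; rewrite mulr_gt0 // scalerA.
move=> _ _ [t [y [t0 ry ->]]] [s [z [s0 rz ->]]].
have [|q q0 hq] := relint_open kc ry (v := y - z).
  by apply: dirm_subin; exact: relint_sub.
pose l := q / 2; have l0 : 0 < l by rewrite /l; lra.
have l1 : 0 < 1 + l by lra.
have tl : 0 < t / (1 + l) by rewrite divr_gt0.
exists (l * (t / (1 + l)) / s); first by rewrite !divr_gt0 // mulr_gt0.
exists (t / (1 + l)), (y + l *: (y - z)); split=> //.
  by apply: hq; rewrite gtr0_norm // /l; lra.
by apply/rowP => i; rewrite !mxE; field; rewrite !gt_eqF.
Qed.

Lemma coneat_dirm x0 c y : C c -> c y ->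
  (dirm (coneat x0 (relint c)) :=: dirm c + (y - x0)%R)%MS.
Proof.
move=> Cc cy; have co := coneat_ocone x0 Cc; have [[v0 v0c] _ _ _] := co.
apply/eqmxP/andP; split.
  have inM v : coneat x0 (relint c) v -> v <:= (dirm c + (y - x0)%R)%MS.
    move=> [t [z [_ rz ->]]]; rewrite scalemx_sub //.
    have -> : z - x0 = (z - y) + (y - x0) by vec.
    apply: addmx_sub; last exact: addsmxSr.
    apply: submx_trans (addsmxSl _ _); apply: dirm_subin => //; exact: relint_sub.
  apply: (dirm_min v0c) => v vc; apply: addmx_sub; first exact: inM.
  by rewrite -scaleN1r scalemx_sub // inM.
have [p rp] := cell_relint0 hC Cc.
have cp v : relint c v -> coneat x0 (relint c) (v - x0).
  by move=> rv; exists 1, v; rewrite scale1r.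
have dc : (dirm c <= dirm (coneat x0 (relint c)))%MS.
  apply/rV_subP => v vc; have [q q0 hq] := relint_open (kC Cc) rp vc.
  have rq : relint c (p + (q / 2) *: v) by apply: hq; rewrite gtr0_norm; lra.
  have -> : v = (q / 2)^-1 *: ((p + (q / 2) *: v - x0) - (p - x0)).
    by apply/rowP => i; rewrite !mxE; field; rewrite gt_eqF.
  rewrite scalemx_sub //; apply: addmx_sub; first exact: ocone_in co (cp _ rq).
  by rewrite -scaleN1r scalemx_sub //; exact: ocone_in co (cp _ rp).
rewrite addsmx_sub dc /=; have -> : y - x0 = (p - x0) + (y - p) by vec.
apply: addmx_sub; first exact: ocone_in co (cp _ rp).
by apply: submx_trans dc; apply: dirm_subin => //; exact: relint_sub.
Qed.

Lemma coneat_below x0 c b : C c -> C b -> b `<=` c ->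
  below (coneat x0 (relint b)) (coneat x0 (relint c)).
Proof.
move=> Cc Cb bc _ _ [t [y [t0 ry ->]]] [s [z [s0 rz ->]]]; have ts : 0 < t + s by lra.
exists (t + s), (y + (s / (t + s)) *: (z - y)); split=> //.
  apply: relint_segment (kC Cc) _ rz _; first by apply: bc; exact: relint_sub.
  by apply/andP; split; [rewrite divr_gt0|rewrite ler_pdivrMr // mul1r; lra].
by apply/rowP => i; rewrite !mxE; field; rewrite gt_eqF.
Qed.

(** * The fan of the star of a cell *)

Section Star.
Variables (b : set E) (Cb : C b) (s : seq (set E)) (us : uniq s).
Hypothesis sE : forall c, c \in s <-> C c /\ b `<=` c.

Let x0 := pt (relint b).
Let rx0 : relint b x0. Proof. exact: ptP (cell_relint0 hC Cb). Qed.
(** Since [x0] lies in every cell of the star, the cones have the direction spaces of the cells. *)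
Let K c := coneat x0 (relint c).

Let K_dirm c : c \in s -> (dirm (K c) :=: dirm c)%MS.
Proof.
move=> /sE[Cc bc]; have cx := bc _ (relint_sub rx0).
apply: eqmx_trans (coneat_dirm x0 Cc cx) _; rewrite subrr.
exact: addsmx0.
Qed.

Let K_ray c v : c \in s -> K c v -> exists2 t0 : R, 0 < t0 &
  forall t, 0 < t -> t <= t0 -> relint c (x0 + t *: v).
Proof.
move=> /sE[Cc bc] [t [y [t0 ry ->]]]; exists t^-1; first by rewrite invr_gt0.
move=> q q0 qt; rewrite scalerA; apply: relint_segment (kC Cc) _ ry _.
  exact: bc (relint_sub rx0).
by rewrite mulr_gt0 //= -ler_pdivlMr // mul1r.
Qed.

Let K_uniq c c' v : c \in s -> c' \in s -> K c v -> K c' v -> c = c'.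
Proof.
move=> cs c's kv kv'; have [t t0 ht] := K_ray cs kv; have [q q0 hq] := K_ray c's kv'.
have [[Cc _] [Cc' _]] := (proj1 (sE c) cs, proj1 (sE c') c's).
have m0 : 0 < Num.min t q by rewrite lt_min t0.
apply: (cell_uniq hC Cc Cc' (ht _ m0 _) (hq _ m0 _)); by rewrite ge_min lexx ?orbT.
Qed.

(** Move a point [p] of the open cell [c] in the direction [y]. The open cell entered has [p] in its
    closure, so it contains [c]; its cone meets [K c'], so it is [c']. *)
Let K_frontier c c' x y : c \in s -> c' \in s -> K c x -> K c' y ->
  (forall t : R, 0 < t -> K c' (x + t *: y)) -> c `<=` c'.
Proof.
move=> cs c's kx ky H; have [t t0 ht] := K_ray cs kx.
have [[Cc bc] [Cc' _]] := (proj1 (sE c) cs, proj1 (sE c') c's).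
pose p := x0 + t *: x; have rp : relint c p by exact: ht.
have [c3 C3 [q q0 hq]] := cell_local hC p y.
have p3 : c3 p.
  by apply: (closed_ray (cell_closed hC C3) q0) => l l0 lq; exact: relint_sub (hq _ l0 lq).
have cc3 := cell_frontier hC Cc C3 rp p3.
have c3s : c3 \in s by apply/sE; split=> // z /bc /cc3.
have -> // : c' = c3.
apply: (K_uniq c's c3s (H (q / 2 / t) _)); first by rewrite !divr_gt0.
exists t^-1, (p + (q / 2) *: y); rewrite invr_gt0; split=> //; first by apply: hq; lra.
by rewrite /p; apply/rowP => i; rewrite !mxE; field; rewrite gt_eqF.
Qed.

Let F := [seq K c | c <- s].

Let K_inj : {in s &, injective K}.
Proof.
move=> c c' cs c's e; have [Cc _] := proj1 (sE c) cs.
have [[v kv] _ _ _] := coneat_ocone x0 Cc.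
by apply: (K_uniq cs c's kv); rewrite -/(K c') -e.
Qed.

Let star_fan : fan 1%:M F.
Proof.
split.
- by rewrite map_inj_in_uniq.
- by move=> _ /mapP[c /sE[Cc _] ->]; exact: coneat_ocone.
- by move=> _ x _ _; exact: submx1.
- move=> v _; have [c Cc [t t0 ht]] := cell_local hC x0 v.
  have cx : c x0.
    by apply: (closed_ray (cell_closed hC Cc) t0) => l l0 lt; exact: relint_sub (ht _ l0 lt).
  have cs : c \in s by apply/sE; split=> //; exact: (cell_frontier hC Cb Cc rx0 cx).
  exists (K c); first exact: map_f.
  exists (t / 2)^-1, (x0 + (t / 2) *: v); split; [rewrite invr_gt0; lra|apply: ht; lra|].
  by apply/rowP => i; rewrite !mxE; field; rewrite gt_eqF.
- move=> _ _ x /mapP[c cs ->] /mapP[c' c's ->] kx kx'.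
  by rewrite (K_uniq cs c's kx kx').
move=> _ _ x y /mapP[c cs ->] /mapP[c' c's ->] kx ky H.
have [[Cc _] [Cc' _]] := (proj1 (sE c) cs, proj1 (sE c') c's).
by apply: coneat_below => //; exact: (K_frontier c's cs kx ky H).
Qed.

Let K_bd c c' : c \in s -> c' \in s -> fan_bd (K c) (K c') = eps c c'.
Proof.
move=> cs c's; have [[Cc bc] [Cc' bc']] := (proj1 (sE c) cs, proj1 (sE c') c's).
have rkK a : a \in s -> rk (K a) = rk a by move=> as_; rewrite /rk (K_dirm as_).
have bE : below (K c') (K c) <-> c' `<=` c.
  split=> [bl|]; last exact: coneat_below.
  have [[x kx] _ _ _] := coneat_ocone x0 Cc'; have [[y ky] _ kZ _] := coneat_ocone x0 Cc.
  by apply: (K_frontier c's cs kx ky) => t t0; apply: bl => //; exact: kZ.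
have [bl|nb] := pselect (c' `<=` c); last by rewrite /fan_bd /eps !asboolF // => /bE.
have [k|nk] := eqVneq (rk c) (rk c').+1; last first.
  by rewrite /fan_bd /eps !rkK // (negbTE nk) !andbF.
have [p rp] := cell_relint0 hC Cc.
have kp : K c (p - x0) by exists 1, p; rewrite scale1r.
have fB := row_base_free (dirm c'); have eB := eq_row_base (dirm c').
have blK : below (K c') (K c) by apply/bE.
have kK : rk (K c) = (rk (K c')).+1 by rewrite !rkK.
have h1 := fan_inc star_fan (map_f K cs) (map_f K c's) blK kK kp fB
  (eqmx_trans eB (eqmx_sym (K_dirm c's))).
have h2 := epsE Cc Cc' bl k rp (bc' _ (relint_sub rx0)) fB eB.
have B0 : bsgn (row_base (dirm c')) != 0 by case: (bsgn_free fB) => ->.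
apply: (mulIf B0); rewrite -h2 -[x0 - p]opprB h1.
by rewrite /fan_bd asboolT // kK eqxx.
Qed.

Lemma star_eps_eps c a : c \in s -> a \in s -> \sum_(e <- s) eps c e * eps e a = 0.
Proof.
move=> cs as_; rewrite -[RHS](fan_bd_bd star_fan (map_f K cs) (map_f K as_)) big_map.
by apply: eq_big_seq => e es; rewrite !K_bd.
Qed.

Let sum_K (V : zmodType) (f : set E -> V) c' : c' \in s ->
  bdF F f (K c') = \sum_(c <- s) f (K c) *~ eps c c'.
Proof. by move=> c's; rewrite /bdF big_map; apply: eq_big_seq => c cs; rewrite K_bd. Qed.

Let rkK c : c \in s -> rk (K c) = rk c.
Proof. by move=> cs; rewrite /rk (K_dirm cs). Qed.

Lemma star_fundamental (V : zmodType) (m : V) c' : c' \in s ->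
  \sum_(c <- s) (if rk c == d then m else 0) *~ eps c c' = 0.
Proof.
move=> c's; have [om0 _] := fan_exactP V star_fan.
rewrite -[RHS](om0 m _ (map_f K c's)) sum_K //; apply: eq_big_seq => c cs.
by rewrite rkK // mxrank1.
Qed.

Lemma star_exact (V : zmodType) (f : set E -> V) :
  (forall c', c' \in s -> \sum_(c <- s) f c *~ eps c c' = 0) ->
  exists g m, forall c', c' \in s ->
    f c' = \sum_(c <- s) g c *~ eps c c' + (if rk c' == d then m else 0).
Proof.
move=> df; have [_ ex] := fan_exactP V star_fan.
(* Chains of the fan are functions of cones; [un] transports [f] along the bijection [K]. *)
pose un t := f (xget set0 [set c | c \in s /\ K c = t]).
have unK c : c \in s -> un (K c) = f c.
  move=> cs; congr f; have [c's e] : [set c' | c' \in s /\ K c' = K c] (xget set0 [set c' | c' \in s /\ K c' = K c]).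
    by apply: xgetPex; exists c.
  exact: K_inj.
have [|g [m hg]] := ex un.
  move=> _ /mapP[c' c's ->]; rewrite sum_K // -[RHS](df _ c's).
  by apply: eq_big_seq => c cs; rewrite unK.
exists (fun c => g (K c)), m => c' c's.
by rewrite -sum_K // -unK // hg ?map_f // rkK // mxrank1.
Qed.

(** If all cones had smaller dimension, their spans could not cover the space. *)
Lemma star_top : exists2 c, c \in s & rk c = d.
Proof.
apply: contrapT => H.
have [M /mapP[c cs ->]|u _ hu] := @avoid_subspaces _ _ (1%:M : 'M[R]_d) [seq dirm (K c) | c <- s].
  apply/negP => /mxrankS; rewrite mxrank1 => dk; apply: H; exists c => //.
  by apply/eqP; rewrite eqn_leq -(rkK cs) dk andbT; exact: rank_leq_col.
have [_ /mapP[c cs ->] ku] := fan_cover star_fan (submx1 u).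
have [Cc _] := proj1 (sE c) cs.
have /negP := hu _ (map_f (fun c => dirm (K c)) cs); apply.
exact: ocone_in (coneat_ocone x0 Cc) ku.
Qed.

End Star.
End CellIncidence.

(** * The fan over the proper faces of a cell *)

Section Faces.
Variables (R : realType) (d : nat).
Local Notation E := 'rV[R]_d.
Implicit Types (c b a : set E) (x y v p : E).
Variables (C : set (set E)) (hC : polytopal_CW C).
Let kC := cell_convex hC.

(** The nonzero terms belong to cells between [a] and [c], all of which lie in the star of [a]. *)
Lemma eps_eps c a s : C c -> C a -> uniq s ->
  (forall b, C b -> a `<=` b -> b `<=` c -> b \in s) -> {in s, forall b, C b} ->
  \sum_(b <- s) eps c b * eps b a = 0.
Proof.
move=> Cc Ca us sc sC; have [st ust stE] := cell_star hC Ca.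
have [ac|nac] := pselect (a `<=` c); last first.
  rewrite big1_seq // => b /andP[_ bs]; apply/eqP; rewrite mulf_eq0; apply: contrapT => /negP.
  by rewrite negb_or => /andP[/eps_neq0[bc _] /eps_neq0[ab _]]; apply: nac => z /ab /bc.
have cst : c \in st by apply/stE.
have ast : a \in st by apply/stE; split.
rewrite -[RHS](star_eps_eps hC Ca ust stE cst ast); apply: big_supp_eq => // b bs nb.
  apply/eqP; rewrite mulf_eq0; apply: contraNT nb; rewrite negb_or => /andP[_ /eps_neq0[ab _]].
  by apply/stE; split=> //; exact: sC.
apply/eqP; rewrite mulf_eq0; apply: contraNT nb; rewrite negb_or => /andP[/eps_neq0[bc _] /eps_neq0[ab _]].
by have [Cb _] := proj1 (stE b) bs; exact: sc.
Qed.

Lemma eps_sq c b : C c -> C b -> b `<=` c -> rk c = (rk b).+1 -> eps c b * eps c b = 1.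
Proof.
move=> Cc Cb bc k; have [x rx] := cell_relint0 hC Cc; have [y by_] := cell_nonempty hC Cb.
have fB := row_base_free (dirm b); have eB := eq_row_base (dirm b).
have h := epsE hC Cc Cb bc k rx by_ fB eB.
have fB' : row_free (col_mx (y - x) (row_base (dirm b))).
  rewrite row_free_col_mx // eB -opprB -scaleN1r eqmx_scale ?oppr_eq0 ?oner_eq0 //.
  exact: (subcell_span hC Cc Cb bc (rkS_neq k) by_ rx).
by have := bsgn_sq fB'; rewrite h mulrACA (bsgn_sq fB) mulr1.
Qed.

Variables (c : set E) (Cc : C c) (s : seq (set E)) (us : uniq s).
Hypothesis sE : forall b, b \in s <-> C b /\ b `<=` c.

Let x0 := pt (relint c).
Let rx0 : relint c x0. Proof. exact: ptP (cell_relint0 hC Cc). Qed.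
(** Here [x0] is interior to [c], so the cone over a proper face has one dimension more than the
    face. *)
Let K b := coneat x0 (relint b).
Let prop := [seq b <- s | b != c].

Let propP b : b \in prop -> [/\ C b, b `<=` c & b <> c].
Proof. by rewrite mem_filter => /andP[/eqP bc /sE[]]. Qed.

Let prop_nr b y : b \in prop -> b y -> ~ relint c y.
Proof.
move=> /propP[Cb bc ne] by_ rc; have /negP := subcell_span hC Cc Cb bc ne by_ rc; apply.
by rewrite subrr sub0mx.
Qed.

Let prop_x0 b y : b \in prop -> b y -> ~~ (y - x0 <:= dirm b).
Proof.
move=> /propP[Cb bc ne] by_.
rewrite -opprB -scaleN1r eqmx_scale ?oppr_eq0 ?oner_eq0 //.
exact: (subcell_span hC Cc Cb bc ne by_ rx0).
Qed.

(** Of two boundary points on a ray from [x0], the nearer one would lie between [x0] and a point of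
    [c], hence in the relative interior. *)
Let bd_ray y z (t : R) : c y -> c z -> ~ relint c y -> ~ relint c z -> 0 < t ->
  y - x0 = t *: (z - x0) -> y = z.
Proof.
move=> cy cz ny nz t0 e; have [t1|t1|t1] := ltgtP t 1.
- case: ny; apply: (relint_between (kC Cc) rx0 (t := t^-1 - 1)).
    by rewrite subr_gt0 invf_gt1.
  by have -> : y + (t^-1 - 1) *: (y - x0) = z by rewrite -(subrK x0 y) e;
    apply/rowP => i; rewrite !mxE; field; rewrite gt_eqF.
- case: nz; apply: (relint_between (kC Cc) rx0 (t := t - 1)); first by rewrite subr_gt0.
  by have -> : z + (t - 1) *: (z - x0) = y by rewrite -(subrK x0 y) e; vec.
by move: e; rewrite t1 scale1r => /(addIr _).
Qed.

Let K_uniq b b' v : b \in prop -> b' \in prop -> K b v -> K b' v -> b = b'.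
Proof.
move=> bp b'p [t [y [t0 ry ev]]] [t' [y' [t'0 ry' ev']]].
have [[Cb bc _] [Cb' bc' _]] := (propP bp, propP b'p).
have by_ := relint_sub ry; have by' := relint_sub ry'.
have e : y - x0 = (t^-1 * t') *: (y' - x0).
  by rewrite -scalerA -ev' ev scalerA mulVf ?gt_eqF // scale1r.
have yy : y = y'.
  apply: (bd_ray (bc _ by_) (bc' _ by') (prop_nr bp by_) (prop_nr b'p by') _ e).
  by rewrite mulr_gt0 // invr_gt0.
by apply: (cell_uniq hC Cb Cb' ry); rewrite yy.
Qed.

Let K_neq0 b : b \in prop -> ~ K b 0.
Proof.
move=> bp [t [y [t0 ry /esym/eqP]]]; rewrite scaler_eq0 gt_eqF //= subr_eq0 => /eqP e.
by apply: (prop_nr bp (relint_sub ry)); rewrite e.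
Qed.

(** The functional [g] is 1 on [b' - x0], so division by [g] projects the cone over [b'] back to
    [b']. For [t] tending to 0 the projections of [x + t *: y] tend to a point of [b'] on the ray of
    [x], provided [g x > 0]; if [g x] were 0, they would be unbounded. *)
Let K_frontier b b' x y : b \in prop -> b' \in prop -> K b x -> K b' y ->
  (forall t : R, 0 < t -> K b' (x + t *: y)) -> b `<=` b'.
Proof.
move=> bp b'p kx [s2 [q [s20 rq ey]]] H.
have [[Cb bc _] [Cb' bc' _]] := (propP bp, propP b'p).
have [s1 [p [s10 rp ex]]] := kx.
have bq := relint_sub rq; have b_p := relint_sub rp.
have x_neq0 : x != 0 by apply/eqP => x00; apply: (K_neq0 bp); rewrite -x00.
have oc : ocone [set v | exists2 t : R, 0 < t & v = t *: (q - x0)].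
  split.
  - by exists (1 *: (q - x0)), 1.
  - by move=> _ _ [t t0 ->] [t' t'0 ->]; exists (t + t'); rewrite ?addr_gt0 // scalerDl.
  - by move=> a _ a0 [t t0 ->]; exists (a * t); rewrite ?mulr_gt0 // scalerA.
  move=> _ _ [t t0 ->] [t' t'0 ->]; exists (t / 2 / t'); first by rewrite !divr_gt0.
  exists (t / 2); first lra.
  by apply/rowP => i; rewrite !mxE; field; rewrite gt_eqF.
have [|h [h0 h1]] := cone_separation (L := dirm b') oc.
  by move=> _ [t t0 ->]; rewrite eqmx_scale ?gt_eqF //; exact: prop_x0.
pose g v := ev h v / ev h (q - x0).
have hq : 0 < ev h (q - x0) by apply: h1; exists 1; rewrite ?scale1r.
have gb z : b' z -> g (z - x0) = 1.
  move=> bz; have -> : z - x0 = (z - q) + (q - x0) by vec.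
  by rewrite /g evD h0 ?dirm_subin // add0r divff // gt_eqF.
have gD u v (t : R) : g (u + t *: v) = g u + t * g v.
  by rewrite /g !evE mulrDl mulrA.
have gZ v (t : R) : g (t *: v) = t * g v by rewrite /g evZ mulrA.
pose al := g x; pose be := g y.
have key t : 0 < t -> 0 < al + t * be /\ b' (x0 + (al + t * be)^-1 *: (x + t *: y)).
  move=> t0; have [l [z [l0 rz e]]] := H _ t0; have bz := relint_sub rz.
  have <- : l = al + t * be by rewrite -gD e gZ gb // mulr1.
  by rewrite e scalerA mulVf ?gt_eqF // scale1r addrC subrK.
have be0 : 0 < be by rewrite /be ey gZ gb // mulr1.
have al0 : 0 <= al.
  rewrite leNgt; apply/negP => al0; have ht : 0 < - al / be / 2 by apply: divr_gt0 => //; apply: divr_gt0 => //; rewrite oppr_gt0.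
  have [+ _] := key _ ht.
  have -> : al + - al / be / 2 * be = al / 2 by field; rewrite gt_eqF.
  by lra.
have al1 : 0 < al.
  rewrite lt_neqAle al0 andbT; apply/eqP => al00.
  have [B hB] := polytope_bounded (CW_polytope hC Cb').
  (* With [t] chosen so that the term in [x] has norm [B1], the projected point has norm above the
     bound [B] of [b']. *)
  pose B1 := B + `|x0| + `|be^-1 *: y| + 1.
  have x1 : 0 < `|x| by rewrite normr_gt0.
  have B10 : 0 < B1.
    have := hB _ bq; have := normr_ge0 q; have := normr_ge0 x0; have := normr_ge0 (be^-1 *: y).
    by rewrite /B1; lra.
  pose t := `|x| / be / B1; have t0 : 0 < t by exact: divr_gt0 (divr_gt0 x1 be0) B10.
  have [_ /hB] := key _ t0; rewrite -al00 add0r.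
  have -> : x0 + (t * be)^-1 *: (x + t *: y) = (t * be)^-1 *: x + (x0 + be^-1 *: y).
    by apply/rowP => i; rewrite !mxE; field; rewrite !gt_eqF.
  have n1 : `|(t * be)^-1 *: x| = B1.
    have -> : (t * be)^-1 = B1 / `|x|.
      by rewrite /t [_ / B1 * _]mulrAC divfK ?gt_eqF // invf_div.
    by rewrite normrZ gtr0_norm ?divr_gt0 // divfK // gt_eqF.
  have := ler_normB ((t * be)^-1 *: x + (x0 + be^-1 *: y)) (x0 + be^-1 *: y).
  rewrite addrK n1; have := ler_normD x0 (be^-1 *: y).
  by rewrite /B1; lra.
pose q0 := x0 + al^-1 *: x.
have bq0 : b' q0.
  have [ab bq1] := key 1 ltr01; rewrite mul1r scale1r in ab bq1.
  apply: (closed_ray (cell_closed hC Cb') (r := 1) (v := x0 + (al + be)^-1 *: (x + y) - q0)) => // l l0 l1.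
  (* The projection reparametrises the segment from [x] to [x + y]; this [t] corresponds to time [l]
     on the projected segment. *)
  pose t := l * al / (al + be - l * be).
  have D : 0 < al + be - l * be by nra.
  have [_] := key t ltac:(by rewrite divr_gt0 // mulr_gt0).
  congr (b' _); rewrite /q0 /t.
  apply/rowP => i; rewrite !mxE; field.
  have -> : al * (al + be - l * be) + l * al * be = al * (al + be) by ring.
  by rewrite !gt_eqF // mulr_gt0.
have pq : p = q0.
  apply: (bd_ray (bc _ b_p) (bc' _ bq0) (prop_nr bp b_p) (prop_nr b'p bq0) (t := al / s1)).
    by rewrite divr_gt0.
  by rewrite /q0 ex; apply/rowP => i; rewrite !mxE; field; rewrite !gt_eqF.
by apply: (cell_frontier hC Cb Cb' rp); rewrite pq.
Qed.

(** The cone [[set 0]] stands for the empty face and provides the augmentation. *)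
Let F := [set 0] :: [seq K b | b <- prop].

Let K_inj : {in prop &, injective K}.
Proof.
move=> b b' bp b'p e; have [Cb _ _] := propP bp.
have [[v kv] _ _ _] := coneat_ocone hC x0 Cb.
by apply: (K_uniq bp b'p kv); rewrite -/(K b') -e.
Qed.

Let oc0 : ocone [set (0 : E)].
Proof.
split; first by exists 0.
- by move=> x y -> ->; rewrite addr0.
- by move=> t x _ ->; rewrite scaler0.
by move=> x y -> ->; exists 1; rewrite // scaler0 subr0.
Qed.

Let faces_fan : fan (dirm c) F.
Proof.
split.
- rewrite /= map_inj_in_uniq // filter_uniq // andbT.
  by apply/negP => /mapP[b bp e]; apply: (K_neq0 bp); rewrite -e.
- move=> r; rewrite inE => /orP[/eqP->//|/mapP[b /propP[Cb _ _] ->]]; exact: (coneat_ocone hC x0 Cb).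
- move=> r x; rewrite inE => /orP[/eqP->|/mapP[b /propP[Cb bc _] ->]].
    by move=> /= ->; exact: sub0mx.
  move=> [t [y [_ ry ->]]]; rewrite scalemx_sub //; apply: dirm_subin; first exact: (relint_sub rx0).
  by apply: bc; exact: (relint_sub ry).
- move=> v vc; have [->|v0] := eqVneq v 0; first by exists [set 0]; rewrite ?mem_head.
  have [B hB] := polytope_bounded (CW_polytope hC Cc).
  have v1 : 0 < `|v| by rewrite normr_gt0.
  pose T := (B + `|x0| + 1) / `|v|.
  have B0 : 0 < B + `|x0| + 1.
    by have := hB _ (relint_sub rx0); have := normr_ge0 x0; lra.
  have T0 : 0 < T by rewrite divr_gt0.
  have nT : ~ c (x0 + T *: v).
    move=> /hB; have := ler_normB (x0 + T *: v) x0.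
    rewrite addrC addKr normrZ gtr0_norm // /T divfK ?gt_eqF //; lra.
  have [t [t01 ct nt]] : exists t : R, [/\ 0 < t < 1, c (x0 + t *: (T *: v)) & ~ relint c (x0 + t *: (T *: v))].
    apply: contrapT => H; apply: nT; apply: (relint_exit (cell_closed hC Cc) (kC Cc) rx0).
      by rewrite scalemx_sub.
    by move=> t t01 ct; apply: contrapT => nt; apply: H; exists t.
  have [b Cb rb] := cell_at hC (x0 + t *: (T *: v)).
  have bp : b \in prop.
    rewrite mem_filter; apply/andP; split; first by apply/eqP => e; apply: nt; rewrite -e.
    apply/sE; split=> //; exact: (cell_frontier hC Cb Cc rb ct).
  have /andP[t0 t1] := t01.
  exists (K b); first by rewrite inE map_f ?orbT.
  exists (t * T)^-1, (x0 + t *: (T *: v)); split=> //; first by rewrite invr_gt0 mulr_gt0.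
  by apply/rowP => i; rewrite !mxE; field; rewrite !gt_eqF.
- move=> r r' x; rewrite !inE => /orP[/eqP->|/mapP[b bp ->]] /orP[/eqP->|/mapP[b' b'p ->]] //.
  + by move=> -> /(K_neq0 b'p).
  + by move=> kx x00; case: (K_neq0 bp); rewrite -x00.
  by move=> kx kx'; rewrite (K_uniq bp b'p kx kx').
move=> r r' x y; rewrite !inE => /orP[/eqP->|/mapP[b bp ->]] /orP[/eqP->|/mapP[b' b'p ->]].
- by move=> -> -> _ p q -> ->; rewrite addr0.
- move=> kx -> H; case: (K_neq0 b'p); have := H 1 ltr01.
  by rewrite scaler0 addr0 => <-.
- by move=> -> ky _ p q -> kq; rewrite add0r.
move=> kx ky H; have [[Cb _ _] [Cb' _ _]] := (propP bp, propP b'p).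
by apply: (coneat_below hC) => //; exact: (K_frontier b'p bp kx ky H).
Qed.

(** Compares the reference orientations of [b] and of the cone over it, the radial vector coming
    first. These factors translate the signs of the fan into those of the cells. *)
Let u b : int := inc [set x0] b.

Let uE k (B : 'M[R]_(k, d)) b y : b y -> row_free B -> (B :=: dirm b)%MS ->
  bsgn (col_mx (y - x0) B) = u b * bsgn B.
Proof.
move=> by_ fB eB; apply: (incE fB eB ltr01).
have -> : pt [set x0] = x0 by apply: (@ptP _ _ [set x0]); exists x0.
have -> : y - x0 - 1 *: (pt b - x0) = y - pt b by vec.
by apply: dirm_subin => //; apply: ptP; exists y.
Qed.

Let u_sq b : b \in prop -> u b * u b = 1.
Proof.
move=> bp; have [Cb bc ne] := propP bp; have [y by_] := cell_nonempty hC Cb.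
have fB := row_base_free (dirm b); have eB := eq_row_base (dirm b).
have fB' : row_free (col_mx (y - x0) (row_base (dirm b))).
  by rewrite row_free_col_mx // eB prop_x0.
by have := bsgn_sq fB'; rewrite (uE by_ fB eB) mulrACA (bsgn_sq fB) mulr1.
Qed.

Let u_facet b : b \in prop -> rk c = (rk b).+1 -> u b = eps c b.
Proof.
move=> bp k; have [Cb bc ne] := propP bp; have [y by_] := cell_nonempty hC Cb.
have fB := row_base_free (dirm b); have eB := eq_row_base (dirm b).
have B0 : bsgn (row_base (dirm b)) != 0 by case: (bsgn_free fB) => ->.
by apply: (mulIf B0); rewrite -(uE by_ fB eB) (epsE hC Cc Cb bc k rx0 by_ fB eB).
Qed.

Let K_dirm b y : b \in prop -> b y -> (dirm (K b) :=: dirm b + (y - x0)%R)%MS.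
Proof. by move=> /propP[Cb _ _] by_; exact: (coneat_dirm hC). Qed.

Let K_rk b : b \in prop -> rk (K b) = (rk b).+1.
Proof.
move=> bp; have [Cb bc ne] := propP bp; have [y by_] := cell_nonempty hC Cb.
rewrite /rk (K_dirm bp by_); apply/eqP; rewrite eqn_leq; apply/andP; split.
  apply: leq_trans (mxrank_adds_leqif _ _) _; have := rank_leq_row (y - x0).
  by move: (\rank _) (\rank _) => p q; lia.
rewrite (ltn_leqif (mxrank_leqif_sup (addsmxSl _ _))) addsmx_sub submx_refl /=.
exact: prop_x0.
Qed.

Let rk0 : rk [set (0 : E)] = 0%N.
Proof.
have : (dirm [set (0 : E)] <= (0 : 'M[R]_d))%MS.
  by apply: (@dirm_min _ _ _ _ _ 0) => // x ->; rewrite subrr sub0mx.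
by rewrite submx0 /rk => /eqP->; exact: mxrank0.
Qed.

(** The vector pointing outwards comes before the radial vector in the fan, and after it when the
    cone is taken over the boundary of [b']; the exchange gives the minus sign. *)
Let K_bd b b' : b \in prop -> b' \in prop ->
  fan_bd (K b') (K b) = - (u b' * u b * eps b' b).
Proof.
move=> bp b'p; have [[Cb bc ne] [Cb' bc' ne']] := (propP bp, propP b'p).
have bE : below (K b) (K b') <-> b `<=` b'.
  split=> [bl|]; last exact: (coneat_below hC).
  have [[x kx] _ _ _] := coneat_ocone hC x0 Cb; have [[y ky] _ kZ _] := coneat_ocone hC x0 Cb'.
  by apply: (K_frontier bp b'p kx ky) => t t0; apply: bl => //; exact: kZ.
have [bb|nb] := pselect (b `<=` b'); last first.
  by rewrite /fan_bd /eps !asboolF ?mulr0 ?oppr0 // => /bE.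
have [k|nk] := eqVneq (rk b') (rk b).+1; last first.
  by rewrite /fan_bd /eps !K_rk // eqSS (negbTE nk) !andbF mulr0 oppr0.
have [x' rx'] := cell_relint0 hC Cb'; have [y by_] := cell_nonempty hC Cb.
have fB := row_base_free (dirm b); have eB := eq_row_base (dirm b).
set B := row_base (dirm b) in fB eB.
have by' := bb _ by_; have bx' := relint_sub rx'.
have kx' : K b' (x' - x0) by exists 1, x'; rewrite scale1r.
have fB2 : row_free (col_mx (y - x0) B) by rewrite row_free_col_mx // eB prop_x0.
have eB2 : (col_mx (y - x0) B :=: dirm (K b))%MS.
  apply: eqmx_trans (eqmx_sym (K_dirm bp by_)); rewrite addsmxC.
  by apply: eqmx_trans (eqmx_sym (addsmxE _ _)) _; exact: adds_eqmx.
have kK : rk (K b') = (rk (K b)).+1 by rewrite !K_rk // k.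
have KF b1 : b1 \in prop -> K b1 \in F by move=> h; rewrite inE map_f ?orbT.
have h1 := fan_inc faces_fan (KF _ b'p) (KF _ bp) (proj2 bE bb) kK kx' fB2 eB2.
have fB3 : row_free (col_mx (y - x') B).
  rewrite row_free_col_mx // eB -opprB -scaleN1r eqmx_scale ?oppr_eq0 ?oner_eq0 //.
  exact: (subcell_span hC Cb' Cb bb (rkS_neq k) by_ rx').
have eB3 : (col_mx (y - x') B :=: dirm b')%MS.
  apply/eqmxP; rewrite -(mxrank_leqif_eq _).2; first by rewrite (eqP fB3) -/(rk b') k.
  by rewrite -addsmxE addsmx_sub dirm_subin //= eB (subset_dirm _ bb) //; exists y.
have h3 := epsE hC Cb' Cb bb k rx' by_ fB eB.
have h4 := uE by' fB3 eB3.
have fB4 : row_free (col_mx (y - x0) (col_mx (y - x') B)).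
  by rewrite row_free_col_mx // eB3 prop_x0.
have h5 : bsgn (col_mx (- (x' - x0)) (col_mx (y - x0) B)) =
    bsgn (col_mx (y - x') (col_mx (y - x0) B)).
  apply: (bsgn_col_pos fB2 ltr01).
  have -> : - (x' - x0) - 1 *: (y - x') = - (y - x0) by vec.
  by rewrite -addsmxE -scaleN1r scalemx_sub // addsmxSl.
have B0 : bsgn B != 0 by case: (bsgn_free fB) => ->.
rewrite /fan_bd asboolT; last exact: (proj2 bE bb).
rewrite kK eqxx /=; apply: (mulIf B0).
rewrite -[LHS]mulr1 -(u_sq bp) [LHS](_ : _ = (inc (K b') (K b) * (u b * bsgn B)) * u b); last by ring.
rewrite -(uE by_ fB eB) -h1 h5 (bsgn_swap fB4) h4 h3; ring.
Qed.

Let K_bd0 b : b \in prop -> fan_bd (K b) [set 0] = if rk b == 0%N then - u b else 0.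
Proof.
move=> bp; have [Cb bc ne] := propP bp; have [p rp] := cell_relint0 hC Cb.
rewrite /fan_bd asboolT => [|x y ->]; last by rewrite add0r.
rewrite K_rk // rk0 eqSS /=; case: eqP => // k.
have kp : K b (p - x0) by exists 1, p; rewrite scale1r.
have b0 : below [set 0] (K b) by move=> x y ->; rewrite add0r.
have KF : K b \in F by rewrite inE map_f ?orbT.
have fB : row_free (0 : 'M[R]_(0, d)) by rewrite /row_free mxrank0.
have e0 (A : 'M[R]_d) : \rank A = 0%N -> ((0 : 'M[R]_(0, d)) :=: A)%MS.
  by move/eqP; rewrite mxrank_eq0 => /eqP->; apply/eqmxP; rewrite !sub0mx.
have kk : rk (K b) = (rk [set (0 : E)]).+1 by rewrite K_rk // rk0 k.
have h1 := fan_inc faces_fan KF (mem_head _ _) b0 kk kp fB (e0 _ rk0).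
have h2 := uE (relint_sub rp) fB (e0 _ k).
have B0 : bsgn (0 : 'M[R]_(0, d)) != 0 by case: (bsgn_free fB) => ->.
apply: (mulIf B0); rewrite -h1 mulNr -h2.
apply: (bsgn_col_neg (a := 1) fB); first by [].
by rewrite scale1r addNr sub0mx.
Qed.

Let cs : c \in s. Proof. by apply/sE; split. Qed.

Let sum_s (V : zmodType) (f : set E -> V) : \sum_(b <- s) f b = f c + \sum_(b <- prop) f b.
Proof. by rewrite (bigD1_seq c) //= big_filter. Qed.

(** With [phi c = 0], [phi] is a cochain on the boundary sphere, transported to the fan by the
    factors [u]. The cocycle condition at [c] is the vanishing on the fundamental chain that
    [fan_coexact] asks for, and the value of the solution at [[set 0]] becomes the constant on
    vertices. *)
Let faces_exact0 (V : zmodType) (phi : set E -> V) : (0 < rk c)%N -> phi c = 0 ->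
  (forall b', b' \in s -> \sum_(b <- s) phi b *~ eps b' b = 0) ->
  exists psi m, forall b', b' \in s ->
    phi b' = \sum_(b <- s) psi b *~ eps b' b + (if rk b' == 0%N then m else 0).
Proof.
move=> rc pc0 dphi.
pose ph t := if t == [set 0] then 0 else
  let b := xget set0 [set b | b \in prop /\ K b = t] in phi b *~ u b.
have phK b : b \in prop -> ph (K b) = phi b *~ u b.
  move=> bp; rewrite /ph ifN; last first.
    by apply/eqP => e; apply: (K_neq0 bp); rewrite e.
  have [b'p e] : [set b' | b' \in prop /\ K b' = K b] (xget set0 [set b' | b' \in prop /\ K b' = K b]).
    by apply: xgetPex; exists b.
  by rewrite (K_inj b'p bp e).
have ph0 : ph [set 0] = 0 by rewrite /ph eqxx.
have [t tF|| psh hpsh] := fan_coexact (phi := ph) faces_fan.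
- rewrite big_cons ph0 mul0rz add0r big_map.
  move: tF; rewrite inE => /orP[/eqP->|/mapP[b' b'p ->]].
    rewrite big1_seq // => b /andP[_ bp]; apply/eqP; rewrite phK //.
    have [->|/fan_bdP[_]] := eqVneq (fan_bd [set 0] (K b)) 0; first by rewrite mulr0z.
    by rewrite rk0.
  have b's : b' \in s by move: b'p; rewrite mem_filter => /andP[].
  transitivity (- ((\sum_(b <- prop) phi b *~ eps b' b) *~ u b')).
    rewrite mulrz_suml -sumrN; apply: eq_big_seq => b bp.
    rewrite phK // K_bd // mulrNz -mulrzA -mulrzA; congr (- (_ *~ _)).
    by rewrite -[RHS]mulr1 -(u_sq bp); ring.
  by have := dphi _ b's; rewrite sum_s pc0 mul0rz add0r => ->; rewrite mul0rz oppr0.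
- rewrite big_cons ph0 if_same add0r big_map.
  have := dphi _ cs; rewrite sum_s pc0 mul0rz add0r => e; rewrite -[RHS]e.
  apply: eq_big_seq => b bp; rewrite phK // K_rk // eq_sym -/(rk c).
  case: eqP => k; first by rewrite u_facet.
  by have [->|/eps_neq0[_]] := eqVneq (eps c b) 0; rewrite ?mulr0z.
(* Values on facets are dropped: they would contribute only at [c], where [phi] is 0. *)
exists (fun b => if (b != c) && (rk c != (rk b).+1) then - (psh (K b) *~ u b) else 0), (- psh [set 0]).
move=> b' b's; rewrite sum_s eqxx /= mul0rz add0r.
have [->|ne] := eqVneq b' c.
  rewrite pc0 ifN ?addr0; last by rewrite -lt0n.
  rewrite big1_seq // => b /andP[_ bp]; case: ifP => [/andP[_ /eqP k]|]; last by rewrite mul0rz.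
  have [->|/eps_neq0[_]] := eqVneq (eps c b) 0; first by rewrite mulr0z.
  by move/k.
have b'p : b' \in prop by rewrite mem_filter ne.
have KF : K b' \in F by rewrite inE map_f ?orbT.
have := hpsh _ KF; rewrite phK // big_cons K_bd0 // big_map => /(congr1 (fun z => z *~ u b')).
rewrite -mulrzA u_sq // mulr1z => ->; rewrite mulrzDl addrC; congr (_ + _); last first.
  case: eqP => _; last by rewrite mulr0z mul0rz.
  by rewrite -mulrzA mulNr u_sq // mulrNz mulr1z.
rewrite mulrz_suml; apply: eq_big_seq => b bp.
have [_ _ /eqP->] /= := propP bp.
have [e|] := eqVneq (rk c) (rk b).+1; last first.
  move=> _ /=; rewrite K_bd // mulrNz !mulNrz -!mulrzA; congr (- (_ *~ _)).
  by rewrite -[RHS]mulr1 -(u_sq b'p); ring.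
rewrite mul0rz K_bd //; have [->|/eps_neq0[_ k]] := eqVneq (eps b' b) 0.
  by rewrite mulr0 oppr0 mulr0z mul0rz.
have [Cb' bc' ne'] := propP b'p.
by have := subcell_rk hC Cc Cb' bc' ne'; rewrite e k ltnn.
Qed.

(** In positive dimension, subtracting the coboundary of a function supported on one facet [b0]
    reduces to the case [phi c = 0]. *)
Lemma faces_exact (V : zmodType) (phi : set E -> V) :
  (forall b', b' \in s -> \sum_(b <- s) phi b *~ eps b' b = 0) ->
  exists psi m, forall b', b' \in s ->
    phi b' = \sum_(b <- s) psi b *~ eps b' b + (if rk b' == 0%N then m else 0).
Proof.
move=> dphi; have [rc|] := posnP (rk c).
  exists (fun=> 0), (phi c) => b' b's; rewrite big1 ?add0r => [|b _]; last by rewrite mul0rz.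
  have [Cb' bc'] := proj1 (sE b') b's.
  have [->|/eqP ne] := eqVneq b' c; first by rewrite rc eqxx.
  by have := subcell_rk hC Cc Cb' bc' ne; rewrite rc.
move=> rc.
(* Without a facet, the spans of all cones of the fan would be proper subspaces and could not fill
   [dirm c]. *)
have [b0 b0p k0] : exists2 b, b \in prop & rk c = (rk b).+1.
  apply: contrapT => H.
  have [M /mapP[t tF ->]|v vc hv] := @avoid_subspaces _ _ (dirm c) [seq dirm t | t <- F].
    apply/negP => /mxrankS; rewrite -/(rk c) -/(rk t).
    move: tF; rewrite inE => /orP[/eqP->|/mapP[b bp ->]]; first by rewrite rk0; lia.
    rewrite K_rk // => h; apply: H; exists b => //; apply/eqP; rewrite eqn_leq h /=.
    by have [Cb bc ne] := propP bp; exact: (subcell_rk hC Cc Cb bc ne).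
  have [t tF tv] := fan_cover faces_fan vc.
  have /negP := hv _ (map_f (fun t => dirm t) tF); apply.
  exact: (ocone_in (fan_ocone faces_fan tF) tv).
have [Cb0 b0c ne0] := propP b0p.
have b0s : b0 \in s by apply/sE.
pose psi1 b := if b == b0 then phi c *~ eps c b0 else 0.
have d1 b' : \sum_(b <- s) psi1 b *~ eps b' b = phi c *~ (eps c b0 * eps b' b0).
  rewrite (big_one (r := b0)) // /psi1; first by rewrite eqxx mulrzA.
  by move=> b _ /eqP/negbTE->; rewrite mul0rz.
pose phi1 b := phi b - \sum_(b1 <- s) psi1 b1 *~ eps b b1.
have [|b' b's|psi [m hpsi]] := @faces_exact0 _ phi1 rc.
- by rewrite /phi1 d1 eps_sq // mulr1z subrr.
- transitivity (\sum_(b <- s) phi b *~ eps b' b -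
      \sum_(b <- s) phi c *~ (eps c b0 * (eps b' b * eps b b0))).
    rewrite -sumrB; apply: eq_bigr => b _; rewrite /phi1 d1 mulrzBl; congr (_ - _).
    rewrite -(mulrzA (phi c) (eps c b0 * eps b b0) (eps b' b)).
    by congr (_ *~ _); rewrite -mulrA; congr (_ * _); exact: mulrC.
  rewrite (dphi _ b's) sub0r; apply/eqP; rewrite oppr_eq0; apply/eqP.
  rewrite -mulrz_sumr -mulr_sumr eps_eps ?mulr0 ?mulr0z //.
  + by have [] := proj1 (sE b') b's.
  + move=> b Cb _ bb'; apply/sE; split=> // z /bb'; have [_] := proj1 (sE b') b's; exact.
  by move=> b /sE[].
exists (fun b => psi1 b + psi b), m => b' b's.
under eq_bigr => b _ do rewrite mulrzDl.
by rewrite big_split -addrA -hpsi // addrC subrK.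
Qed.

(** The constant chain of the one-dimensional fan has no boundary at [[set 0]]. *)
Lemma faces_fundamental : rk c = 1%N -> \sum_(b <- s) eps c b = 0.
Proof.
move=> kc; have [om0 _] := fan_exactP int faces_fan.
have := om0 1 _ (mem_head _ _).
rewrite /bdF big_cons rk0 -/(rk c) kc /= mul0rz add0r big_map.
move=> e; rewrite sum_s.
have -> : eps c c = 0 by rewrite /eps (ltn_eqF (ltnSn _)) andbF.
rewrite add0r -[RHS]oppr0 -[in RHS]e -sumrN; apply: eq_big_seq => b bp.
have [Cb bc ne] := propP bp; have kb := subcell_rk hC Cc Cb bc ne.
have k0 : rk b = 0%N by move: kb; rewrite kc; case: (rk b).
by rewrite K_rk // K_bd0 // k0 /= mulrNz opprK u_facet ?kc ?k0 // intz.
Qed.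

End Faces.

(** * Rigid motions and coronas *)

Section Isometries.
Variables (R : realType) (d : nat).
Local Notation E := 'rV[R]_d.
Implicit Types (x y u v : E) (c b : set E).

Let dp x y : R := \sum_i x 0 i * y 0 i.

Let dpC x y : dp x y = dp y x.
Proof. by apply: eq_bigr => i _; rewrite mulrC. Qed.

Let dpD x y z : dp (x + y) z = dp x z + dp y z.
Proof. by rewrite /dp -big_split; apply: eq_bigr => i _; rewrite mxE mulrDl. Qed.

Let dpZ (t : R) x z : dp (t *: x) z = t * dp x z.
Proof. by rewrite /dp mulr_sumr; apply: eq_bigr => i _; rewrite mxE mulrA. Qed.

Let dpN x z : dp (- x) z = - dp x z.
Proof. by rewrite -scaleN1r dpZ mulN1r. Qed.

Let dp_en x : dp x x = en x ^+ 2.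
Proof. by rewrite en_sqr; apply: eq_bigr => i _. Qed.

Let dp_polar x y : dp x y = (en x ^+ 2 + en y ^+ 2 - en (x - y) ^+ 2) / 2.
Proof.
rewrite -!dp_en dpD dpN !(dpC _ (x - y)) !dpD !dpN (dpC y x); lra.
Qed.

(** By polarisation [g] preserves dot products. The squared length of [P - (t *: Q + S)] is a
    polynomial in dot products, so the defect of linearity is as long as the same expression without
    [g], which is 0. *)
Lemma isometry_linear (g : E -> E) : g 0 = 0 ->
  (forall x y, en (g x - g y) = en (x - y)) ->
  forall (t : R) x y, g (t *: x + y) = t *: g x + g y.
Proof.
move=> g0 gi t x y.
have gn z : en (g z) = en z by rewrite -[g z]subr0 -g0 gi subr0.
have gd u v : dp (g u) (g v) = dp u v by rewrite !dp_polar !gn gi.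
have ex (P Q S : E) : dp (P - (t *: Q + S)) (P - (t *: Q + S)) =
    dp P P - 2 * t * dp P Q - 2 * dp P S + t ^+ 2 * dp Q Q + 2 * t * dp Q S + dp S S.
  rewrite dpD dpN dpD dpZ !(dpC _ (P - _)) !dpD !dpN !dpD !dpZ (dpC Q P) (dpC S P) (dpC S Q).
  by ring.
apply/eqP; rewrite -subr_eq0; apply/eqP/en0_eq0/eqP.
rewrite -sqrf_eq0 -dp_en ex !gd -ex subrr.
by rewrite /dp big1 // => i _; rewrite mxE mul0r.
Qed.

Lemma isometry_affine (f : E -> E) : (forall x y, edist (f x) (f y) = edist x y) ->
  forall x, f x = x *m linpart f + f 0.
Proof.
move=> fi x; pose g v := f v - f 0.
have gl := @isometry_linear g.
have {}gl t u v : g (t *: u + v) = t *: g u + g v.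
  apply: gl; first by rewrite /g subrr.
  move=> a b; rewrite /g -[RHS]edistE -fi edistE; congr en; vec.
have g0 : g 0 = 0 by rewrite /g subrr.
have gx : g x = x *m linpart f.
  rewrite {1}(row_sum_delta x) mulmx_sum_row.
  elim/big_rec2: _ => // i u v _ <-; rewrite gl; congr (_ *: _ + _).
  by apply/rowP => j; rewrite /linpart /lin1_mx !mxE.
by rewrite -gx subrK.
Qed.

Section Motion.
Variables (f : E -> E) (mf : rigid_motion f).
Local Notation M := (linpart f).

Lemma motion_affine x : f x = x *m M + f 0.
Proof. by apply: isometry_affine; case: mf. Qed.

Lemma motion_unit : M \in unitmx.
Proof. by rewrite unitmxE unitfE; case: mf => _ /lt0r_neq0. Qed.

Lemma motionB x y : f x - f y = (x - y) *m M.
Proof. by rewrite motion_affine (motion_affine y) mulmxBl; vec. Qed.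

Definition motion_inv y : E := (y - f 0) *m invmx M.

Lemma motionK : cancel f motion_inv.
Proof. by move=> x; rewrite /motion_inv motion_affine addrK mulmxK // motion_unit. Qed.

Lemma motion_invK : cancel motion_inv f.
Proof. by move=> y; rewrite motion_affine /motion_inv mulmxKV ?motion_unit // subrK. Qed.

Lemma linpart_affine (g : E -> E) (A : 'M[R]_d) (z : E) :
  (forall x, g x = x *m A + z) -> linpart g = A.
Proof.
move=> gE; rewrite /linpart /lin1_mx; apply/matrixP => i j.
by rewrite mxE !gE mul0mx add0r addrK -rowE mxE.
Qed.

Lemma linpart_inv : linpart motion_inv = invmx M.
Proof.
apply: (@linpart_affine _ _ (- (f 0 *m invmx M))) => x.
by rewrite /motion_inv mulmxBl.
Qed.

Lemma motion_inv_rigid : rigid_motion motion_inv.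
Proof.
split=> [x y|]; first by rewrite -(proj1 mf) !motion_invK.
by rewrite linpart_inv det_inv invr_gt0; case: mf.
Qed.

Lemma image_motionK c : motion_inv @` (f @` c) = c.
Proof.
by apply/seteqP; split=> [_ [_ [x cx <-] <-]|x cx]; [rewrite motionK|exists (f x); [exists x|rewrite motionK]].
Qed.

Lemma image_motion_invK c : f @` (motion_inv @` c) = c.
Proof.
by apply/seteqP; split=> [_ [_ [x cx <-] <-]|x cx]; [rewrite motion_invK|exists (motion_inv x); [exists x|rewrite motion_invK]].
Qed.

Lemma mem_image_motion c x : (f @` c) (f x) <-> c x.
Proof.
by split=> [[y cy /(can_inj motionK)<-]//|cx]; exists x.
Qed.

Lemma image_motion_sub c b : f @` c `<=` f @` b <-> c `<=` b.
Proof.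
split=> [h x cx|h _ [x cx <-]]; last by exists x; [exact: h|].
by apply/mem_image_motion/h; exists x.
Qed.

Lemma affine_hull_motion c x : affine_hull c x -> affine_hull (f @` c) (f x).
Proof.
move=> [n [p [a [cp a1 ->]]]]; exists n, (fun i => f (p i)), a; split=> //.
  by move=> i; exists (p i).
rewrite motion_affine mulmx_suml -[f 0 in LHS]scale1r -a1 scaler_suml -big_split.
by apply: eq_bigr => i _; rewrite [in RHS]motion_affine scalerDr scalemxAl.
Qed.

Lemma dirm_motion c : c !=set0 -> (dirm (f @` c) :=: dirm c *m M)%MS.
Proof.
move=> [x0 cx0]; apply/eqmxP/andP; split.
  apply: (@dirm_min _ _ _ _ _ (f x0)) => [|_ [x cx <-]]; first by exists x0.
  by rewrite motionB submxMr // dirm_subin.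
apply/rV_subP => v /submxP[w ->]; rewrite mulmxA; set u := w *m _.
have uc : u <:= dirm c by rewrite submxMl.
have c0 : c !=set0 by exists x0.
have [x [y [hx hy ->]]] := proj1 (dirmP u c0) uc.
by rewrite -motionB; apply: dirm_sub; exact: affine_hull_motion.
Qed.

Lemma rk_motion c : c !=set0 -> rk (f @` c) = rk c.
Proof.
move=> c0; rewrite /rk (dirm_motion c0); apply: mxrankMfree.
by rewrite row_free_unit motion_unit.
Qed.

(** The sign with which a motion [g] carries the reference orientation of [c] to that of its
    image. *)
Definition sgnf (g : E -> E) c : int :=
  bsgn (row_base (dirm c) *m linpart g) * bsgn (row_base (dirm c)).

Lemma row_free_motion k (B : 'M[R]_(k, d)) : row_free B -> row_free (B *m M).
Proof. by rewrite /row_free mxrankMfree // row_free_unit motion_unit. Qed.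

Lemma sgnfE k (B : 'M[R]_(k, d)) c : row_free B -> (B :=: dirm c)%MS ->
  bsgn (B *m M) = sgnf f c * bsgn B.
Proof.
move=> fB eB; have ek : k = \rank (dirm c) by rewrite -eB; apply/eqP; rewrite eq_sym.
subst k; have [A [eA dA]] := bsgn_basis_eq fB (eqmx_trans eB (eqmx_sym (eq_row_base (dirm c)))).
have fC := row_base_free (dirm c).
rewrite /sgnf eA -mulmxA (bsgn_mul A fC) (bsgn_mul A (row_free_motion fC)).
by rewrite -[LHS]mulr1 -(bsgn_sq fC); ring.
Qed.

Lemma sgnf_sq c : sgnf f c * sgnf f c = 1.
Proof.
rewrite /sgnf mulrACA !bsgn_sq ?mulr1 ?row_base_free //.
by rewrite row_free_motion // row_base_free.
Qed.

(** The direction space of [c] is the whole space, so the sign is that of the determinant; here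
    rigid motions have to preserve orientation. *)
Lemma sgnf_full c : rk c = d -> sgnf f c = 1.
Proof.
move=> k; have f1 : row_free (1%:M : 'M[R]_d) by rewrite row_free_unit unitmx1.
have e1 : ((1%:M : 'M[R]_d) :=: dirm c)%MS.
  by apply/eqmxP; rewrite submx1 andbT sub1mx /row_full -/(rk c) k.
have := sgnfE f1 e1; rewrite mul1mx -{1}[M]mulmx1 bsgn_mul // => h.
have B0 : bsgn (1%:M : 'M[R]_d) != 0 by case: (bsgn_free f1) => ->.
by apply: (mulIf B0); rewrite -h gtr0_sgz //; case: mf.
Qed.

End Motion.

Lemma motion_id : rigid_motion (@id E) /\ linpart (@id E) = 1%:M.
Proof.
have e : linpart (@id E) = 1%:M by apply: (@linpart_affine _ _ 0) => x; rewrite mulmx1 addr0.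
by split=> //; split; rewrite // e det1.
Qed.

Lemma motion_comp (f g : E -> E) : rigid_motion f -> rigid_motion g ->
  rigid_motion (g \o f) /\ linpart (g \o f) = linpart f *m linpart g.
Proof.
move=> mf mg; have e : linpart (g \o f) = linpart f *m linpart g.
  apply: (@linpart_affine _ _ (f 0 *m linpart g + g 0)) => x /=.
  by rewrite (motion_affine mg) (motion_affine mf x) mulmxDl mulmxA addrA.
split=> //; split=> [x y|]; first by rewrite /= (proj1 mg) (proj1 mf).
by rewrite e det_mulmx mulr_gt0 //; [case: mf|case: mg].
Qed.

Lemma sgnf_comp (f g : E -> E) c : rigid_motion f -> rigid_motion g -> c !=set0 ->
  sgnf (g \o f) c = sgnf g (f @` c) * sgnf f c.
Proof.
move=> mf mg c0; have fB := row_base_free (dirm c); have eB := eq_row_base (dirm c).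
have [mgf e] := motion_comp mf mg.
have B0 : bsgn (row_base (dirm c)) != 0 by case: (bsgn_free fB) => ->.
apply: (mulIf B0); rewrite -(sgnfE mgf fB eB) -mulrA -(sgnfE mf fB eB) e mulmxA.
apply: (sgnfE mg); first exact: row_free_motion.
by apply: eqmx_trans (eqmx_sym (dirm_motion mf c0)); exact: eqmxMr.
Qed.

Lemma relint_motion (f : E -> E) c x : rigid_motion f -> relint c x -> relint (f @` c) (f x).
Proof.
move=> mf [cx [e e0 he]]; split; first by exists x.
exists e => // y ay; rewrite -[y](motion_invK mf) (proj1 mf) => h.
exists (motion_inv f y) => //; apply: he => //.
rewrite -(image_motionK mf c); apply: affine_hull_motion => //.
exact: motion_inv_rigid.
Qed.

(** Motions map outward vectors to outward vectors, so incidence numbers change only through the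
    reference orientations. *)
Lemma eps_motion (C : set (set E)) (hC : polytopal_CW C) (f : E -> E) c b : rigid_motion f ->
  C c -> C b -> C (f @` c) -> C (f @` b) ->
  eps (f @` c) (f @` b) = sgnf f c * sgnf f b * eps c b.
Proof.
move=> mf Cc Cb Cfc Cfb; have c0 := cell_nonempty hC Cc; have b0 := cell_nonempty hC Cb.
have [[bc k]|no] := pselect (b `<=` c /\ rk c = (rk b).+1); last first.
  have e0 a a' : ~ (a' `<=` a /\ rk a = (rk a').+1) -> eps a a' = 0.
    by move=> h; apply/eqP; apply: contrapT => /negP/eps_neq0.
  rewrite !e0 ?mulr0 // => -[/(image_motion_sub mf) h]; rewrite !rk_motion // => k.
  by apply: no.
have [x rx] := cell_relint0 hC Cc; have [y by_] := b0.
have fB := row_base_free (dirm b); have eB := eq_row_base (dirm b).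
set B := row_base (dirm b) in fB eB.
have fB' := row_free_motion mf fB.
have eB' : (B *m linpart f :=: dirm (f @` b))%MS.
  by apply: eqmx_trans (eqmx_sym (dirm_motion mf b0)); exact: eqmxMr.
have k' : rk (f @` c) = (rk (f @` b)).+1 by rewrite !rk_motion.
have fby : (f @` b) (f y) by exists y.
have h1 := epsE hC Cfc Cfb (proj2 (image_motion_sub mf b c) bc) k' (relint_motion mf rx) fby fB' eB'.
have h2 := epsE hC Cc Cb bc k rx by_ fB eB.
have fC : row_free (col_mx (y - x) B).
  rewrite row_free_col_mx // eB -opprB -scaleN1r eqmx_scale ?oppr_eq0 ?oner_eq0 //.
  exact: (subcell_span hC Cc Cb bc (rkS_neq k) by_ rx).
have eC : (col_mx (y - x) B :=: dirm c)%MS.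
  apply/eqmxP; rewrite -(mxrank_leqif_eq _).2; first by rewrite (eqP fC) -/(rk c) k.
  rewrite -addsmxE addsmx_sub eB (subset_dirm b0 bc) andbT.
  by apply: dirm_subin; [exact: relint_sub|exact: bc].
move: h1; rewrite (motionB mf) -mul_col_mx (sgnfE mf fC eC) h2 (sgnfE mf fB eB) => h1.
have B0 : bsgn B != 0 by case: (bsgn_free fB) => ->.
apply: (mulIf B0); rewrite -[LHS]mulr1 -(sgnf_sq mf b).
rewrite [LHS](_ : _ = (eps (f @` c) (f @` b) * (sgnf f b * bsgn B)) * sgnf f b); last by ring.
by rewrite -h1; ring.
Qed.

End Isometries.

(** * Coronas and their restriction to nearby cells *)

Section Coronas.
Variables (R : realType) (d : nat) (L : Type) (T : polytopal_tiling R d L).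
Local Notation E := 'rV[R]_d.
Implicit Types (c b t a : set E) (i j : nat).

Let hC := cells_CW T.

Lemma cell0 c : cells T c -> c !=set0.
Proof. exact: (cell_nonempty hC). Qed.

Lemma tileE t : tile T t <-> cells T t /\ rk t = d.
Proof. by split=> -[Ct k]; split=> //; apply/(has_dimE _ (cell0 Ct)). Qed.

(** Chains of tiles separate the recursion of [tile_corona] from the cells in it, which come back in
    [tile_coronaP]. *)
Fixpoint tile_reach i t t' : Prop :=
  if i is j.+1 then tile T t' /\ exists2 t1, tile_reach j t t1 & t1 `&` t' !=set0
  else t' = t.

Lemma tile_reach_tile i t t' : tile T t -> tile_reach i t t' -> tile T t'.
Proof. by case: i => [|i] Tt /= => [->|[]]. Qed.

Lemma tile_coronaP i t a : tile T t -> tile_corona T i t a <->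
  cells T a /\ exists2 t', tile_reach i t t' & a `<=` t'.
Proof.
move=> Tt; elim: i a => [|i IH] a /=; split=> -[Ca].
- by move=> [_ /= -> at_]; split=> //; exists t.
- by move=> [_ -> at_]; split=> //; exists t.
- move=> [t' [/= Tt' [c /IH[Cc [t1 r1 ct1]] [x [cx tx]]]] at'].
  split=> //; exists t' => //; split=> //; exists t1 => //.
  by exists x; split=> //; exact: ct1.
move=> [t' [Tt' [t1 r1 t1t']] at']; split=> //; exists t' => //; split=> //.
exists t1 => //; apply/IH; have [Ct1 _] := tile_reach_tile Tt r1.
by split=> //; exists t1.
Qed.

Lemma tile_meets_self t : tile T t -> t `&` t !=set0.
Proof. by move=> [Ct _]; have [x tx] := cell0 Ct; exists x. Qed.

Lemma tile_reach_mono i t t' : tile T t -> tile_reach i t t' -> tile_reach i.+1 t t'.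
Proof.
move=> Tt r; have Tt' := tile_reach_tile Tt r.
by split=> //; exists t' => //; exact: tile_meets_self.
Qed.

Lemma tile_reach_le i j t t' : (i <= j)%N -> tile T t -> tile_reach i t t' -> tile_reach j t t'.
Proof.
move=> /subnK <- Tt; elim: (j - i)%N => [//|k IH] r; rewrite addSn.
by apply: tile_reach_mono => //; exact: IH.
Qed.

Lemma tile_reach_cons i t0 t t' : tile T t -> t0 `&` t !=set0 ->
  tile_reach i t t' -> tile_reach i.+1 t0 t'.
Proof.
move=> Tt h; elim: i t' => [|i IH] t'; first by move=> ->; split=> //; exists t0.
by move=> [Tt' [t1 /IH r1 h1]]; split=> //; exists t1.
Qed.

Lemma cell_in_tile c : cells T c -> exists2 t, tile T t & c `<=` t.
Proof.
move=> Cc; have [s us sE] := cell_star hC Cc.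
have [t /sE[Ct ct] k] := star_top hC Cc us sE.
by exists t => //; apply/tileE.
Qed.

Lemma maps_corona_mem f i c c' a : maps_corona T f i c c' -> corona T i c a ->
  corona T i c' (f @` a) /\ label T (f @` a) = label T a.
Proof. by move=> [_ _ [e hl]] ca; split; [rewrite -e; exists a|exact: hl]. Qed.

Lemma maps_corona_inv f i c c' : maps_corona T f i c c' ->
  maps_corona T (motion_inv f) i c' c.
Proof.
move=> [mf fc [fe fl]]; have K := image_motionK mf; split; first exact: motion_inv_rigid.
  by rewrite -fc K.
split; last by rewrite -fe => _ [a ca <-]; rewrite K fl.
apply/seteqP; split=> [_ [b cb <-]|a ca].
  by move: cb; rewrite -fe => -[a ca <-]; rewrite K.
by exists (f @` a); [rewrite -fe; exists a|rewrite K].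
Qed.

Lemma maps_corona_comp f g i c c' c'' : maps_corona T f i c c' ->
  maps_corona T g i c' c'' -> maps_corona T (g \o f) i c c''.
Proof.
move=> [mf fc [fe fl]] [mg gc [ge gl]]; have [mgf _] := motion_comp mf mg.
have I a : (g \o f) @` a = g @` (f @` a).
  by rewrite image_comp.
split=> //; first by rewrite I fc.
split; last first.
  by move=> a ca; rewrite I gl ?fl // -fe; exists a.
apply/seteqP; split=> [_ [a ca <-]|a].
  by rewrite I -ge; exists (f @` a) => //; rewrite -fe; exists a.
by rewrite -ge -fe => -[_ [b cb <-] <-]; exists b.
Qed.

Lemma maps_corona_id i c : maps_corona T id i c c.
Proof.
have I a : id @` a = a by rewrite image_id.
split; [by have [] := motion_id R d|exact: I|split=> [|a _]; last by rewrite I].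
by apply/seteqP; split=> [_ [a ca <-]|a ca]; [rewrite I|exists a].
Qed.

Section Restriction.
Variables (i : nat).

(** Every tile containing [c] meets [t0], so it reaches in [j.+1] steps what [t0] reaches in [j]. *)
Let near_corona c t0 t' a j : tile T t0 -> t0 `&` c !=set0 -> (j <= i)%N ->
  tile_reach j t0 t' -> cells T a -> a `<=` t' -> corona T i.+1 c a.
Proof.
move=> T0 [x [tx cx]] ji r Ca at'; split=> // t Tt ct; apply/tile_coronaP => //.
split=> //; exists t' => //; apply: (@tile_reach_le j.+1) => //.
by apply: (tile_reach_cons T0 _ r); exists x; split=> //; exact: ct.
Qed.

Let image_tile f c c' t : cells T c' -> maps_corona T f i.+1 c c' -> corona T i.+1 c t ->
  tile T t -> tile T (f @` t).
Proof.
move=> Cc' h ct Tt; have [[Cft _] _] := maps_corona_mem h ct.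
have [mf _ _] := h; apply/tileE; split=> //.
by move/tileE: Tt => [Ct k]; rewrite (rk_motion mf (cell0 Ct)).
Qed.

Let image_reach f c c' t0 t' j : cells T c' -> maps_corona T f i.+1 c c' ->
  tile T t0 -> t0 `&` c !=set0 -> (j <= i)%N -> tile_reach j t0 t' ->
  tile_reach j (f @` t0) (f @` t').
Proof.
move=> Cc' h T0 tc; elim: j t' => [|j IH] t' ji; first by move=> ->.
move=> r; have Tt' := tile_reach_tile T0 r; have [Ct' _] := Tt'.
have := r => /= -[_ [t1 r1 [x [t1x t'x]]]]; split.
  by apply: (image_tile Cc' h) => //; exact: (near_corona T0 tc ji r).
exists (f @` t1); first by apply: IH => //; exact: ltnW.
by exists (f x); split; exists x.
Qed.

(** A tile around the image of [b] is pulled back by the inverse motion, which maps the corona of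
    [c'] to that of [c]. *)
Let image_corona f c c' b a : cells T c -> cells T c' -> cells T b ->
  maps_corona T f i.+1 c c' -> b `&` c !=set0 -> cells T (f @` b) ->
  corona T i b a -> corona T i (f @` b) (f @` a).
Proof.
move=> Cc Cc' Cb h [x [bx cx]] Cfb [Ca ha].
have mf : rigid_motion f by case: h.
have h' := maps_corona_inv h.
have [t0 T0 bt0] := cell_in_tile Cb.
have meet t : b `<=` t -> t `&` c !=set0 by move=> bt; exists x; split=> //; exact: bt.
have ca : corona T i.+1 c a.
  move/(tile_coronaP _ _ T0): (ha _ T0 bt0) => [_ [t' r at']].
  exact: (near_corona T0 (meet _ bt0) (leqnn i) r).
have [[Cfa _] _] := maps_corona_mem h ca.
split=> // t0' T0' bt0'.
have Tt : tile T (motion_inv f @` t0').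
  apply: (image_tile Cc h') => //; have [Ct0' _] := T0'.
  apply: (near_corona T0' _ (leq0n i) (erefl : tile_reach 0 t0' t0')) => //.
  exists (f x); split; first by apply: bt0'; exists x.
  by have [_ <- _] := h; exists x.
have btt : b `<=` motion_inv f @` t0'.
  by rewrite -(image_motionK mf b); apply: image_subset.
move/(tile_coronaP _ _ Tt): (ha _ Tt btt) => [_ [t' r at']].
apply/tile_coronaP => //; split=> //; exists (f @` t'); last by apply: image_subset.
rewrite -(image_motion_invK mf t0').
exact: (image_reach Cc' h Tt (meet _ btt) (leqnn i) r).
Qed.

(** Tiles around [b] meet [c], so the [i]-corona of [b] lies in the [i.+1]-corona of [c]. This is
    the loss of radius in passing between incident cells. *)
Lemma maps_corona_restrict f c c' b : cells T c -> cells T c' -> cells T b ->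
  maps_corona T f i.+1 c c' -> b `&` c !=set0 ->
  cells T (f @` b) /\ maps_corona T f i b (f @` b).
Proof.
move=> Cc Cc' Cb h bc; have [x [bx cx]] := bc.
have [mf fc [fe fl]] := h; have h' := maps_corona_inv h.
have [t0 T0 bt0] := cell_in_tile Cb.
have meet t : b `<=` t -> t `&` c !=set0 by move=> bt; exists x; split=> //; exact: bt.
have cb : corona T i.+1 c b.
  exact: (near_corona T0 (meet _ bt0) (leq0n i) (erefl : tile_reach 0 t0 t0)).
have [[Cfb _] _] := maps_corona_mem h cb.
have bc' : (f @` b) `&` c' !=set0 by exists (f x); rewrite -fc; split; exists x.
split=> //; split=> //; split.
  apply/seteqP; split=> [_ [a ca <-]|a ca]; first exact: (image_corona Cc Cc' Cb h bc Cfb).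
  exists (motion_inv f @` a); last exact: image_motion_invK.
  have := image_corona Cc' Cc Cfb h' bc'; rewrite (image_motionK mf); exact.
move=> a [Ca ha]; apply: fl.
move/(tile_coronaP _ _ T0): (ha _ T0 bt0) => [_ [t' r at']].
exact: (near_corona T0 (meet _ bt0) (leqnn i) r).
Qed.

End Restriction.

Lemma maps_corona_le f i j c c' : (i <= j)%N -> cells T c -> cells T c' ->
  maps_corona T f j c c' -> maps_corona T f i c c'.
Proof.
move=> /subnK <- Cc Cc'; elim: (j - i)%N => [//|k IH]; rewrite addSn => h.
apply: IH; have [_ fc _] := h.
have cc : c `&` c !=set0 by have [x cx] := cell0 Cc; exists x.
by have [_] := maps_corona_restrict Cc Cc' Cc h cc; rewrite fc.
Qed.

End Coronas.

(** * Isomorphisms from zigzags *)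

Section IsoRelations.
Variable G : pzRingType.
Implicit Types (V W U : lmodType G).

Definition submod V (S : set V) :=
  S 0 /\ forall (a : G) x y, S x -> S y -> S (a *: x + y).

(* An isomorphism Z / B -> Z' / B' given by a relation between representatives;
   unlike a map, it can be read off from a zigzag of choices. *)
Definition iso_rel V W (Z B : set V) (Z' B' : set W) := exists rel : V -> W -> Prop,
  [/\ forall z w, rel z w -> [/\ Z z, Z' w & B z <-> B' w],
      forall (a : G) z w z1 w1, rel z w -> rel z1 w1 -> rel (a *: z + z1) (a *: w + w1),
      forall z, Z z -> exists w, rel z w & forall w, Z' w -> exists z, rel z w].

Lemma iso_rel_refl V (Z B : set V) : submod Z -> iso_rel Z B Z B.
Proof.
move=> [_ hZ]; exists (fun z w => Z z /\ z = w); split.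
- by move=> z w [Zz <-].
- by move=> a z _ z1 _ [Zz <-] [Zz1 <-]; split=> //; exact: hZ.
- by move=> z Zz; exists z.
- by move=> z Zz; exists z.
Qed.

Lemma iso_rel_sym V W (Z B : set V) (Z' B' : set W) : iso_rel Z B Z' B' -> iso_rel Z' B' Z B.
Proof.
move=> [rel [h1 h2 h3 h4]]; exists (fun w z => rel z w); split=> //.
  by move=> w z /h1[? ? [? ?]]; split.
by move=> a z w z1 w1 r r1; exact: h2.
Qed.

Lemma iso_rel_trans V W U (Z B : set V) (Z' B' : set W) (Z2 B2 : set U) :
  iso_rel Z B Z' B' -> iso_rel Z' B' Z2 B2 -> iso_rel Z B Z2 B2.
Proof.
move=> [r [h1 h2 h3 h4]] [s [k1 k2 k3 k4]].
exists (fun z u => exists2 w, r z w & s w u); split.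
- move=> z u [w /h1[Zz _ e] /k1[_ Zu e']]; split=> //.
  by split=> [/e/e'|/e'/e].
- move=> a z u z1 u1 [w r1 s1] [w1 r2 s2].
  by exists (a *: w + w1); [exact: h2|exact: k2].
- move=> z /h3[w rw]; have [_ Zw _] := h1 _ _ rw; have [u su] := k3 _ Zw.
  by exists u, w.
- move=> u /k4[w sw]; have [Zw _ _] := k1 _ _ sw; have [z rz] := h4 _ Zw.
  by exists z, w.
Qed.

Lemma submodB V (S : set V) x y : submod S -> S x -> S y -> S (x - y).
Proof. by move=> [_ h] Sx Sy; rewrite addrC -scaleN1r; exact: h. Qed.

Lemma submodD V (S : set V) x y : submod S -> S x -> S y -> S (x + y).
Proof. by move=> [_ h] Sx Sy; rewrite -[x]scale1r; exact: h. Qed.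

Lemma add_coset_eq V (S : set V) x y : submod S ->
  add_coset S x = add_coset S y <-> S (x - y).
Proof.
move=> hS; split=> [e|Sxy].
  have : add_coset S y x by rewrite -e; exists 0; [case: hS|rewrite addr0].
  by move=> [s Ss <-]; rewrite addrC addKr.
apply/seteqP; split=> _ [s Ss <-].
  by exists (x - y + s); [exact: submodD|rewrite addrA [y + _]addrC subrK].
exists (s - (x - y)); first exact: submodB.
by rewrite opprB addrCA [x + _]addrC subrK addrC.
Qed.

Lemma iso_rel_quotient V W (Z B : set V) (Z' B' : set W) :
  submod Z -> submod B -> submod B' -> iso_rel Z B Z' B' -> quotient_iso Z B Z' B'.
Proof.
move=> sZ sB sB' [r [h1 h2 h3 h4]].
have rB z w z1 w1 : r z w -> r z1 w1 -> r (z - z1) (w - w1).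
  by move=> ra rb; have := h2 (-1) _ _ _ _ rb ra; rewrite !scaleN1r ![- _ + _]addrC.
(* Defined without choice as the union of all classes related to [X], which turn out to be one
   class. *)
pose F (X : set V) : set W :=
  [set w | exists z w0, [/\ X = add_coset B z, r z w0 & add_coset B' w0 w]].
have FE z w : r z w -> F (add_coset B z) = add_coset B' w.
  move=> rzw; apply/seteqP; split=> [w' [z1 [w1 [e r1 h]]]|w' h]; last by exists z, w.
  suff -> : add_coset B' w = add_coset B' w1 by [].
  apply/add_coset_eq => //; have [_ _ <-] := h1 _ _ (rB _ _ _ _ rzw r1).
  exact/add_coset_eq.
exists F; last first.
  move=> a z1 z2 w1 w2 Zz1 Zz2 Zw1 Zw2 e1 e2.
  have [v1 r1] := h3 _ Zz1; have [v2 r2] := h3 _ Zz2.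
  rewrite (FE _ _ (h2 a _ _ _ _ r1 r2)); apply/add_coset_eq => //.
  move: e1 e2; rewrite (FE _ _ r1) (FE _ _ r2) => /(add_coset_eq _ _ sB') b1 /(add_coset_eq _ _ sB') b2.
  have -> : a *: v1 + v2 - (a *: w1 + w2) = a *: (v1 - w1) + (v2 - w2).
    by rewrite scalerBr opprD addrACA.
  by case: sB' => _ hs; exact: hs.
split.
- move=> _ [z Zz <-]; have [w rzw] := h3 _ Zz; exists w; first by case: (h1 _ _ rzw).
  by rewrite (FE _ _ rzw).
- move=> X Y /set_mem[z Zz <-] /set_mem[z1 Zz1 <-]; have [w rw] := h3 _ Zz; have [w1 rw1] := h3 _ Zz1.
  rewrite (FE _ _ rw) (FE _ _ rw1) => /(add_coset_eq _ _ sB') bw; apply/add_coset_eq => //.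
  by have [_ _ ->] := h1 _ _ (rB _ _ _ _ rw rw1).
- move=> _ [w Zw <-]; have [z rzw] := h4 _ Zw; exists (add_coset B z).
    by exists z => //; case: (h1 _ _ rzw).
  exact: FE.
Qed.

End IsoRelations.

(** * The zigzag in a double complex *)

Section Zigzag.
Variables (G : pzRingType) (V : lmodType G) (D : nat -> nat -> set V) (dh dv : V -> V) (d : nat).
Hypothesis D_submod : forall p q, submod (D p q).
Hypothesis dh_lin : forall (a : G) x y, dh (a *: x + y) = a *: dh x + dh y.
Hypothesis dv_lin : forall (a : G) x y, dv (a *: x + y) = a *: dv x + dv y.
Hypothesis dhD : forall p q x, D p q x -> D p.+1 q (dh x).
Hypothesis dvD : forall p q x, D p q.+1 x -> D p q (dv x).
Hypothesis dh_dh : forall p q x, D p q x -> dh (dh x) = 0.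
Hypothesis dv_dv : forall p q x, D p q x -> dv (dv x) = 0.
Hypothesis dh_dv : forall p q x, D p q x -> dh (dv x) = dv (dh x).
Hypothesis row_exact : forall p q x, D p.+1 q x -> dh x = 0 -> exists2 y, D p q y & dh y = x.
Hypothesis col_exact : forall p q x, (q < d)%N -> D p q x -> dv x = 0 ->
  exists2 y, D p q.+1 y & dv y = x.

Variable m : nat.

Definition bicycles j : set V := [set x | [/\ D j (j + m) x, dh x = 0 & dv x = 0]].

(** The boundaries come from the column for [j = 0] and from the row otherwise; as long as
    [j + m < d], [bibounds_col] gives all of them the column form. *)
Definition bibounds j : set V :=
  match j with
  | 0 => [set dv x | x in [set x | D 0 m.+1 x /\ dh x = 0]]
  | i.+1 => [set dh x | x in [set x | D i (i.+1 + m) x /\ dv x = 0]]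
  end.

Let dh0 : dh 0 = 0.
Proof. by have := dh_lin (-1) 0 0; rewrite scaler0 addr0 scaleN1r addNr. Qed.

Let dv0 : dv 0 = 0.
Proof. by have := dv_lin (-1) 0 0; rewrite scaler0 addr0 scaleN1r addNr. Qed.

Let dhB x y : dh (x - y) = dh x - dh y.
Proof. by rewrite addrC -[- y]scaleN1r dh_lin scaleN1r addrC. Qed.

Let dvB x y : dv (x - y) = dv x - dv y.
Proof. by rewrite addrC -[- y]scaleN1r dv_lin scaleN1r addrC. Qed.

Lemma bicycles_submod j : submod (bicycles j).
Proof.
have [D0 hD] := D_submod j (j + m); split; first by split.
move=> a x y [Dx hx vx] [Dy hy vy]; split; first exact: hD.
  by rewrite dh_lin hx hy scaler0 addr0.
by rewrite dv_lin vx vy scaler0 addr0.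
Qed.

(** If [dv y = 0], write [y = dv z]; then [dh y] is also the image of [dh z] under [dv]. The
    converse exchanges rows and columns. *)
Let bibounds_col j x : (j + m < d)%N ->
  bibounds j x <-> exists2 y, D j (j + m).+1 y & dv y = x /\ dh y = 0.
Proof.
case: j => [|j] jm; first by split=> [[y [Dy hy] <-]|[y Dy [<- hy]]]; exists y.
split=> [[y [Dy vy] <-]|[y Dy [<- hy]]].
  have [z Dz zy] := col_exact jm Dy vy; exists (dh z); first exact: dhD.
  by rewrite -(dh_dv Dz) zy (dh_dh Dz).
have [z Dz zy] := row_exact Dy hy; exists (dv z); last by rewrite (dh_dv Dz) zy.
by split; [exact: dvD|exact: (dv_dv Dz)].
Qed.

(** [x = dv y] and [x' = dh y] for a common [y], which exactness provides from either end; changing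
    [y] by an element killed by one differential changes the other image by a boundary. *)
Let zigzag_step j : (j + m < d)%N ->
  iso_rel (bicycles j) (bibounds j) (bicycles j.+1) (bibounds j.+1).
Proof.
move=> jm; have [_ hD] := D_submod j (j + m).+1.
exists (fun x x' => [/\ bicycles j x, bicycles j.+1 x' &
  exists2 y, D j (j + m).+1 y & dv y = x /\ dh y = x']); split.
- move=> x x' [Zx Zx' [y Dy [yx yx']]]; split=> //; rewrite bibounds_col //; split.
    move=> [z Dz [zx hz]]; exists (y - z); last by rewrite dhB hz subr0.
    by split; [exact: submodB|rewrite dvB yx zx subrr].
  move=> [z [Dz vz] zx]; exists (y - z); first exact: submodB.
  by rewrite dvB dhB vz zx yx' subrr subr0.
- move=> a x x' x1 x1' [Zx Zx' [y Dy [yx yx']]] [Zx1 Zx1' [y1 Dy1 [yx1 yx1']]].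
  split; [exact: (bicycles_submod j).2|exact: (bicycles_submod j.+1).2|].
  by exists (a *: y + y1); [exact: hD|rewrite dh_lin dv_lin yx yx1 yx' yx1'].
- move=> x Zx; have [Dx hx vx] := Zx; have [y Dy yx] := col_exact jm Dx vx.
  exists (dh y); split=> //; last by exists y.
  by split; [exact: dhD|exact: (dh_dh Dy)|rewrite -(dh_dv Dy) yx].
- move=> x Zx; have [Dx hx vx] := Zx; have [y Dy yx] := row_exact Dx hx.
  exists (dv y); split=> //; last by exists y.
  by split; [exact: dvD|rewrite (dh_dv Dy) yx|exact: (dv_dv Dy)].
Qed.

Lemma zigzag n : (n + m <= d)%N ->
  iso_rel (bicycles 0) (bibounds 0) (bicycles n) (bibounds n).
Proof.
elim: n => [|n IH] nm; first by apply: iso_rel_refl; exact: bicycles_submod.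
by apply: iso_rel_trans (IH (ltnW nm)) (zigzag_step nm).
Qed.

End Zigzag.

(** * Averaging over isotropy *)

Section Averaging.
Variables (R : realType) (d : nat) (L : Type) (T : polytopal_tiling R d L).
Local Notation E := 'rV[R]_d.
Implicit Types (x y c : set E) (f g : E -> E) (i j : nat).

(** Remove the coset of the first element of [X] and recurse. Asking of [X] only stability under
    composition with [Y] makes the assumptions pass to the complement of a coset. *)
Lemma lagrange_seq (X Y : seq (E -> E)) : uniq X -> uniq Y ->
  {in X, forall f, injective f} -> id \in Y ->
  {in Y & Y, forall f g, f \o g \in Y} ->
  {in Y, forall f, exists2 g : E -> E, g \in Y & f \o g = id} ->
  {in X & Y, forall f g, f \o g \in X} -> (size Y %| size X)%N.
Proof.
move=> uX uY; elim: {X}(size X).+1 {-2}X (ltnSn (size X)) uX => // n IH X sX uX iX idY mY vY aX.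
case: X sX uX iX aX => [|f X0] sX uX iX aX; first by rewrite dvdn0.
set X := f :: X0 in sX uX iX aX *; have fX : f \in X by rewrite mem_head.
pose fY := [seq f \o g | g <- Y].
have ufY : uniq fY.
  rewrite map_inj_in_uniq // => g h _ _ e; apply/funext => z; apply: (iX _ fX).
  exact: (congr1 (fun k => k z) e).
have fYX : {subset fY <= X} by move=> _ /mapP[g gY ->]; exact: aX.
have sf : size (seq.filter (mem fY) X) = size Y.
  rewrite -[RHS](size_map (fun g => f \o g)); apply/perm_size/uniq_perm => //.
    exact: filter_uniq.
  by move=> z; rewrite mem_filter; apply: andb_idr => /fYX.
have e : size X = (size Y + size (seq.filter (predC (mem fY)) X))%N.
  by rewrite -sf !size_filter count_predC.
rewrite e dvdn_addr //; apply: IH => //.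
- have Y0 : (0 < size Y)%N by case: (Y) idY.
  by apply: leq_trans _ (sX : (size X <= n)%N); rewrite e -[X in (X < _)%N]add0n ltn_add2r.
- exact: filter_uniq.
- by move=> g; rewrite mem_filter => /andP[_]; exact: iX.
- move=> g h; rewrite !mem_filter => /andP[/= ng gX] hY; rewrite aX // andbT.
  apply/negP => /mapP[k kY ek]; case/negP: ng; have [h' h'Y hh'] := vY _ hY.
  apply/mapP; exists (k \o h'); first exact: mY.
  have -> : g = (g \o h) \o h' by rewrite -compA hh'.
  by rewrite ek.
Qed.

Lemma iso_seq c i : finite_set (Iso T c i) ->
  exists2 s : seq (E -> E), uniq s & (forall f, f \in s <-> maps_corona T f i c c) /\
    size s = iso_order T c i.
Proof.
move=> fI; exists (enum_fset (fset_set (Iso T c i))); first exact: fset_uniq.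
split=> // f; have e : (f \in enum_fset (fset_set (Iso T c i))) = (f \in Iso T c i).
  exact: (in_fset_set fI f).
by rewrite e in_setE.
Qed.

Lemma iso_order_dvd c i j : cells T c -> (i <= j)%N -> finite_set (Iso T c i) ->
  (iso_order T c j %| iso_order T c i)%N.
Proof.
move=> Cc ij fi; have sub : Iso T c j `<=` Iso T c i by move=> f; exact: maps_corona_le.
have fj := sub_finite_set sub fi.
have [X uX [XE <-]] := iso_seq fi; have [Y uY [YE <-]] := iso_seq fj.
apply: lagrange_seq => //.
- by move=> f /XE[mf _ _]; exact: can_inj (motionK mf).
- by apply/YE; exact: maps_corona_id.
- by move=> f g /YE hf /YE hg; apply/YE; exact: (maps_corona_comp hg hf).
- move=> f /YE hf; have [mf _ _] := hf; exists (motion_inv f); last exact/funext/motion_invK.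
  by apply/YE; exact: maps_corona_inv.
move=> f g /XE hf /YE /(maps_corona_le ij Cc Cc) hg.
by apply/XE; exact: (maps_corona_comp hg hf).
Qed.

Variables (G : pzRingType) (K : nat).
Hypothesis hdiv : forall c, cells T c -> division_by G (iso_order T c K).

(** The order at [K] is a multiple, by [q], of the order at [i], so [x * q%:R] inverts the latter if
    [x] inverts the former. *)
Lemma iso_invertible c i : cells T c -> (K <= i)%N -> (1 : G) <> 0 ->
  exists s : seq (E -> E), [/\ uniq s, (forall f, f \in s <-> maps_corona T f i c c) &
    exists a : G, forall v : G^o, a *: (v *+ size s) = v].
Proof.
move=> Cc Ki G0; have [x [xN _]] := hdiv Cc.
have fK : finite_set (Iso T c K).
  (* For an infinite group [iso_order] is 0, and division by 0 would give [1 = 0]. *)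
  apply: contrapT => nf; apply: G0; rewrite -xN /iso_order /fset_set.
  by case: pselect => // _; rewrite cardfs0 mulr0.
have [q e] := dvdnP (iso_order_dvd Cc Ki fK).
have fi := sub_finite_set (fun f => maps_corona_le Ki Cc Cc (f := f)) fK.
have [s us [sE ss]] := iso_seq fi; exists s; split=> //; exists (x * q%:R) => v.
by rewrite -scaler_nat scalerA -mulrA -natrM ss -e xN scale1r.
Qed.

(* The cells that look like [x] up to radius [i] share their representative. *)
Definition rep i x : set E :=
  xget set0 [set r | cells T r /\ exists f, maps_corona T f i x r].

Lemma repP i x : cells T x -> cells T (rep i x) /\ exists f, maps_corona T f i x (rep i x).
Proof.
move=> Cx; rewrite /rep; case: xgetP => [r _ //|H].
by case: (H x); split=> //; exists id; exact: maps_corona_id.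
Qed.

Lemma rep_eq i x x' f : maps_corona T f i x x' -> rep i x = rep i x'.
Proof.
move=> h; rewrite /rep; congr (xget _ _); apply/seteqP; split=> r [Cr [g hg]]; split=> //.
  exists (g \o motion_inv f); exact: (maps_corona_comp (maps_corona_inv h) hg).
by exists (g \o f); exact: (maps_corona_comp h hg).
Qed.

(** Values refer to the reference orientations of both cells, hence the two signs. [A x] will be the
    list of faces or the star of [x]. *)
Definition equivariant i (phi : set E -> set E -> G^o) (A : set E -> seq (set E)) :=
  forall f x x' y, cells T x -> cells T x' -> maps_corona T f i x x' -> y \in A x ->
    phi x y = phi x' (f @` y) *~ (sgnf f x * sgnf f y).

(** * Equivariant solutions of cellwise linear equations *)

Section Average.
Variables (A : set E -> seq (set E)) (kappa : set E -> set E -> int).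
Hypothesis uA : forall x, cells T x -> uniq (A x).
Hypothesis AC : forall x y, cells T x -> y \in A x -> cells T y.
Hypothesis Amap : forall i f x x' y, cells T x -> cells T x' ->
  maps_corona T f i.+1 x x' -> y \in A x -> f @` y \in A x'.
Hypothesis kappa_map : forall i f x x' y y', cells T x -> cells T x' ->
  maps_corona T f i.+1 x x' -> y \in A x -> y' \in A x ->
  kappa (f @` y) (f @` y') = sgnf f y * sgnf f y' * kappa y y'.

Let A_reindex (V : nmodType) i f x x' (F : set E -> V) : cells T x -> cells T x' ->
  maps_corona T f i.+1 x x' -> \sum_(y <- A x') F y = \sum_(y <- A x) F (f @` y).
Proof.
move=> Cx Cx' h; have [mf _ _] := h; rewrite -[RHS](big_map (fun y => f @` y) predT).
apply/perm_big/uniq_perm => [||y]; first exact: uA.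
  by rewrite map_inj_uniq ?uA // => y z e; rewrite -(image_motionK mf y) e image_motionK.
apply/idP/mapP => [yA|[z zA ->]]; last exact: (Amap Cx Cx' h).
exists (motion_inv f @` y); last by rewrite image_motion_invK.
exact: (Amap Cx' Cx (maps_corona_inv h)).
Qed.

(** The solution at the representative is pulled back along all motions from [x] to it, and these
    are averaged. Each pullback is a solution since [kappa] and [phi] are equivariant, and
    composition with a motion from [x] to [x'] permutes the motions, so the average is
    equivariant. *)
Lemma average i (phi : set E -> set E -> G^o) : (K <= i.+1)%N -> equivariant i.+1 phi A ->
  (forall x, cells T x -> exists psi : set E -> G^o, forall y, y \in A x ->
    phi x y = \sum_(y' <- A x) psi y' *~ kappa y y') ->
  exists2 psi, equivariant i.+1 psi A & forall x y, cells T x -> y \in A x ->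
    phi x y = \sum_(y' <- A x) psi x y' *~ kappa y y'.
Proof.
move=> Ki ephi sol.
(* In the zero ring all equations hold; division by 0 is then possible and the groups may be
   infinite. *)
have [G0|G1] := eqVneq (1 : G) 0.
  have G0' (a b : G^o) : a = b by rewrite -[a]scale1r -[b]scale1r G0 !scale0r.
  by exists (fun _ _ => 0) => [f x x' y|x y] *; exact: (G0' _ _).
have /cid[psi0 hpsi0] : exists psi0 : set E -> set E -> G^o, forall x y, cells T x ->
    y \in A x -> phi x y = \sum_(y' <- A x) psi0 x y' *~ kappa y y'.
  suff /choice[psi0 h] : forall x, exists psi : set E -> G^o, forall y, cells T x -> y \in A x ->
      phi x y = \sum_(y' <- A x) psi y' *~ kappa y y' by exists psi0.
  move=> x; have [/sol[psi h]|nC] := pselect (cells T x); first by exists psi => y _; exact: h.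
  by exists (fun=> 0).
(* [mor x] lists the motions from [x] to its representative, as the isotropy of the representative
   composed with one of them, together with a scalar that undoes multiplication by their number. *)
have /choice[mor hmor] : forall x, exists sa : seq (E -> E) * G, cells T x ->
    [/\ uniq sa.1, (forall f, f \in sa.1 <-> maps_corona T f i.+1 x (rep i.+1 x)) &
        forall v : G^o, sa.2 *: (v *+ size sa.1) = v].
  move=> x; have [Cx|nC] := pselect (cells T x); last by exists ([::], 0).
  have [Cr [g hg]] := repP i.+1 Cx; have [mg _ _] := hg.
  have [s [us sE [a ha]]] := iso_invertible Cr Ki (fun e => elimN eqP G1 e).
  exists ([seq k \o g | k <- s], a) => _ /=; split; last by move=> v; rewrite size_map.
    rewrite map_inj_uniq // => k k' e; apply/funext => z.
    by rewrite -(motion_invK mg z); exact: (congr1 (fun k => k (motion_inv g z)) e).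
  move=> f; split=> [/mapP[k /sE hk ->]|hf]; first exact: (maps_corona_comp hg hk).
  apply/mapP; exists (f \o motion_inv g).
    by apply/sE; exact: (maps_corona_comp (maps_corona_inv hg) hf).
  by apply/funext => z /=; rewrite motionK.
pose psi x y : G^o := (mor x).2 *:
  \sum_(g <- (mor x).1) psi0 (rep i.+1 x) (g @` y) *~ (sgnf g x * sgnf g y).
have a_eq x x' f : cells T x -> cells T x' -> maps_corona T f i.+1 x x' ->
    perm_eq (mor x).1 [seq g \o f | g <- (mor x').1].
  move=> Cx Cx' h; have [mf _ _] := h.
  have [u m _] := hmor x Cx; have [u' m' _] := hmor x' Cx'; apply: uniq_perm => //.
    rewrite map_inj_uniq // => k k' e; apply/funext => z.
    by rewrite -(motion_invK mf z); exact: (congr1 (fun k => k (motion_inv f z)) e).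
  move=> g; apply/idP/mapP => [/m hg|[k /m' hk ->]]; last first.
    by apply/m; rewrite (rep_eq h); exact: (maps_corona_comp h hk).
  exists (g \o motion_inv f); last by apply/funext => z /=; rewrite motionK.
  by apply/m'; rewrite -(rep_eq h); exact: (maps_corona_comp (maps_corona_inv h) hg).
exists psi.
  move=> f x x' y Cx Cx' h yA; have [mf fx _] := h; have Cy := AC Cx yA.
  have [u m a] := hmor x Cx; have [u' m' a'] := hmor x' Cx'; have pe := a_eq _ _ _ Cx Cx' h.
  rewrite /psi; set S := \sum_(g <- _) _; set S' := \sum_(g <- _) _.
  have e : S = S' *~ (sgnf f x * sgnf f y).
    rewrite /S (perm_big _ pe) /= big_map /S' mulrz_suml; apply: eq_big_seq => g /m' [mg _ _].
    rewrite (sgnf_comp mf mg (cell0 Cx)) (sgnf_comp mf mg (cell0 Cy)) fx -(rep_eq h).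
    by rewrite -[(g \o f) @` y]image_comp -mulrzA; congr (_ *~ _); ring.
  have ss : size (mor x).1 = size (mor x').1 by rewrite (perm_size pe) size_map.
  (* Both scalars undo multiplication by the same number of motions. *)
  have av (v : G^o) : (mor x).2 *: v = (mor x').2 *: v.
    by rewrite -[v in LHS]a' -scalerMnr -ss a.
  by rewrite e av scalerMzr.
move=> x y Cx yA; have [u m a] := hmor x Cx; have [Cr _] := repP i.+1 Cx.
have -> : \sum_(y' <- A x) psi x y' *~ kappa y y' = (mor x).2 *:
    \sum_(g <- (mor x).1) \sum_(y' <- A x)
      psi0 (rep i.+1 x) (g @` y') *~ (sgnf g x * sgnf g y') *~ kappa y y'.
  rewrite exchange_big scaler_sumr; apply: eq_bigr => y' _.
  by rewrite /psi scalerMzr mulrz_suml.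
rewrite -[LHS]a; congr (_ *: _).
rewrite (eq_big_seq (fun=> phi x y)) => [|g /m hg].
  by rewrite big_const_seq count_predT iter_addr_0.
have [mg _ _] := hg; have Cy := AC Cx yA.
rewrite (ephi _ _ _ _ Cx Cr hg yA) hpsi0 //; last exact: (Amap Cx Cr hg).
rewrite (A_reindex _ Cx Cr hg) mulrz_suml; apply: eq_big_seq => y' y'A.
rewrite (kappa_map Cx Cr hg) // -!mulrzA; congr (_ *~ _).
by rewrite -[LHS]mulr1 -(sgnf_sq mg y); ring.
Qed.

Lemma equivariant_le i j phi : (i <= j)%N -> equivariant i phi A -> equivariant j phi A.
Proof.
by move=> ij e f x x' y Cx Cx' h; apply: (e) => //; exact: (maps_corona_le ij Cx Cx' h).
Qed.

Lemma equivariant_sum i phi : equivariant i.+1 phi A ->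
  equivariant i.+1 (fun x y => \sum_(y' <- A x) phi x y' *~ kappa y y') A.
Proof.
move=> e f x x' y Cx Cx' h yA; have [mf _ _] := h.
rewrite (A_reindex _ Cx Cx' h) mulrz_suml; apply: eq_big_seq => y' y'A.
rewrite (e _ _ _ _ Cx Cx' h y'A) (kappa_map Cx Cx' h) // -!mulrzA; congr (_ *~ _).
by rewrite -[LHS]mulr1 -(sgnf_sq mf y); ring.
Qed.

Definition graded (p q : nat) (phi : set E -> set E -> G^o) :=
  (forall x y, phi x y <> 0 -> [/\ cells T x, y \in A x, rk x = p & rk y = q]) /\
  exists i, equivariant i phi A.

Definition differential (phi : set E -> set E -> G^o) x y : G^o :=
  if `[< cells T x /\ y \in A x >] then \sum_(y' <- A x) phi x y' *~ kappa y y' else 0.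

Lemma differentialE phi x y : cells T x -> y \in A x ->
  differential phi x y = \sum_(y' <- A x) phi x y' *~ kappa y y'.
Proof. by move=> Cx yA; rewrite /differential asboolT. Qed.

Lemma restriction_graded (p q : nat) i phi : equivariant i.+1 phi A ->
  graded p q (fun x y => if `[< [/\ cells T x, y \in A x, rk x = p & rk y = q] >] then phi x y else 0).
Proof.
move=> e; split=> [x y|]; first by case: asboolP.
exists i.+1 => f x x' y Cx Cx' h yA; have [mf fx _] := h; have yA' := Amap Cx Cx' h yA.
have -> : `[< [/\ cells T x', f @` y \in A x', rk x' = p & rk (f @` y) = q] >] =
    `[< [/\ cells T x, y \in A x, rk x = p & rk y = q] >].
  apply/asbool_equiv_eq; rewrite -fx (rk_motion mf (cell0 Cx)) (rk_motion mf (cell0 (AC Cx yA))).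
  by rewrite fx; split=> -[].
by case: asboolP => _; [exact: (e _ _ _ _ Cx Cx' h yA)|rewrite mul0rz].
Qed.

Lemma graded_submod (p q : nat) : submod (graded p q).
Proof.
split=> [|a phi psi [sp [i ep]] [sq [j eq]]].
  by split=> [x y //|]; exists 0%N => f x x' y *; rewrite mul0rz.
split=> [x y|].
  rewrite -[_ x y]/(a *: phi x y + psi x y) => n.
  have [e|/eqP/sp //] := eqVneq (phi x y) 0; have [e'|/eqP/sq //] := eqVneq (psi x y) 0.
  by case: n; rewrite e e' scaler0 addr0.
exists (maxn i j) => f x x' y Cx Cx' h yA.
have e1 := equivariant_le (leq_maxl i j) ep Cx Cx' h yA.
have e2 := equivariant_le (leq_maxr i j) eq Cx Cx' h yA.
rewrite -[LHS]/(a *: phi x y + psi x y) e1 e2.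
rewrite -[RHS]/((a *: phi x' (f @` y) + psi x' (f @` y)) *~ (sgnf f x * sgnf f y)).
by rewrite mulrzDl scalerMzr.
Qed.

Variables (p1 p2 p3 : nat).
Hypothesis kappa_graded : forall y y', kappa y y' != 0 -> (rk y == p3) = (rk y' == p2).

Lemma differential_graded phi : graded p1 p2 phi -> graded p1 p3 (differential phi).
Proof.
move=> [sp [i ep]]; split=> [x y|].
  rewrite /differential; case: asboolP => // -[Cx yA] n.
  have [y' [y'A ny']] : exists y', y' \in A x /\ phi x y' *~ kappa y y' <> 0.
    apply: contrapT => H; apply: n; rewrite big1_seq // => y' /andP[_ y'A].
    by apply: contrapT => ny'; apply: H; exists y'.
  have [k0|k0] := eqVneq (kappa y y') 0; first by case: ny'; rewrite k0.
  have [|_ _ k1 k2] := sp x y'; first by move=> e; case: ny'; rewrite e mul0rz.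
  by split=> //; apply/eqP; rewrite (kappa_graded k0) k2.
exists i.+1 => f x x' y Cx Cx' h yA.
rewrite !differentialE //; last exact: (Amap Cx Cx' h).
exact: (equivariant_sum (equivariant_le (leqnSn i) ep) Cx Cx' h yA).
Qed.

(** [kappa] links degree [p3] to degree [p2] only, so in all other degrees both sides vanish and a
    cellwise solution in degree [p3] is enough. The radius is raised to at least [K] to allow
    averaging. *)
Lemma differential_exact phi : graded p1 p3 phi ->
  (forall x, cells T x -> exists psi : set E -> G^o, forall y, y \in A x -> rk y = p3 ->
    phi x y = \sum_(y' <- A x) psi y' *~ kappa y y') ->
  exists2 psi, graded p1 p2 psi & differential psi = phi.
Proof.
move=> [sp [i ep]] sol.
have [||x Cx|psi epsi hpsi] := @average (maxn i K) phi.
- by rewrite leqW // leq_maxr.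
- by apply: equivariant_le ep; rewrite leqW // leq_maxl.
- have [psi hpsi] := sol x Cx; exists (fun y => if rk y == p2 then psi y else 0) => y yA.
  have [k|k] := eqVneq (rk y) p3; last first.
    have -> : phi x y = 0 by apply: contrapT => /sp[_ _ _ /eqP]; rewrite (negbTE k).
    apply/esym; rewrite big1 // => y' _; have [->|/kappa_graded] := eqVneq (kappa y y') 0; first by [].
    by rewrite (negbTE k) => <-; rewrite mul0rz.
  rewrite hpsi //; apply: eq_bigr => y' _.
  have [->|/kappa_graded] := eqVneq (kappa y y') 0; first by [].
  by rewrite k eqxx => <-.
exists (fun x y => if `[< [/\ cells T x, y \in A x, rk x = p1 & rk y = p2] >] then psi x y else 0).
  exact: restriction_graded epsi.
apply/funext => x; apply/funext => y; rewrite /differential; case: asboolP => [[Cx yA]|H]; last first.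
  by apply: contrapT => n; apply: H; have [] := sp x y (fun e => n (esym e)).
have [k1|k1] := eqVneq (rk x) p1; last first.
  rewrite big1 => [|y' _]; first by apply: contrapT => n; have [_ _ /eqP] := sp x y (fun e => n (esym e)); rewrite (negbTE k1).
  by rewrite asboolF ?mul0rz // => -[_ _ /eqP]; rewrite (negbTE k1).
have [k3|k3] := eqVneq (rk y) p3; last first.
  rewrite big1 => [|y' _].
    by apply: contrapT => n; have [_ _ _ /eqP] := sp x y (fun e => n (esym e)); rewrite (negbTE k3).
  have [->|/kappa_graded] := eqVneq (kappa y y') 0; first by [].
  by rewrite (negbTE k3) => /esym k; rewrite asboolF ?mul0rz // => -[_ _ _ /eqP]; rewrite k.
rewrite hpsi //; apply: eq_big_seq => y' y'A.
have [->|/kappa_graded] := eqVneq (kappa y y') 0; first by [].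
by rewrite k3 eqxx => /esym/eqP k; rewrite asboolT.
Qed.

End Average.

Definition graded1 (p : nat) (h : set E -> G^o) :=
  (forall x, h x <> 0 -> cells T x /\ rk x = p) /\
  exists i, forall f x x', cells T x -> cells T x' -> maps_corona T f i x x' ->
    h x = h x' *~ sgnf f x.

(** * Functions constant on tiles or on vertices *)

Section Extension.
Variables (A : set E -> seq (set E)) (e : nat).
Hypothesis AC : forall x y, cells T x -> y \in A x -> cells T y.
Hypothesis Amap : forall i f x x' y, cells T x -> cells T x' ->
  maps_corona T f i.+1 x x' -> y \in A x -> f @` y \in A x'.
Hypothesis A_extreme : forall x, cells T x -> exists2 y, y \in A x & rk y = e.
Hypothesis sgnf_extreme : forall f y, rigid_motion f -> rk y = e -> sgnf f y = 1.

(** [A] is the star with [e = d], or the faces with [e = 0]. Rigid motions have sign 1 on tiles and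
    on vertices, so [h] can be spread over them equivariantly. *)
Definition extension (h : set E -> G^o) x y : G^o :=
  if `[< [/\ cells T x, y \in A x & rk y = e] >] then h x else 0.

Lemma extension_graded (p : nat) h : graded1 p h -> graded A p e (extension h).
Proof.
move=> [sh [i eh]]; split=> [x y|].
  by rewrite /extension; case: asboolP => // -[Cx yA k] /sh[].
exists i.+1 => f x x' y Cx Cx' hf yA; have [mf fx _] := hf; have yA' := Amap Cx Cx' hf yA.
have ky := rk_motion mf (cell0 (AC Cx yA)).
rewrite /extension; have [k|k] := eqVneq (rk y) e; last first.
  by rewrite !asboolF ?mul0rz // => -[_ _ /eqP]; rewrite ?ky (negbTE k).
rewrite !asboolT ?ky // (sgnf_extreme mf k) mulr1; apply: eh => //.
exact: (maps_corona_le (leqnSn i) Cx Cx' hf).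
Qed.

Lemma extension_inj h h' : (forall x, h x <> 0 -> cells T x) ->
  (forall x, h' x <> 0 -> cells T x) -> extension h = extension h' -> h = h'.
Proof.
move=> sh sh' hh; apply/funext => x; have [Cx|nC] := pselect (cells T x).
  have [y yA k] := A_extreme Cx; have := congr1 (fun phi => phi x y) hh.
  by rewrite /extension asboolT.
transitivity (0 : G^o); first by apply: contrapT => /sh.
by apply/esym; apply: contrapT => /sh'.
Qed.

Lemma extension_onto (p : nat) phi : graded A p e phi ->
  (forall x, cells T x -> exists m : G^o, forall y, y \in A x -> rk y = e -> phi x y = m) ->
  exists2 h, graded1 p h & extension h = phi.
Proof.
move=> [sp [i ep]] const.
have /choice[h hh] : forall x, exists m : G^o,
    (cells T x -> forall y, y \in A x -> rk y = e -> phi x y = m) /\ (~ cells T x -> m = 0).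
  move=> x; have [Cx|nC] := pselect (cells T x); last by exists 0.
  by have [m hm] := const x Cx; exists m.
exists h.
  split=> [x n|].
    have [Cx|nC] := pselect (cells T x); last by case: n; exact: (hh x).2.
    have [y yA k] := A_extreme Cx; split=> //.
    by have [] := sp x y; rewrite ?((hh x).1 Cx y yA k).
  exists i.+1 => f x x' Cx Cx' hf; have [mf _ _] := hf; have [y yA k] := A_extreme Cx.
  rewrite -((hh x).1 Cx y yA k) -((hh x').1 Cx' (f @` y) (Amap Cx Cx' hf yA)); last first.
    by rewrite (rk_motion mf (cell0 (AC Cx yA))).
  rewrite (ep _ _ _ _ Cx Cx' (maps_corona_le (leqnSn i) Cx Cx' hf) yA).
  by rewrite (sgnf_extreme mf k) mulr1.
apply/funext => x; apply/funext => y; rewrite /extension; case: asboolP => [[Cx yA k]|H].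
  exact/esym/((hh x).1).
by apply/esym; apply: contrapT => /sp[Cx yA _ k]; apply: H.
Qed.

End Extension.
End Averaging.

(** * The double complex of incident pairs of cells *)

Section DoubleComplex.
Variables (R : realType) (d : nat) (L : Type) (T : polytopal_tiling R d L).
Variables (G : pzRingType) (K : nat).
Hypothesis hdiv : forall c, cells T c -> division_by G (iso_order T c K).
Local Notation E := 'rV[R]_d.
Local Notation V := (set E -> set E -> G^o).
Implicit Types (b c x y : set E) (phi psi : V) (i j p q : nat).

Let hC := cells_CW T.

Definition faces c : seq (set E) :=
  xget [::] [set s | uniq s /\ forall b, b \in s <-> cells T b /\ b `<=` c].

Definition star b : seq (set E) :=
  xget [::] [set s | uniq s /\ forall c, c \in s <-> cells T c /\ b `<=` c].

Lemma facesP c : cells T c -> uniq (faces c) /\ forall b, b \in faces c <-> cells T b /\ b `<=` c.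
Proof.
move=> Cc; have [s us sE] := cell_faces hC Cc.
by rewrite /faces; case: xgetP => [r _ //|/(_ s)[]].
Qed.

Lemma starP b : cells T b -> uniq (star b) /\ forall c, c \in star b <-> cells T c /\ b `<=` c.
Proof.
move=> Cb; have [s us sE] := cell_star hC Cb.
by rewrite /star; case: xgetP => [r _ //|/(_ s)[]].
Qed.

Lemma mem_faces b c : cells T c -> (b \in faces c) <-> cells T b /\ b `<=` c.
Proof. by move=> /facesP[_ ->]. Qed.

Lemma mem_star b c : cells T b -> (c \in star b) <-> cells T c /\ b `<=` c.
Proof. by move=> /starP[_ ->]. Qed.

Let uF c (Cc : cells T c) := (facesP Cc).1.
Let uS b (Cb : cells T b) := (starP Cb).1.

Let FC c b : cells T c -> b \in faces c -> cells T b.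
Proof. by move=> Cc /(mem_faces _ Cc)[]. Qed.

Let SC b c : cells T b -> c \in star b -> cells T c.
Proof. by move=> Cb /(mem_star _ Cb)[]. Qed.

Let meet b c : cells T b -> b `<=` c -> b `&` c !=set0.
Proof. by move=> Cb bc; have [z bz] := cell0 Cb; exists z; split=> //; exact: bc. Qed.

Let Fmap i f c c' b : cells T c -> cells T c' ->
  maps_corona T f i.+1 c c' -> b \in faces c -> f @` b \in faces c'.
Proof.
move=> Cc Cc' h /(mem_faces _ Cc)[Cb bc]; have [_ <- _] := h.
have [Cfb _] := maps_corona_restrict Cc Cc' Cb h (meet Cb bc).
by have [_ fc _] := h; rewrite fc; apply/mem_faces => //; split=> //; rewrite -fc; apply: image_subset.
Qed.

Let Smap i f b b' c : cells T b -> cells T b' ->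
  maps_corona T f i.+1 b b' -> c \in star b -> f @` c \in star b'.
Proof.
move=> Cb Cb' h /(mem_star _ Cb)[Cc bc]; have [_ fb _] := h.
have [|Cfc _] := maps_corona_restrict Cb Cb' Cc h; first by rewrite setIC; exact: meet.
by apply/mem_star => //; split=> //; rewrite -fb; apply: image_subset.
Qed.

Let F_eps i f x x' y y' : cells T x -> cells T x' ->
  maps_corona T f i.+1 x x' -> y \in faces x -> y' \in faces x ->
  eps (f @` y) (f @` y') = sgnf f y * sgnf f y' * eps y y'.
Proof.
move=> Cx Cx' h yx y'x; have [mf _ _] := h.
have fx z : z \in faces x -> cells T (f @` z).
  by move=> /(Fmap Cx Cx' h); exact: FC.
by apply: (eps_motion hC mf); [exact: FC yx|exact: FC y'x|exact: fx|exact: fx].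
Qed.

Let S_eps i f x x' y y' : cells T x -> cells T x' ->
  maps_corona T f i.+1 x x' -> y \in star x -> y' \in star x ->
  eps (f @` y') (f @` y) = sgnf f y * sgnf f y' * eps y' y.
Proof.
move=> Cx Cx' h yx y'x; have [mf _ _] := h; rewrite [sgnf f y * _]mulrC.
have fx z : z \in star x -> cells T (f @` z).
  by move=> /(Smap Cx Cx' h); exact: SC.
by apply: (eps_motion hC mf); [exact: SC y'x|exact: SC yx|exact: fx|exact: fx].
Qed.

Definition swap phi : V := fun c b => phi b c.

(** Ranging over the faces of [c] keeps [c] fixed while [b] varies, the form needed for averaging;
    [dhE] reduces the sum to the faces of [b], outside which [eps] vanishes. *)
Definition dh phi : V := swap (differential T faces (@eps R d) (swap phi)).
Definition dv phi : V := differential T star (fun c c' => eps c' c) phi.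
(** Equivariance is measured on coronas of the smaller cell; by [pairs_swap] those of the larger
    cell give the same functions, up to the radius. *)
Definition pairs p q : set V := graded T star p q.

Let S_to_F i phi : equivariant T i phi star -> equivariant T i.+1 (swap phi) faces.
Proof.
move=> e f c c' b Cc Cc' h /(mem_faces _ Cc)[Cb bc]; have [_ fc _] := h.
have [Cfb hb] := maps_corona_restrict Cc Cc' Cb h (meet Cb bc).
rewrite /swap (e f b (f @` b) c) //; last exact/mem_star.
by rewrite fc mulrC.
Qed.

Let F_to_S i phi : equivariant T i (swap phi) faces -> equivariant T i.+1 phi star.
Proof.
move=> e f b b' c Cb Cb' h /(mem_star _ Cb)[Cc bc]; have [_ fb _] := h.
have [|Cfc hc] := maps_corona_restrict Cb Cb' Cc h; first by rewrite setIC; exact: meet.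
rewrite -[phi b c]/(swap phi c b) (e f c (f @` c) b) //; last exact/mem_faces.
by rewrite /swap fb mulrC.
Qed.

Lemma pairs_swap p q phi : pairs p q phi <-> graded T faces q p (swap phi).
Proof.
split=> -[sp [i e]]; split.
- by move=> c b /sp[Cb /(mem_star _ Cb)[Cc bc] kb kc]; split=> //; apply/mem_faces.
- by exists i.+1; exact: S_to_F.
- by move=> b c /(sp c b)[Cc /(mem_faces _ Cc)[Cb bc] kb kc]; split=> //; apply/mem_star.
- by exists i.+1; exact: F_to_S.
Qed.

Lemma faces_sum (h : set E -> G^o) b c : cells T b -> cells T c -> b `<=` c ->
  \sum_(e <- faces c) h e *~ eps b e = \sum_(e <- faces b) h e *~ eps b e.
Proof.
move=> Cb Cc bc; apply: big_supp_eq => [||e ec eb|e eb ec]; [exact: uF|exact: uF| |].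
  have [->|/eps_neq0[be _]] := eqVneq (eps b e) 0; first by rewrite mulr0z.
  by case/negP: eb; apply/mem_faces => //; split=> //; exact: FC ec.
case/negP: ec; move/(mem_faces _ Cb): eb => [Ce be].
by apply/mem_faces => //; split=> // z /be/bc.
Qed.

Lemma star_sum (h : set E -> G^o) b c : cells T b -> cells T c -> b `<=` c ->
  \sum_(e <- star b) h e *~ eps e c = \sum_(e <- star c) h e *~ eps e c.
Proof.
move=> Cb Cc bc; apply: big_supp_eq => [||e eb ec|e ec eb]; [exact: uS|exact: uS| |].
  have [->|/eps_neq0[ce _]] := eqVneq (eps e c) 0; first by rewrite mulr0z.
  by case/negP: ec; apply/mem_star => //; split=> //; exact: SC eb.
case/negP: eb; move/(mem_star _ Cc): ec => [Ce ce].
by apply/mem_star => //; split=> // z /bc/ce.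
Qed.

Lemma dhE phi b c : cells T b -> cells T c -> b `<=` c ->
  dh phi b c = \sum_(b' <- faces b) phi b' c *~ eps b b'.
Proof.
move=> Cb Cc bc; rewrite /dh /swap differentialE //; last exact/mem_faces.
exact: (faces_sum (phi^~ c)).
Qed.

Lemma dvE phi b c : cells T b -> cells T c -> b `<=` c ->
  dv phi b c = \sum_(c' <- star c) phi b c' *~ eps c' c.
Proof.
move=> Cb Cc bc; rewrite /dv differentialE //; last exact/mem_star.
exact: (star_sum (phi b)).
Qed.

Let dh_out phi b c : ~ [/\ cells T b, cells T c & b `<=` c] -> dh phi b c = 0.
Proof.
move=> H; rewrite /dh /swap /differential asboolF // => -[Cc /(mem_faces _ Cc)[Cb bc]].
by apply: H.
Qed.

Let dv_out phi b c : ~ [/\ cells T b, cells T c & b `<=` c] -> dv phi b c = 0.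
Proof.
move=> H; rewrite /dv /differential asboolF // => -[Cb /(mem_star _ Cb)[Cc bc]].
by apply: H.
Qed.

Let pairs_ext phi psi :
  (forall b c, ~ [/\ cells T b, cells T c & b `<=` c] -> phi b c = psi b c) ->
  (forall b c, cells T b -> cells T c -> b `<=` c -> phi b c = psi b c) -> phi = psi.
Proof.
move=> h1 h2; apply/funext => b; apply/funext => c.
have [[Cb Cc bc]|H] := pselect [/\ cells T b, cells T c & b `<=` c]; first exact: h2.
exact: h1.
Qed.

Lemma dh_lin (a : G) phi psi : dh (a *: phi + psi) = a *: dh phi + dh psi.
Proof.
apply: pairs_ext => [b c H|b c Cb Cc bc].
  by rewrite -[RHS]/(a *: dh phi b c + dh psi b c) !dh_out // scaler0 addr0.
rewrite -[RHS]/(a *: dh phi b c + dh psi b c) !dhE // scaler_sumr -big_split.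
by apply: eq_bigr => b' _; rewrite -[LHS]/((a *: phi b' c + psi b' c) *~ eps b b') mulrzDl scalerMzr.
Qed.

Lemma dv_lin (a : G) phi psi : dv (a *: phi + psi) = a *: dv phi + dv psi.
Proof.
apply: pairs_ext => [b c H|b c Cb Cc bc].
  by rewrite -[RHS]/(a *: dv phi b c + dv psi b c) !dv_out // scaler0 addr0.
rewrite -[RHS]/(a *: dv phi b c + dv psi b c) !dvE // scaler_sumr -big_split.
by apply: eq_bigr => c' _; rewrite -[LHS]/((a *: phi b c' + psi b c') *~ eps c' c) mulrzDl scalerMzr.
Qed.

Lemma dh_pairs p q phi : pairs p q phi -> pairs p.+1 q (dh phi).
Proof.
move=> /pairs_swap h; apply/pairs_swap.
apply: (differential_graded uF Fmap F_eps _ h) => y y' /eps_neq0[_ ->].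
by rewrite eqSS.
Qed.

Lemma dv_pairs p q phi : pairs p q.+1 phi -> pairs p q (dv phi).
Proof.
move=> h; apply: (differential_graded uS Smap S_eps _ h) => y y' /eps_neq0[_ ->].
by rewrite eqSS.
Qed.

Lemma dh_dh phi : dh (dh phi) = 0.
Proof.
apply: pairs_ext => [b c /dh_out->//|b c Cb Cc bc].
rewrite dhE // (eq_big_seq (fun b' => \sum_(e <- faces b) phi e c *~ (eps b b' * eps b' e))).
  rewrite exchange_big big1_seq // => e /andP[_ eb].
  have Ce := FC Cb eb; rewrite -mulrz_sumr (eps_eps hC Cb Ce (uF Cb)) ?mulr0z //.
    by move=> a Ca _ ab; apply/mem_faces.
  by move=> a; exact: FC.
move=> b' /(mem_faces _ Cb)[Cb' bb']; rewrite dhE //; last by move=> z /bb'/bc.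
rewrite -(faces_sum (phi^~ c) Cb' Cb bb') mulrz_suml; apply: eq_bigr => e _.
by rewrite -mulrzA mulrC.
Qed.

Lemma dv_dv phi : dv (dv phi) = 0.
Proof.
apply: pairs_ext => [b c /dv_out->//|b c Cb Cc bc].
rewrite dvE // (eq_big_seq (fun c' => \sum_(e <- star c) phi b e *~ (eps e c' * eps c' c))).
  rewrite exchange_big big1_seq // => e /andP[_ eb].
  have Ce := SC Cc eb; rewrite -mulrz_sumr (eps_eps hC Ce Cc (uS Cc)) ?mulr0z //.
    by move=> a Ca ab _; apply/mem_star.
  by move=> a; exact: SC.
move=> c' /(mem_star _ Cc)[Cc' cc']; rewrite dvE //; last by move=> z /bc/cc'.
rewrite -(star_sum (phi b) Cc Cc' cc') mulrz_suml; apply: eq_bigr => e _.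
by rewrite -mulrzA.
Qed.

Lemma dh_dv phi : dh (dv phi) = dv (dh phi).
Proof.
apply: pairs_ext => [b c H|b c Cb Cc bc]; first by rewrite dh_out ?dv_out.
rewrite dhE // dvE // (eq_big_seq (fun b' =>
    \sum_(c' <- star c) phi b' c' *~ eps c' c *~ eps b b')); last first.
  move=> b' /(mem_faces _ Cb)[Cb' bb']; rewrite dvE //; last by move=> z /bb'/bc.
  by rewrite mulrz_suml.
rewrite exchange_big; apply: eq_big_seq => c' /(mem_star _ Cc)[Cc' cc'].
rewrite dhE //; last by move=> z /bc/cc'.
by rewrite mulrz_suml; apply: eq_bigr => b' _; rewrite -!mulrzA mulrC.
Qed.

(** [faces_exact] solves the equation over each [c]; its constant sits on vertices, outside degree
    [p.+1]. *)
Lemma row_exact p q phi : pairs p.+1 q phi -> dh phi = 0 -> exists2 psi, pairs p q psi & dh psi = phi.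
Proof.
move=> /pairs_swap h h0; have [sp _] := h.
have [|c Cc|psi hpsi e] := differential_exact hdiv uF FC Fmap F_eps (p2 := p) _ h.
- by move=> y y' /eps_neq0[_ ->]; rewrite eqSS.
- have [us sE] := facesP Cc.
  have [b /sE[Cb bc]|psi [m hpsi]] := faces_exact hC Cc us sE (phi := phi^~ c).
    rewrite (faces_sum (phi^~ c) Cb Cc bc) -dhE // h0; by [].
  exists psi => b bc k; rewrite -[LHS]/(phi b c) hpsi // k addr0; by [].
exists (swap psi); first exact/pairs_swap.
by apply/funext => b; apply/funext => c; exact: (congr1 (fun f => f c b) e).
Qed.

Lemma col_exact p q phi : (q < d)%N -> pairs p q phi -> dv phi = 0 ->
  exists2 psi, pairs p q.+1 psi & dv psi = phi.
Proof.
move=> qd h h0; have [sp _] := h.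
have [|b Cb|psi hpsi e] := differential_exact hdiv uS SC Smap S_eps (p2 := q.+1) _ h.
- by move=> y y' /eps_neq0[_ ->]; rewrite eqSS.
- have [us sE] := starP Cb.
  have [c /sE[Cc bc]|psi [m hpsi]] := star_exact hC Cb us sE (f := phi b).
    by rewrite (star_sum (phi b) Cb Cc bc) -dvE // h0.
  by exists psi => c bc k; rewrite hpsi // k (ltn_eqF qd) addr0.
by exists psi.
Qed.

(** Without proper faces, a cell of positive dimension would have the constant function 1 as a
    cocycle that is not a coboundary, against [faces_exact]. So one can descend to a vertex. *)
Lemma faces_vertex c : cells T c -> exists2 v, v \in faces c & rk v = 0%N.
Proof.
elim: {c}(rk c).+1 {-2}c (ltnSn (rk c)) => // n IH c kc Cc; have [us sE] := facesP Cc.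
have cc : c \in faces c by apply/sE; split.
have [k0|kpos] := posnP (rk c); first by exists c.
have [b bc ne] : exists2 b, b \in faces c & b <> c.
  apply: contrapT => H.
  have e0 b : b \in faces c -> b = c by move=> bc; apply: contrapT => ne; apply: H; exists b.
  have ecc : eps c c = 0 by apply/eqP; apply: contrapT => /negP/eps_neq0[_ /n_Sn].
  have [b' /e0-> |psi [m /(_ c cc)]] := faces_exact hC Cc us sE (phi := fun=> (1 : int)).
    by rewrite big1_seq // => b /andP[_ /e0->]; rewrite ecc mulr0z.
  rewrite (gtn_eqF kpos) addr0 big1_seq // => b /andP[_ /e0->].
  by rewrite ecc mulr0z.
have [Cb bsc] := proj1 (sE b) bc; have kb := subcell_rk hC Cc Cb bsc ne.
have [v /(mem_faces _ Cb)[Cv vb] kv] := IH b (leq_trans kb kc) Cb.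
by exists v => //; apply/sE; split=> // z /vb/bsc.
Qed.

Lemma star_tile b : cells T b -> exists2 t, t \in star b & rk t = d.
Proof. by move=> Cb; have [us sE] := starP Cb; exact: (star_top hC Cb us sE). Qed.

(** The only frame of a point is the empty matrix, which every motion fixes. *)
Lemma sgnf_point (f : E -> E) c : rigid_motion f -> rk c = 0%N -> sgnf f c = 1.
Proof.
move=> mf k; have fB : row_free (0 : 'M[R]_(0, d)) by rewrite /row_free mxrank0.
have eB : ((0 : 'M[R]_(0, d)) :=: dirm c)%MS.
  by move/eqP: k; rewrite mxrank_eq0 => /eqP->; apply/eqmxP; rewrite !sub0mx.
have := sgnfE mf fB eB; rewrite mul0mx => /esym; rewrite -[RHS]mul1r; apply: mulIf.
by case: (bsgn_free fB) => ->.
Qed.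

Definition cochains p : set (set E -> G^o) := graded1 T p.

Definition delta (h : set E -> G^o) b : G^o :=
  if `[< cells T b >] then \sum_(b' <- faces b) h b' *~ eps b b' else 0.

Definition partial (h : set E -> G^o) c : G^o :=
  if `[< cells T c >] then \sum_(c' <- star c) h c' *~ eps c' c else 0.

Definition tile_ext (h : set E -> G^o) : V := extension T star d h.
Definition vertex_ext (h : set E -> G^o) : V := swap (extension T faces 0 h).

Lemma cochains_submod p : submod (cochains p).
Proof.
split=> [|a g h [sg [i eg]] [sh [j eh]]].
  by split=> [x //|]; exists 0%N => f x x' *; rewrite mul0rz.
split=> [x|].
  rewrite -[_ x]/(a *: g x + h x) => n.
  have [e|/eqP/sg //] := eqVneq (g x) 0; have [e'|/eqP/sh //] := eqVneq (h x) 0.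
  by case: n; rewrite e e' scaler0 addr0.
exists (maxn i j) => f x x' Cx Cx' hf.
rewrite -[LHS]/(a *: g x + h x) -[RHS]/((a *: g x' + h x') *~ sgnf f x).
rewrite (eg _ _ _ Cx Cx' (maps_corona_le (leq_maxl i j) Cx Cx' hf)).
rewrite (eh _ _ _ Cx Cx' (maps_corona_le (leq_maxr i j) Cx Cx' hf)).
by rewrite mulrzDl scalerMzr.
Qed.

Lemma delta_lin (a : G) (g h : set E -> G^o) : delta (a *: g + h) = a *: delta g + delta h.
Proof.
apply/funext => b; rewrite -[RHS]/(a *: delta g b + delta h b) /delta.
case: asboolP => _; last by rewrite scaler0 addr0.
rewrite scaler_sumr -big_split; apply: eq_bigr => b' _.
by rewrite -[LHS]/((a *: g b' + h b') *~ eps b b') mulrzDl scalerMzr.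
Qed.

Lemma partial_lin (a : G) (g h : set E -> G^o) : partial (a *: g + h) = a *: partial g + partial h.
Proof.
apply/funext => c; rewrite -[RHS]/(a *: partial g c + partial h c) /partial.
case: asboolP => _; last by rewrite scaler0 addr0.
rewrite scaler_sumr -big_split; apply: eq_bigr => c' _.
by rewrite -[LHS]/((a *: g c' + h c') *~ eps c' c) mulrzDl scalerMzr.
Qed.

Let tile_extE h b c : cells T b -> cells T c -> b `<=` c ->
  tile_ext h b c = if rk c == d then h b else 0.
Proof.
move=> Cb Cc bc; rewrite /tile_ext /extension; case: asboolP => [[_ _ ->]|H]; first by rewrite eqxx.
by case: eqP => // k; case: H; split=> //; apply/mem_star.
Qed.

Let vertex_extE h b c : cells T b -> cells T c -> b `<=` c ->
  vertex_ext h b c = if rk b == 0%N then h c else 0.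
Proof.
move=> Cb Cc bc; rewrite /vertex_ext /swap /extension; case: asboolP => [[_ _ ->]//|H].
by case: eqP => // k; case: H; split=> //; apply/mem_faces.
Qed.

Let tile_out h b c : ~ [/\ cells T b, cells T c & b `<=` c] -> tile_ext h b c = 0.
Proof.
move=> H; rewrite /tile_ext /extension asboolF // => -[Cb /(mem_star _ Cb)[Cc bc] _].
by apply: H.
Qed.

Let vertex_out h b c : ~ [/\ cells T b, cells T c & b `<=` c] -> vertex_ext h b c = 0.
Proof.
move=> H; rewrite /vertex_ext /swap /extension asboolF // => -[Cc /(mem_faces _ Cc)[Cb bc] _].
by apply: H.
Qed.

Lemma tile_ext_lin (a : G) g h : tile_ext (a *: g + h) = a *: tile_ext g + tile_ext h.
Proof.
apply/funext => b; apply/funext => c.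
rewrite -[RHS]/(a *: tile_ext g b c + tile_ext h b c) /tile_ext /extension.
by case: asboolP => // _; rewrite scaler0 addr0.
Qed.

Lemma vertex_ext_lin (a : G) g h : vertex_ext (a *: g + h) = a *: vertex_ext g + vertex_ext h.
Proof.
apply/funext => b; apply/funext => c.
rewrite -[RHS]/(a *: vertex_ext g b c + vertex_ext h b c) /vertex_ext /swap /extension.
by case: asboolP => // _; rewrite scaler0 addr0.
Qed.

Lemma dh_tile h : dh (tile_ext h) = tile_ext (delta h).
Proof.
apply: pairs_ext => [b c H|b c Cb Cc bc]; first by rewrite dh_out ?tile_out.
rewrite dhE // tile_extE // /delta asboolT //.
have E b' : b' \in faces b -> tile_ext h b' c = if rk c == d then h b' else 0.
  by move=> /(mem_faces _ Cb)[Cb' bb']; rewrite tile_extE // => z /bb'/bc.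
case: eqP => k; first by apply: eq_big_seq => b' /E->; rewrite k eqxx.
by rewrite big1_seq // => b' /andP[_ /E->]; case: eqP => // _; rewrite mul0rz.
Qed.

Lemma dv_vertex h : dv (vertex_ext h) = vertex_ext (partial h).
Proof.
apply: pairs_ext => [b c H|b c Cb Cc bc]; first by rewrite dv_out ?vertex_out.
rewrite dvE // vertex_extE // /partial asboolT //.
have E c' : c' \in star c -> vertex_ext h b c' = if rk b == 0%N then h c' else 0.
  by move=> /(mem_star _ Cc)[Cc' cc']; rewrite vertex_extE // => z /bc/cc'.
case: eqP => k; first by apply: eq_big_seq => c' /E->; rewrite k eqxx.
by rewrite big1_seq // => c' /andP[_ /E->]; case: eqP => // _; rewrite mul0rz.
Qed.

(** For fixed [b] the function is constant on tiles, a multiple of the fundamental chain of a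
    star. *)
Lemma dv_tile h : dv (tile_ext h) = 0.
Proof.
apply: pairs_ext => [b c /dv_out->//|b c Cb Cc bc]; rewrite dvE //.
have [us sE] := starP Cc; have cc : c \in star c by apply/sE; split.
rewrite -[RHS](star_fundamental hC Cc us sE (h b) cc).
by apply: eq_big_seq => c' /sE[Cc' cc']; rewrite tile_extE // => z /bc/cc'.
Qed.

(** Only edges [b] can contribute, and their ends cancel by [faces_fundamental]. *)
Lemma dh_vertex h : dh (vertex_ext h) = 0.
Proof.
apply: pairs_ext => [b c /dh_out->//|b c Cb Cc bc]; rewrite dhE //.
have [us sE] := facesP Cb.
have E b' : b' \in faces b -> vertex_ext h b' c = if rk b' == 0%N then h c else 0.
  by move=> /(mem_faces _ Cb)[Cb' bb']; rewrite vertex_extE // => z /bb'/bc.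
have [k|k] := eqVneq (rk b) 1%N.
  have := congr1 (fun z => h c *~ z) (faces_fundamental hC Cb us sE k).
  rewrite mulr0z mulrz_sumr => e; rewrite -[RHS]e; apply: eq_big_seq => b' /E->.
  have [->|/eps_neq0[_]] := eqVneq (eps b b') 0; first by rewrite !mulr0z.
  by rewrite k => -[<-].
rewrite big1_seq // => b' /andP[_ /E->].
have [->|/eps_neq0[_ e]] := eqVneq (eps b b') 0; first by rewrite mulr0z.
by rewrite ifN ?mul0rz //; apply: contra k => /eqP k; rewrite e k.
Qed.

Lemma tile_pairs n h : cochains n h -> pairs n d (tile_ext h).
Proof. by apply: extension_graded => // f y mf; exact: sgnf_full. Qed.

Lemma vertex_pairs n h : cochains n h -> pairs 0 n (vertex_ext h).
Proof.
move=> ch; apply/pairs_swap; apply: extension_graded ch => //.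
by move=> f y; exact: sgnf_point.
Qed.

(** By [star_exact] a cycle in degree [d] of a star is constant on the tiles, as there are no cells
    of dimension [d.+1] to bound anything. *)
Lemma tile_onto n phi : pairs n d phi -> dv phi = 0 -> exists2 h, cochains n h & tile_ext h = phi.
Proof.
move=> h h0; apply: (extension_onto SC Smap star_tile (fun f y mf => @sgnf_full _ _ f mf y)) => // b Cb.
have [us sE] := starP Cb.
have [c /sE[Cc bc]|psi [m hpsi]] := star_exact hC Cb us sE (f := phi b).
  by rewrite (star_sum (phi b) Cb Cc bc) -dvE // h0.
exists m => c cb k; rewrite hpsi // k eqxx big1 ?add0r // => c' _.
have [->|/eps_neq0[_ e]] := eqVneq (eps c' c) 0; first by rewrite mulr0z.
by have := rank_leq_col (dirm c'); rewrite -/(rk c') e k ltnn.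
Qed.

Lemma vertex_onto n phi : pairs 0 n phi -> dh phi = 0 -> exists2 h, cochains n h & vertex_ext h = phi.
Proof.
move=> /pairs_swap h h0.
have [|g cg e] := extension_onto FC Fmap faces_vertex sgnf_point h; last first.
- exists g => //; apply/funext => b; apply/funext => c.
  by rewrite /vertex_ext /swap e.
move=> c Cc; have [us sE] := facesP Cc.
have [b /sE[Cb bc]|psi [m hpsi]] := faces_exact hC Cc us sE (phi := phi^~ c).
  by rewrite (faces_sum (phi^~ c) Cb Cc bc) -dhE // h0.
exists m => b bc k; rewrite -[LHS]/(phi b c) hpsi // k eqxx big1 ?add0r // => b' _.
have [->|/eps_neq0[_]] := eqVneq (eps b b') 0; first by rewrite mulr0z.
by rewrite k.
Qed.

Let tile_inj g h : (forall x, g x <> 0 -> cells T x) -> (forall x, h x <> 0 -> cells T x) ->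
  tile_ext g = tile_ext h -> g = h.
Proof. by move=> sg sh; apply: extension_inj => //; exact: star_tile. Qed.

Let vertex_inj g h : (forall x, g x <> 0 -> cells T x) -> (forall x, h x <> 0 -> cells T x) ->
  vertex_ext g = vertex_ext h -> g = h.
Proof.
move=> sg sh e; apply: (extension_inj faces_vertex sg sh).
by apply/funext => c; apply/funext => b; exact: (congr1 (fun f => f b c) e).
Qed.

Let delta_cells g x : delta g x <> 0 -> cells T x.
Proof. by rewrite /delta; case: asboolP. Qed.

Let partial_cells g x : partial g x <> 0 -> cells T x.
Proof. by rewrite /partial; case: asboolP. Qed.

Let cochains_cells n h : cochains n h -> forall x, h x <> 0 -> cells T x.
Proof. by move=> [sh _] x /sh[]. Qed.

Definition delta_cocycles n := [set h | cochains n h /\ delta h = 0].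
Definition delta_coboundaries n : set (set E -> G^o) :=
  if n is j.+1 then [set delta h | h in cochains j] else [set 0].
Definition partial_cycles m := [set h | cochains m h /\ partial h = 0].
Definition partial_boundaries m := [set partial h | h in cochains m.+1].

Let tile_ext0 : tile_ext 0 = 0.
Proof. by rewrite /tile_ext /extension; apply/funext => b; apply/funext => c; case: asboolP. Qed.

Let vertex_ext0 : vertex_ext 0 = 0.
Proof.
apply/funext => b; apply/funext => c; rewrite /vertex_ext /swap /extension.
by case: asboolP.
Qed.

Let dh0 : dh 0 = 0. Proof. by rewrite -[in LHS]vertex_ext0 dh_vertex. Qed.

Let dv0 : dv 0 = 0. Proof. by rewrite -[in LHS]tile_ext0 dv_tile. Qed.

Lemma tile_iso n m : (n + m)%N = d -> iso_rel (delta_cocycles n) (delta_coboundaries n)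
  (bicycles pairs dh dv m n) (bibounds pairs dh dv m n).
Proof.
move=> nm; exists (fun h phi => delta_cocycles n h /\ tile_ext h = phi); split.
- move=> h _ [[ch h0] <-]; split=> //.
    by split; [rewrite nm; exact: tile_pairs|rewrite dh_tile h0|exact: dv_tile].
  case: n => [|j] in nm ch *; split.
  + move=> ->; exists 0; last by rewrite dv0 tile_ext0.
    by split; [case: (graded_submod T G star 0 m.+1)|exact: dh0].
  (* In degree 0 one has [m = d], so [x] lives on cells of dimension [d.+1] and is 0; this matches
     the zero module of coboundaries. *)
  + move=> [x [[sx _] _] e]; apply: tile_inj; [exact: cochains_cells ch|by []|].
    rewrite tile_ext0 -e; suff -> : x = 0 by [].
    apply/funext => b; apply/funext => c; apply: contrapT => /sx[_ _ _ k].
    by have := rank_leq_col (dirm c); rewrite -/(rk c) k -[X in (_ <= X)%N]nm ltnn.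
  + move=> [g cg <-]; exists (tile_ext g); last exact: dh_tile.
    by split; [rewrite nm; exact: tile_pairs|exact: dv_tile].
  move=> [x [Dx vx] e]; rewrite nm in Dx; have [g cg gx] := tile_onto Dx vx.
  exists g => //; apply: tile_inj; [exact: delta_cells|exact: cochains_cells ch|].
  by rewrite -dh_tile gx.
- move=> a g _ h _ [[cg g0] <-] [[ch h0] <-]; split; last exact: tile_ext_lin.
  by split; [exact: (cochains_submod n).2|rewrite delta_lin g0 h0 scaler0 addr0].
- by move=> h ch; exists (tile_ext h).
move=> phi [Dphi h0 v0]; rewrite nm in Dphi; have [h ch e] := tile_onto Dphi v0.
exists h; split=> //; split=> //; apply: tile_inj; [exact: delta_cells|by move=> x []|].
by rewrite -dh_tile e h0 tile_ext0.
Qed.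

Lemma vertex_iso m : iso_rel (partial_cycles m) (partial_boundaries m)
  (bicycles pairs dh dv m 0) (bibounds pairs dh dv m 0).
Proof.
exists (fun h phi => partial_cycles m h /\ vertex_ext h = phi); split.
- move=> h _ [[ch h0] <-]; split=> //.
    by split; [exact: vertex_pairs|exact: dh_vertex|rewrite dv_vertex h0 vertex_ext0].
  split=> [[g cg <-]|[x [Dx hx] e]].
    exists (vertex_ext g); last exact: dv_vertex.
    by split; [exact: vertex_pairs|exact: dh_vertex].
  have [g cg gx] := vertex_onto Dx hx.
  exists g => //; apply: vertex_inj; [exact: partial_cells|exact: cochains_cells ch|].
  by rewrite -dv_vertex gx.
- move=> a g _ h _ [[cg g0] <-] [[ch h0] <-]; split; last exact: vertex_ext_lin.
  by split; [exact: (cochains_submod m).2|rewrite partial_lin g0 h0 scaler0 addr0].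
- by move=> h ch; exists (vertex_ext h).
move=> phi [Dphi h0 v0]; have [h ch e] := vertex_onto Dphi h0.
exists h; split=> //; split=> //; apply: vertex_inj; [exact: partial_cells|by move=> x []|].
by rewrite -dv_vertex e v0 vertex_ext0.
Qed.

Lemma cell_duality n m : (n + m)%N = d -> iso_rel (delta_cocycles n) (delta_coboundaries n)
  (partial_cycles m) (partial_boundaries m).
Proof.
move=> nm; apply: iso_rel_trans (tile_iso nm) _; apply: iso_rel_sym.
apply: iso_rel_trans (vertex_iso m) _.
apply: (@zigzag _ _ pairs dh dv d) => //; last by rewrite nm.
- by move=> p q; exact: graded_submod.
- exact: dh_lin.
- exact: dv_lin.
- exact: dh_pairs.
- exact: dv_pairs.
- by move=> *; exact: dh_dh.
- by move=> *; exact: dv_dv.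
- by move=> *; exact: dh_dv.
- exact: row_exact.
- exact: col_exact.
Qed.

End DoubleComplex.

(** * Comparison with oriented cells *)

Section OrientedCells.
Variables (R : realType) (d : nat) (L : Type) (T : polytopal_tiling R d L).
Local Notation E := 'rV[R]_d.
Implicit Types (b c : set E) (i j k : nat).

Let hC := cells_CW T.

Lemma oc_rk k (o : ocell T k) : rk (oc_cell o) = k.
Proof. by apply/(has_dimE _ (cell0 (oc_cellP o))); case: (oc_orP o). Qed.

Lemma frame_exists k c : cells T c -> rk c = k -> exists B : 'M[R]_(k, d), frame c B.
Proof. by move=> Cc; move/(has_dimE _ (cell0 Cc)). Qed.

Lemma osign_exists k (o : ocell T k) : exists e : int, e * e = 1 /\
  forall B, frame (oc_cell o) B -> oc_or o B = e * bsgn B.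
Proof.
have c0 := cell0 (oc_cellP o); have [[B0 fB0] w1 wM _] := oc_orP o.
have [f0 e0] := proj1 (frameE _ c0) fB0; exists (oc_or o B0 * bsgn B0); split.
  by rewrite mulrACA bsgn_sq // mulr1; case: (w1 _ fB0) => ->.
move=> B /(frameE _ c0)[fB eB].
have [A [-> dA]] := bsgn_basis_eq fB (eqmx_trans eB (eqmx_sym e0)).
rewrite (wM _ _ fB0) bsgn_mul // mulrACA [bsgn B0 * _]mulrC -[LHS]mulr1.
by rewrite -(bsgn_sq f0); ring.
Qed.

(* Orientations are measured against the reference orientation [bsgn]. *)
Definition osign k (o : ocell T k) : int :=
  xget 0 [set e : int | e * e = 1 /\ forall B, frame (oc_cell o) B -> oc_or o B = e * bsgn B].

Lemma osignP k (o : ocell T k) : osign o * osign o = 1 /\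
  forall B, frame (oc_cell o) B -> oc_or o B = osign o * bsgn B.
Proof. by rewrite /osign; case: xgetP => [e _ //|H]; have [e /H] := osign_exists o. Qed.

Lemma osign_sq k (o : ocell T k) : osign o * osign o = 1.
Proof. by case: (osignP o). Qed.

Lemma bsgn_frame k c (B : 'M[R]_(k, d)) : c !=set0 -> frame c B -> bsgn B * bsgn B = 1.
Proof. by move=> c0 /(frameE _ c0)[fB _]; exact: bsgn_sq. Qed.

Lemma osign_uniq k (o : ocell T k) (B : 'M[R]_(k, d)) (e : int) : frame (oc_cell o) B ->
  oc_or o B = e * bsgn B -> osign o = e.
Proof.
move=> fB; have [_ ->//] := osignP o; have bb := bsgn_frame (cell0 (oc_cellP o)) fB.
by move=> /(congr1 (fun z => z * bsgn B)); rewrite -!mulrA bb !mulr1.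
Qed.

Lemma ocell_eq k (o o' : ocell T k) : oc_cell o = oc_cell o' -> osign o = osign o' -> o = o'.
Proof.
move=> ec es; have ew : oc_or o = oc_or o'.
  apply/funext => B; have [_ h] := osignP o; have [_ h'] := osignP o'.
  have [fB|nf] := pselect (frame (oc_cell o) B); first by rewrite h // h' -?ec // es.
  have [_ _ _ -> //] := oc_orP o; have [_ _ _ -> //] := oc_orP o'; by rewrite -ec.
case: o ec ew {es} => c w P Q; case: o' => c' w' P' Q' /= ec ew; subst c'; subst w'.
by rewrite (Prop_irrelevance P P') (Prop_irrelevance Q Q').
Qed.

Lemma ocell_exists k c (e : int) : cells T c -> rk c = k -> e * e = 1 ->
  exists2 o : ocell T k, oc_cell o = c & osign o = e.
Proof.
move=> Cc kc e2; have c0 := cell0 Cc.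
have e1 : e = 1 \/ e = -1.
  have /eqP : (e - 1) * (e + 1) = 0 by rewrite -[RHS](subrr (e * e)) {2}e2; ring.
  rewrite mulf_eq0 subr_eq0 addr_eq0 => /orP[]/eqP->; [by left|by right].
pose w (B : 'M[R]_(k, d)) := if `[< frame c B >] then e * bsgn B else 0.
have wE B : frame c B -> w B = e * bsgn B by move=> fB; rewrite /w asboolT.
have w_or : is_orientation c w.
  split; first exact: frame_exists.
  - move=> B fB; rewrite wE //; move/(frameE _ c0): fB => [/bsgn_free fB _].
    by case: e1 => ->; case: fB => ->; rewrite ?mulN1r ?mul1r ?opprK; [left|right|right|left].
  - move=> A B fB; rewrite [w B]wE //; have [fr eB] := proj1 (frameE _ c0) fB.
    have [A0|uA] := eqVneq (\det A) 0.
      rewrite A0 sgz0 mul0r /w asboolF // => /(frameE _ c0)[fAB _].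
      by have := bsgn_sq fAB; rewrite bsgn_mul // A0 sgz0 !mul0r.
    rewrite wE ?bsgn_mul //; first by ring.
    have uA' : A \in unitmx by rewrite unitmxE unitfE.
    apply/(frameE _ c0); split.
      by rewrite /row_free mxrankMfree // mxrank_unit.
    by apply: eqmx_trans eB; apply: eqmxMfull; rewrite row_full_unit.
  - by move=> B nf; rewrite /w asboolF.
exists (OCell Cc w_or) => //; have [B fB] := frame_exists Cc kc.
exact: (osign_uniq (o := OCell Cc w_or) fB (wE _ fB)).
Qed.

Lemma opposite_osign k (o o' : ocell T k) :
  opposite o o' <-> oc_cell o' = oc_cell o /\ osign o' = - osign o.
Proof.
have [_ h] := osignP o; have [_ h'] := osignP o'.
split=> -[ec e]; split=> //.
  have [B fB] := frame_exists (oc_cellP o) (oc_rk o).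
  by apply: (osign_uniq (B := B)); rewrite ?ec // e h // mulNr.
move=> B; have [fB|nf] := pselect (frame (oc_cell o) B).
  by rewrite h' ?ec // e h // mulNr.
have [_ _ _ -> //] := oc_orP o'; last by rewrite ec.
by have [_ _ _ -> //] := oc_orP o; rewrite oppr0.
Qed.

Lemma frame_motion (f : E -> E) k c (B : 'M[R]_(k, d)) : rigid_motion f -> c !=set0 ->
  frame c B -> frame (f @` c) (B *m linpart f).
Proof.
move=> mf c0 /(frameE _ c0)[fB eB]; have fc0 : f @` c !=set0.
  by have [z cz] := c0; exists (f z); exists z.
apply/(frameE _ fc0); split; first exact: row_free_motion.
by apply: eqmx_trans (eqmx_sym (dirm_motion mf c0)); exact: eqmxMr.
Qed.

Lemma pushforward_osign (f : E -> E) k (o o' : ocell T k) : rigid_motion f ->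
  pushforward f o o' <->
  oc_cell o' = f @` oc_cell o /\ osign o = osign o' * sgnf f (oc_cell o).
Proof.
move=> mf; have c0 := cell0 (oc_cellP o); have c0' := cell0 (oc_cellP o').
have [_ h] := osignP o; have [_ h'] := osignP o'.
have wE B : oc_cell o' = f @` oc_cell o -> frame (oc_cell o) B ->
    oc_or o' (B *m linpart f) = osign o' * sgnf f (oc_cell o) * bsgn B.
  move=> ec fB; rewrite h' ?ec; last exact: frame_motion.
  by move/(frameE _ c0): fB => [fB eB]; rewrite (sgnfE mf fB eB) mulrA.
split=> -[ec e]; split=> //.
  have [B fB] := frame_exists (oc_cellP o) (oc_rk o).
  by apply: (osign_uniq fB); rewrite -e wE.
move=> B; have [fB|nf] := pselect (frame (oc_cell o) B).
  by rewrite wE // -e h.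
have [_ _ _ -> //] := oc_orP o'; first by have [_ _ _ -> //] := oc_orP o.
rewrite ec => fB; apply: nf; have fc0 : f @` oc_cell o !=set0 by rewrite -ec.
have := frame_motion (motion_inv_rigid mf) fc0 fB.
by rewrite image_motionK // linpart_inv // mulmxK // motion_unit.
Qed.

(** [oriented_face] and [eps] follow the same outward convention, so the boundary orientation is
    that of the cell times [eps]. *)
Lemma oriented_face_osign k (o : ocell T k.+1) (o' : ocell T k) :
  oriented_face o o' <->
  eps (oc_cell o) (oc_cell o') != 0 /\ osign o' = osign o * eps (oc_cell o) (oc_cell o').
Proof.
have [Cc Cb] := (oc_cellP o, oc_cellP o'); have [kc kb] := (oc_rk o, oc_rk o').
have [c0 b0] := (cell0 Cc, cell0 Cb); have [_ h] := osignP o; have [_ h'] := osignP o'.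
have kcb : rk (oc_cell o) = (rk (oc_cell o')).+1 by rewrite kc kb.
have wE x y (B : 'M[R]_(k, d)) : oc_cell o' `<=` oc_cell o -> relint (oc_cell o) x ->
    oc_cell o' y -> frame (oc_cell o') B ->
    oc_or o (col_mx (y - x) B) = osign o * eps (oc_cell o) (oc_cell o') * bsgn B.
  move=> bc rx by_ /(frameE _ b0)[fB eB].
  have e := epsE hC Cc Cb bc kcb rx by_ fB eB.
  have fC : row_free (col_mx (y - x) B).
    apply: contrapT => /negP nf; have := e; rewrite {1}/bsgn (negbTE nf) => /esym/eqP.
    rewrite mulf_eq0 => /orP[]/eqP z.
      by have := eps_sq hC Cc Cb bc kcb; rewrite z mul0r.
    by have := bsgn_sq fB; rewrite z mul0r.
  rewrite h ?e ?mulrA //; apply/(frameE _ c0); split=> //.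
  have sub : (col_mx (y - x)%R B <= dirm (oc_cell o))%MS.
    rewrite col_mx_sub dirm_subin //=; [|exact: relint_sub|exact: bc].
    by rewrite eB; apply: subset_dirm.
  apply/eqmxP; rewrite -(geq_leqif (mxrank_leqif_eq sub)) -/(rk _) kc.
  by move: fC; rewrite /row_free => /eqP->.
split=> [[bc e]|[e0 e]].
  split.
    by apply/eqP => z; have := eps_sq hC Cc Cb bc kcb; rewrite z mul0r.
  have [x rx] := cell_relint0 hC Cc; have [y by_] := b0.
  have [B fB] := frame_exists Cb kb.
  by apply: (osign_uniq fB); rewrite (e x y) // wE.
have [bc _] := eps_neq0 e0; split=> // x y B rx by_ fB.
by rewrite wE // -e h'.
Qed.

End OrientedCells.

(** * From functions on cells to oriented chains *)

Section Comparison.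
Variables (R : realType) (d : nat) (L : Type) (T : polytopal_tiling R d L) (G : pzRingType).
Local Notation E := 'rV[R]_d.
Implicit Types (b c x y : set E) (g h : set E -> G^o) (i j k : nat).

Let hC := cells_CW T.

(** The alternating function with value [h] on the reference orientation of each cell. *)
Definition unhat k h : chain T G k := fun o => h (oc_cell o) *~ osign o.
Arguments unhat : clear implicits.

Let supp k h := forall x, h x <> 0 -> cells T x /\ rk x = k.

Lemma unhat_lin k (a : G) g h : unhat k (a *: g + h) = a *: unhat k g + unhat k h.
Proof.
apply/funext => o; rewrite -[RHS]/(a *: unhat k g o + unhat k h o).
by rewrite -[LHS]/((a *: g (oc_cell o) + h (oc_cell o)) *~ osign o) mulrzDl scalerMzr.
Qed.

Lemma unhat_inj k g h : supp k g -> supp k h -> unhat k g = unhat k h -> g = h.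
Proof.
move=> sg sh e; apply/funext => x; have [[Cx kx]|H] := pselect (cells T x /\ rk x = k).
  have [ o <- so] := ocell_exists (e := 1) Cx kx erefl.
  have := congr1 (fun s => s o) e; by rewrite /unhat so !mulr1z.
by transitivity (0 : G^o); [|apply/esym]; apply: contrapT => n; apply: H; [exact: sg|exact: sh].
Qed.

Lemma unhat_alternating k h : alternating (unhat k h).
Proof. by move=> o o' /opposite_osign[ec es]; rewrite /unhat ec es mulrNz. Qed.

Lemma alternating_unhat k (s : chain T G k) : alternating s ->
  exists2 h, supp k h & unhat k h = s.
Proof.
move=> alt; pose V c := [set v : G^o | exists2 o : ocell T k, oc_cell o = c /\ osign o = 1 & v = s o].
exists (fun c => xget 0 (V c)) => [x|].
  by case: xgetP => [_ _ [ o [<- _] _] _|//]; split; [exact: oc_cellP|exact: oc_rk].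
apply/funext => o; rewrite /unhat.
have [ o1 e1 s1] := ocell_exists (e := 1) (oc_cellP o) (oc_rk o) erefl.
have -> : xget 0 (V (oc_cell o)) = s o1.
  case: xgetP => [_ _ [ o2 [e2 s2] ->]|/(_ (s o1)) []]; last by exists o1.
  by congr s; apply: ocell_eq; [rewrite e2 e1|rewrite s2 s1].
have /eqP : (osign o - 1) * (osign o + 1) = 0.
  by rewrite -[RHS](subrr (osign o * osign o)) {2}osign_sq; ring.
rewrite mulf_eq0 subr_eq0 addr_eq0 => /orP[]/eqP so; rewrite so.
  by rewrite mulr1z; congr s; apply: ocell_eq; rewrite ?e1 // s1 so.
rewrite mulrNz mulr1z; apply/esym/alt/opposite_osign.
by rewrite e1 so s1.
Qed.

Lemma ePE_unhat k h : supp k h -> ePE (unhat k h) <-> cochains T k h.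
Proof.
move=> sh; split=> [[_ [i e]]|[_ [i e]]].
  split=> //; exists i => f x x' Cx Cx' hf; have [mf fx _] := hf.
  have kx' : rk x' = rk x by rewrite -fx (rk_motion mf (cell0 Cx)).
  have [kx|kx] := eqVneq (rk x) k; last first.
    have -> : h x = 0 by apply: contrapT => /sh[_ /eqP]; rewrite (negbTE kx).
    have -> : h x' = 0 by apply: contrapT => /sh[_ /eqP]; rewrite kx' (negbTE kx).
    by rewrite mul0rz.
  have [ o ox so] := ocell_exists (e := 1) Cx kx erefl.
  rewrite -kx' in kx; have [ o' ox' so'] := ocell_exists Cx' kx (sgnf_sq mf x).
  have := e f o o'; rewrite /unhat ox ox' so so' mulr1z; apply=> //.
  by apply/pushforward_osign => //; rewrite ox ox' fx so so' sgnf_sq.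
split; first exact: unhat_alternating.
exists i => f o o' hf /pushforward_osign[]; first by case: hf.
move=> ec es; rewrite /unhat (e _ _ _ (oc_cellP o) (oc_cellP o') hf) es -mulrzA.
have [mf _ _] := hf.
by rewrite mulrC -mulrA sgnf_sq // mulr1.
Qed.

Lemma ePE_image k : @ePE _ _ _ T G k = [set unhat k h | h in cochains T k].
Proof.
apply/seteqP; split=> [s es|_ [h ch <-]].
  have [h sh e] := alternating_unhat es.1; exists h => //.
  by apply/(ePE_unhat sh); rewrite e.
by apply/ePE_unhat => //; exact: ch.1.
Qed.

(** Each facet [b] of [c] has exactly one orientation that makes it an oriented face, the one of
    sign [osign o * eps c b], so the sum over oriented faces is a sum over [faces]. *)
Lemma coboundary_unhat k h : coboundary (unhat k h) = unhat k.+1 (delta T h).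
Proof.
apply/funext => o; set c := oc_cell o; have Cc : cells T c := oc_cellP o.
have [us sE] := facesP Cc; pose F b := h b *~ (osign o * eps c b).
rewrite /coboundary (eq_fsbigr (fun o' : ocell T k => F (oc_cell o'))); last first.
  by move=> o' /set_mem/oriented_face_osign[_ e]; rewrite /unhat e.
rewrite -(fsbig_image _ (@oc_cell _ _ _ T k) F); last first.
  move=> o1 o2 /set_mem/oriented_face_osign[_ e1] /set_mem/oriented_face_osign[_ e2] e.
  by apply: (ocell_eq e); apply: (etrans e1); rewrite e; exact: (esym e2).
have -> : [set oc_cell o' | o' in [set o' : ocell T k | oriented_face o o']] =
    [set` [seq b <- faces T c | eps c b != 0]].
  apply/seteqP; split=> [_ [ o' /oriented_face_osign[e0 _] <-]|b]; rewrite /= mem_filter.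
    by rewrite e0; apply/sE; split; [exact: oc_cellP|case: (eps_neq0 e0)].
  move=> /andP[e0 /sE[Cb bc]]; have [_ kb] := eps_neq0 e0.
  have kb' : rk b = k by move: kb; rewrite (oc_rk o) => -[].
  have e2 : (osign o * eps c b) * (osign o * eps c b) = 1.
    by rewrite mulrACA osign_sq (eps_sq hC Cc Cb bc kb).
  have [ o' eb so'] := ocell_exists Cb kb' e2; exists o' => //.
  by apply/oriented_face_osign; rewrite eb.
rewrite -fsbig_seq ?filter_uniq // big_filter /unhat /delta asboolT // mulrz_suml.
rewrite big_mkcond; apply: eq_bigr => b _; rewrite /F.
by case: eqVneq => [->|_]; rewrite ?mul0rz // mulrC mulrzA.
Qed.

Lemma boundary_unhat k h : boundary (unhat k.+1 h) = unhat k (partial T h).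
Proof.
apply/funext => o'; set b := oc_cell o'; have Cb : cells T b := oc_cellP o'.
have [us sE] := starP Cb; pose F c := h c *~ (osign o' * eps c b).
(* [eps] squares to 1, so the orientation of the face determines that of the larger cell. *)
have so (o : ocell T k.+1) : oriented_face o o' -> osign o = osign o' * eps (oc_cell o) b.
  move=> /oriented_face_osign[e0 ->]; have [bc kc] := eps_neq0 e0.
  by rewrite -mulrA (eps_sq hC (oc_cellP o) Cb bc kc) mulr1.
rewrite /boundary (eq_fsbigr (fun o : ocell T k.+1 => F (oc_cell o))); last first.
  by move=> o /set_mem/so e; rewrite /unhat e.
rewrite -(fsbig_image _ (@oc_cell _ _ _ T k.+1) F); last first.
  move=> o1 o2 /set_mem/so e1 /set_mem/so e2 e.
  by apply: (ocell_eq e); apply: (etrans e1); rewrite e; exact: (esym e2).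
have -> : [set oc_cell o | o in [set o : ocell T k.+1 | oriented_face o o']] =
    [set` [seq c <- star T b | eps c b != 0]].
  apply/seteqP; split=> [_ [ o /oriented_face_osign[e0 _] <-]|c]; rewrite /= mem_filter.
    by rewrite e0; apply/sE; split; [exact: oc_cellP|case: (eps_neq0 e0)].
  move=> /andP[e0 /sE[Cc bc]]; have [_ kc] := eps_neq0 e0.
  have ee := eps_sq hC Cc Cb bc kc.
  have kc' : rk c = k.+1 by rewrite kc (oc_rk o').
  have e2 : (osign o' * eps c b) * (osign o' * eps c b) = 1 by rewrite mulrACA osign_sq ee.
  have [ o ec eo] := ocell_exists Cc kc' e2; exists o => //.
  by apply/oriented_face_osign; rewrite ec; split=> //; rewrite eo -mulrA ee mulr1.
rewrite -fsbig_seq ?filter_uniq // big_filter /unhat /partial asboolT // mulrz_suml.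
rewrite big_mkcond; apply: eq_bigr => c _; rewrite /F.
by case: eqVneq => [->|_]; rewrite ?mul0rz // mulrC mulrzA.
Qed.

Let unhat0 k : unhat k 0 = 0.
Proof. by apply/funext => o; rewrite /unhat mul0rz. Qed.

Let supp0 k : supp k 0. Proof. by move=> x []. Qed.

Let delta_supp k h : supp k h -> supp k.+1 (delta T h).
Proof.
move=> sh x; rewrite /delta; case: asboolP => // Cx n; split=> //.
apply: contrapT => kx; apply: n; rewrite big1 // => b _.
have [->|/eps_neq0[_ e]] := eqVneq (eps x b) 0; first by [].
have [->|/eqP/sh[_ kb]] := eqVneq (h b) 0; first by rewrite mul0rz.
by case: kx; rewrite e kb.
Qed.

Let partial_supp k h : supp k.+1 h -> supp k (partial T h).
Proof.
move=> sh x; rewrite /partial; case: asboolP => // Cx n; split=> //.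
apply: contrapT => kx; apply: n; rewrite big1 // => c _.
have [->|/eps_neq0[_ e]] := eqVneq (eps c x) 0; first by [].
have [->|/eqP/sh[_ kc]] := eqVneq (h c) 0; first by rewrite mul0rz.
by case: kx; move: kc; rewrite e => -[].
Qed.

Lemma cocycles_image k : @cocycles _ _ _ T G k = [set unhat k h | h in delta_cocycles T k].
Proof.
apply/seteqP; split=> [s []|_ [h [ch h0] <-]].
  rewrite ePE_image => -[h ch <-]; rewrite coboundary_unhat -(unhat0 k.+1) => e; exists h => //.
  by split=> //; apply: unhat_inj e => //; apply: delta_supp; exact: ch.1.
split; last by rewrite coboundary_unhat h0 unhat0.
by rewrite ePE_image; exists h.
Qed.

Lemma coboundaries_image k :
  @coboundaries _ _ _ T G k = [set unhat k h | h in delta_coboundaries T k].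
Proof.
case: k => [|k] /=; first by rewrite image_set1 unhat0.
rewrite ePE_image; apply/seteqP; split=> [_ [_ [h ch <-] <-]|_ [_ [h ch <-] <-]].
  by exists (delta T h); [exists h|rewrite coboundary_unhat].
by exists (unhat k h); [exists h|rewrite coboundary_unhat].
Qed.

Lemma cycles_image k : @cycles _ _ _ T G k = [set unhat k h | h in partial_cycles T k].
Proof.
case: k => [|k] /=.
  rewrite ePE_image; apply/seteqP; split=> [_ [h ch <-]|_ [h [ch _] <-]]; exists h => //.
  (* In degree 0 every chain is a cycle: [h] vanishes in positive dimension, where all proper
     cofaces are. *)
  split=> //; apply/funext => x; rewrite /partial; case: asboolP => // Cx; rewrite big1 // => c _.
  have [->|/eps_neq0[_ e]] := eqVneq (eps c x) 0; first by [].
  have [->|/eqP/ch.1[_]] := eqVneq (h c) 0; first by rewrite mul0rz.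
  by rewrite e.
apply/seteqP; split=> [s []|_ [h [ch h0] <-]].
  rewrite ePE_image => -[h ch <-]; rewrite boundary_unhat -(unhat0 k) => e; exists h => //.
  by split=> //; apply: unhat_inj e => //; apply: partial_supp; exact: ch.1.
split; last by rewrite boundary_unhat h0 unhat0.
by rewrite ePE_image; exists h.
Qed.

Lemma boundaries_image k :
  @boundaries _ _ _ T G k = [set unhat k h | h in partial_boundaries T k].
Proof.
rewrite /boundaries ePE_image; apply/seteqP; split=> [_ [_ [h ch <-] <-]|_ [_ [h ch <-] <-]].
  by exists (partial T h); [exists h|rewrite boundary_unhat].
by exists (unhat k.+1 h); [exists h|rewrite boundary_unhat].
Qed.

Let kernel_submod k (D : (set E -> G^o) -> set E -> G^o) :
  (forall (a : G) g h, D (a *: g + h) = a *: D g + D h) ->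
  submod [set h | cochains T k h /\ D h = 0].
Proof.
move=> lin; have [c0 cD] := @cochains_submod _ _ _ T G k; split.
  by split=> //; have := lin (-1) 0 0; rewrite scaler0 addr0 scaleN1r addNr.
move=> a g h [cg g0] [ch h0]; split; first exact: cD.
by rewrite lin g0 h0 scaler0 addr0.
Qed.

Let image_submod k : (forall S : set (set E -> G^o), submod S -> submod [set unhat k h | h in S]).
Proof.
move=> S [S0 hS]; split; first by exists 0.
move=> a _ _ [g Sg <-] [h Sh <-]; exists (a *: g + h); first exact: hS.
exact: unhat_lin.
Qed.

Lemma cocycles_submod k : submod (@cocycles _ _ _ T G k).
Proof. by rewrite cocycles_image; apply/image_submod/kernel_submod/delta_lin. Qed.

Lemma coboundaries_submod k : submod (@coboundaries _ _ _ T G k).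
Proof.
rewrite coboundaries_image; apply: image_submod; case: k => [|k] /=.
  by split=> // a _ _ -> ->; rewrite scaler0 addr0.
have [c0 cD] := @cochains_submod _ _ _ T G k; split.
  by exists 0 => //; have := delta_lin T (-1 : G) 0 0; rewrite scaler0 addr0 scaleN1r addNr.
move=> a _ _ [g cg <-] [h ch <-]; exists (a *: g + h); first exact: cD.
exact: delta_lin.
Qed.

Lemma boundaries_submod k : submod (@boundaries _ _ _ T G k).
Proof.
rewrite boundaries_image; apply: image_submod.
have [c0 cD] := @cochains_submod _ _ _ T G k.+1; split.
  by exists 0 => //; have := partial_lin T (-1 : G) 0 0; rewrite scaler0 addr0 scaleN1r addNr.
move=> a _ _ [g cg <-] [h ch <-]; exists (a *: g + h); first exact: cD.
exact: partial_lin.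
Qed.

Lemma unhat_iso k (Z B : set (set E -> G^o)) : submod Z -> Z `<=` supp k -> B `<=` supp k ->
  iso_rel Z B [set unhat k h | h in Z] [set unhat k h | h in B].
Proof.
move=> [_ hZ] sZ sB; exists (fun h s => Z h /\ unhat k h = s); split.
- move=> h _ [Zh <-]; split=> //; first by exists h.
  by split=> [Bh|[g Bg] /unhat_inj <-//]; [exists h|exact: sB|exact: sZ].
- move=> a g _ h _ [Zg <-] [Zh <-]; split; [exact: hZ|exact: unhat_lin].
- by move=> h Zh; exists (unhat k h).
- by move=> _ [h Zh <-]; exists h.
Qed.

Lemma cocycles_iso k : iso_rel (delta_cocycles T k) (delta_coboundaries T k)
  (@cocycles _ _ _ T G k) (@coboundaries _ _ _ T G k).
Proof.
rewrite cocycles_image coboundaries_image; apply: unhat_iso.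
- exact/kernel_submod/delta_lin.
- by move=> h [[]].
case: k => [_ ->|k _ [h [sh _] <-]]; [exact: supp0|exact: delta_supp].
Qed.

Lemma cycles_iso k : iso_rel (partial_cycles T k) (partial_boundaries T k)
  (@cycles _ _ _ T G k) (@boundaries _ _ _ T G k).
Proof.
rewrite cycles_image boundaries_image; apply: unhat_iso.
- exact/kernel_submod/partial_lin.
- by move=> h [[]].
by move=> _ [h [sh _] <-]; exact: partial_supp.
Qed.

End Comparison.

Theorem theorem3p3 (R : realType) (d : nat) (L : Type)
    (T : polytopal_tiling R d L) (G : pzRingType)
    (hFLC : eFLC T)
    (K : nat) (hK : (0 < K)%N)
    (hdiv : forall c : set 'rV[R]_d,
       cells T c -> division_by G (iso_order T c K))
    (k : nat) (hk : (k <= d)%N) :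
  ePE_cohomology_iso_homology T G k (d - k)%N.
Proof.
apply: iso_rel_quotient; [exact: cocycles_submod|exact: coboundaries_submod|exact: boundaries_submod|].
apply: iso_rel_trans (iso_rel_sym (cocycles_iso _ _ _)) _.
by apply: iso_rel_trans (cell_duality hdiv (subnKC hk)) (cycles_iso _ _ _).
Qed.
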